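(* Let $a,b\in\mathbb R$, $a<b$, and let $P(x)$ be a real polynomial with $P(a)=P(b)=0$. Assume that all the real zeroes $x_i$, $i=1,\dots,s$, of $P$ belonging to the open interval $(a,b)$ are simple. Then $P(x)$ possesses Property (E) (with respect to $a,b$). In particular, it is definite on $[a,b]$.
   Context: Property (E) for a polynomial $P$ and points $a,b$ with $P(a)=P(b)=z_0$: there is a path $\Gamma\subset\mathbb C$ joining $a$ and $b$ (piecewise-smooth, with $\gamma=P(\Gamma)$ having only transversal self-intersections) such that $z_0$ is a simple point of $\gamma$ (i.e. $\gamma$ passes through $z_0$ only at its beginning and end) and $z_0$ is on the boundary of the unbounded component of $\mathbb C\setminus\gamma$. $P$ is definite on $[a,b]$ if for every polynomial $Q$ the vanishing of all the moments $\int_a^bP^k(x)Q(x)P'(x)\,dx$, $k\ge0$, implies that there are polynomials $\tilde P,\tilde Q,W$ with $P=\tilde P\circ W$, $Q=\tilde Q\circ W$, $W(a)=W(b)$. *)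

(* Defs.v *)
From HB Require Import structures.
From mathcomp Require Import all_boot all_order all_algebra.
From mathcomp Require Import complex.
From mathcomp Require Import all_classical all_reals all_analysis.

Set Implicit Arguments.
Unset Strict Implicit.
Unset Printing Implicit Defensive.

Import Order.TTheory GRing.Theory Num.Theory.
Import numFieldNormedType.Exports.

Local Open Scope classical_set_scope.
Local Open Scope ring_scope.
Local Open Scope complex_scope.

(* [R[i]] carries no topology by itself; [R[i]^o] is the same type, with the
   topology of the norm [`|z|]. *)

(* Derivation of complex-valued functions of a real variable is componentwise,
   since [R[i]] is not a normed module over [R] in the library. *)
Definition velocity (R : realType) (g : R -> R[i]) (t : R) : R[i] :=
  derive1 (fun u => complex.Re (g u)) t +i* derive1 (fun u => complex.Im (g u)) t.

Definition smooth (R : realType) (g : R -> R[i]) : Prop :=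
  forall (n : nat) (t : R),
    derivable (derive1n n (fun u => complex.Re (g u))) t 1 /\
    derivable (derive1n n (fun u => complex.Im (g u))) t 1.

(* Paths are parametrized by [0, 1]; their values outside [0, 1] are never
   used.  The breakpoints are [0 :: ts] with [ts] increasing and ending in 1.
   Smoothness up to the endpoints of a piece is expressed by a smooth extension
   of that piece to the whole line. *)
Definition piecewise_smooth (R : realType) (ts : seq R) (G : R -> R[i]) : Prop :=
  itv_partition 0 1 ts /\
  forall i : nat, (i < size ts)%N ->
    exists g : R -> R[i],
      [/\ smooth g,
          {in `[nth 0 (0 :: ts) i, nth 0 ts i], forall t, G t = g t} &
          {in `[nth 0 (0 :: ts) i, nth 0 ts i], forall t, velocity g t != 0}].

Definition transversal (R : realType) (v w : R[i]) : Prop :=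
  forall x y : R, x%:C * v + y%:C * w = 0 -> x = 0 /\ y = 0.

(* [g] is a closed curve, so the coincidence of its two ends is not counted as
   a self-intersection; the others must take place at smooth points. *)
Definition transversal_self_intersections (R : realType) (ts : seq R)
    (g : R -> R[i]) : Prop :=
  forall t u : R, 0 <= t -> t < u -> u <= 1 -> g t = g u ->
    ~ (t = 0 /\ u = 1) ->
    [/\ 0 < t, u < 1, t \notin ts, u \notin ts &
        transversal (velocity g t) (velocity g u)].

Definition boundary (T : topologicalType) (A : set T) : set T :=
  closure A `\` interior A.

Definition unbounded_component (R : realType) (K U : set R[i]^o) : Prop :=
  (exists2 z : R[i]^o, ~ K z & U = connected_component (~` K) z) /\
  ~ bounded_set U.

Definition property_E (R : realType) (P : {poly R[i]}) (a b : R[i]) : Prop :=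
  P.[a] = P.[b] /\
  exists (G : R -> R[i]) (ts : seq R),
    let gamma := fun t => P.[G t] in
    [/\ G 0 = a /\ G 1 = b,
        piecewise_smooth ts G,
        transversal_self_intersections ts gamma,
        forall t : R, 0 <= t <= 1 -> gamma t = P.[a] -> t = 0 \/ t = 1 &
        exists2 U : set R[i]^o,
          unbounded_component (gamma @` `[0, 1]) U & boundary U P.[a]].

(* Integral over the oriented segment from [a] to [b]. *)
Definition segment_integral (R : realType) (f : R[i] -> R[i]) (a b : R[i]) :
    R[i] :=
  let h := fun t : R => f (a + t%:C * (b - a)) * (b - a) in
  (\int[@lebesgue_measure R]_(t in `[0, 1]) complex.Re (h t)) +i*
  (\int[@lebesgue_measure R]_(t in `[0, 1]) complex.Im (h t)).

Definition definite (R : realType) (P : {poly R[i]}) (a b : R[i]) : Prop :=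
  forall Q : {poly R[i]},
    (forall k : nat,
       segment_integral (fun x => P.[x] ^+ k * Q.[x] * P^`().[x]) a b = 0) ->
    exists Pt Qt W : {poly R[i]},
      [/\ P = Pt \Po W, Q = Qt \Po W & W.[a] = W.[b]].

(* Main.v *)
Require Import Defs.
From HB Require Import structures.
From mathcomp Require Import all_boot all_order all_algebra.
From mathcomp Require Import complex polyXY.
From mathcomp Require Import all_classical all_reals all_analysis.
From mathcomp Require Import measurable_realfun.
From mathcomp Require polyorder polyrcf.
From mathcomp Require Import ring lra zify.

Set Implicit Arguments.
Unset Strict Implicit.
Unset Printing Implicit Defensive.

Import Order.TTheory GRing.Theory Num.Theory.
Import numFieldNormedType.Exports.

Local Open Scope classical_set_scope.
Local Open Scope ring_scope.
Local Open Scope complex_scope.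

(** The two assertions are proved independently of each other.

    Definiteness.  By Lueroth's theorem in polynomial form ([luroth]) the field
    [C(P, Q)] contains a polynomial [W] such that [P] and [Q] are polynomials in
    [W], and [W] is a quotient of two polynomials in [P] and [Q].  What has to be
    shown is [W(a) = W(b)].  The vanishing moments say that, for every level [y <> 0],
    the integral of [Q'] over the set [P < y] inside [[a, b]] depends only on the
    sign of [y] ([moments_below]).
    Let [y] tend to [0].  A simple zero of [P] in the interior contributes the
    value of [Q] on the corresponding branch of the inverse of [P], which is a
    power series in [y], the same for [y > 0] and [y < 0] ([below_near_root]).
    Hence the contributions of the two endpoints, which live on one side of [0]
    each, add up to such a series as well.  If [P] has the same sign near both
    endpoints, the levels of the other sign force the series to be zero, and [Q]
    agrees to every order at points near [a] and near [b] with the same value of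
    [P] ([ends_same_sign]); [W], being rational in [P] and [Q], then has the same
    limit at both endpoints.  If the signs are opposite, one series in [P]
    describes [Q] at both endpoints ([ends_opposite_sign]), and the value of [W]
    at either of them is that of one rational expression in the series
    ([opposite_value]).

    Property (E).  The path has to avoid the ray [slit] from [0] in the direction
    [- i] except at its ends; then the ray itself leads from [0] to infinity
    outside the curve ([slit_boundary]).  Near the real segment there is a curve
    from [a] to [b] with this property: slightly above or below the real axis,
    so that [Im P > 0] near every interior zero of [P], which is possible because
    these zeros are simple ([base_curve]); in addition it avoids the critical
    points of [P].  Close to such a curve local inverses of [P] exist
    ([local_inverse]), and they lift axis-parallel edges ([edge_lift]).  So the
    curve can be replaced by one whose image consists of edges that are
    alternately vertical and horizontal, with abscissas and heights chosen
    outside a finite set of bad values at each step ([extend]); transversality of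
    the self-intersections is then automatic.  The first piece is a short segment
    out of [a], tilted so that its image does not follow the real axis
    ([start_piece]), and the last one is a short real segment into [b]
    ([finish_piece]). *)


(** * Subfields generated by two polynomials *)

(** [N(P, Q)], for [N] a polynomial in two variables.  The quotients of such
    values form the field [F(P, Q)]. *)
Definition bieval (F : fieldType) (P Q : {poly F}) (N : {poly {poly F}}) :
    {poly F} :=
  (map_poly (comp_poly P) N).[Q].

Section BievalTheory.
Context {F : fieldType} (P Q : {poly F}).

Lemma bieval0 : bieval P Q 0 = 0.
Proof. by rewrite /bieval rmorph0 horner0. Qed.

Lemma bievalB N M : bieval P Q (N - M) = bieval P Q N - bieval P Q M.
Proof. by rewrite /bieval rmorphB hornerD hornerN. Qed.

Lemma bievalM N M : bieval P Q (N * M) = bieval P Q N * bieval P Q M.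
Proof. by rewrite /bieval rmorphM hornerM. Qed.

Lemma bievalC (p : {poly F}) : bieval P Q p%:P = p \Po P.
Proof. by rewrite /bieval map_polyC hornerC. Qed.

Lemma bievalX : bieval P Q 'X = Q.
Proof. by rewrite /bieval map_polyX hornerX. Qed.

End BievalTheory.

Section Gauss.
Context {F : closedFieldType}.
Implicit Types (G H : {poly {poly F}}) (e : {poly F}).

Local Notation eval_in c := (map_poly (horner_eval c)).

(** Over an algebraically closed field, this says that the coefficients of [G]
    have no common factor. *)
Definition primitive G := forall c : F, eval_in c G != 0.

Lemma eval_in_eq0 c G : eval_in c G = 0 ->
  exists G', G = ('X - c%:P) *: G'.
Proof.
move=> G0; exists (map_poly (fun a => a %/ ('X - c%:P)) G).
apply/polyP => i; rewrite coefZ coef_map_id0 ?div0p//.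
rewrite mulrC divpK// dvdp_XsubCl; apply/rootP.
by have := congr1 (fun u : {poly F} => u`_i) G0; rewrite coef_map coef0.
Qed.

Lemma eval_inZ c e G : eval_in c (e *: G) = e.[c] *: eval_in c G.
Proof. by apply/polyP => i; rewrite coefZ !coef_map coefZ /= /horner_eval hornerM. Qed.

Lemma eval_in_lift c (p : {poly F}) : eval_in c p^:P = p.
Proof. by apply/polyP => i; rewrite !coef_map /= /horner_eval hornerC. Qed.

Lemma eval_inC c (p : {poly F}) : eval_in c p%:P = p.[c]%:P.
Proof. by rewrite map_polyC. Qed.

(** Common linear factors of the coefficients are extracted one at a time; the
    degree of the leading coefficient bounds their number. *)
Lemma content_primitive G : G != 0 ->
  exists e G', [/\ e != 0, primitive G' & G = e *: G'].
Proof.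
have [n] := ubnP (size (lead_coef G)).
elim: n G => // n IH G ltGn G0.
have [prG|] := pselect (primitive G).
  by exists 1, G; split=> //; [exact: oner_neq0|rewrite scale1r].
move=> /existsNP[c /negP/negPn/eqP/eval_in_eq0[G' GE]].
have G'0 : G' != 0 by apply: contra_neq G0 => G'0; rewrite GE G'0 scaler0.
have c0 : 'X - c%:P != 0 by rewrite polyXsubC_eq0.
have [] := IH G' _ G'0.
  rewrite -ltnS (leq_trans _ ltGn)// ltnS GE lead_coefZ size_mul//; last first.
    by rewrite lead_coef_eq0.
  by rewrite size_XsubC addSn add1n.
move=> e [G'' [e0 prG'' G'E]]; exists (('X - c%:P) * e), G''; split=> //.
  by rewrite mulf_neq0.
by rewrite GE G'E scalerA.
Qed.

(** Gauss' lemma: the linear factors of [e] divide [H * G], hence [H], since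
    [G] stays nonzero when its coefficients are evaluated. *)
Lemma gauss_dvd e G H K : primitive G -> e != 0 -> e *: K = H * G ->
  exists H', K = H' * G.
Proof.
move=> prG; have [n] := ubnP (size e).
elim: n e H => // n IH e H len e0 eK.
have [/eqP/size_poly1P[k k0 ekE]|/closed_rootP[c]] := altP (size e =P 1%N).
  exists (k^-1%:P *: H); rewrite -scalerAl -eK ekE scalerA -polyCM mulVf//.
  by rewrite scale1r.
move=> ec; have := congr1 (eval_in c) eK.
rewrite eval_inZ (rootP ec) scale0r rmorphM => /esym/eqP; rewrite mulf_eq0.
rewrite (negPf (prG c)) orbF => /eqP/eval_in_eq0[H' HE].
have c0 : 'X - c%:P != 0 by rewrite polyXsubC_eq0.
have /dvdpP[e' eE] : 'X - c%:P %| e by rewrite dvdp_XsubCl.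
have e'0 : e' != 0 by apply: contra_neq e0 => e'0; rewrite eE e'0 mul0r.
apply: (IH e' H') => //.
  by rewrite -ltnS (leq_trans _ len)// ltnS eE size_mul// size_XsubC addn2.
have c0P : ('X - c%:P)%:P != 0 :> {poly {poly F}} by rewrite polyC_eq0.
apply: (mulfI c0P); rewrite !mul_polyC scalerA mulrC -eE eK HE.
by rewrite scalerAl.
Qed.

Lemma primitive_comp_sub (W : {poly F}) : (1 < size W)%N ->
  primitive (W^:P - W%:P).
Proof.
move=> W1 c; rewrite rmorphB /= eval_in_lift eval_inC.
rewrite -size_poly_gt0 size_polyDl ?(leq_trans _ W1)//.
by rewrite size_polyN (leq_ltn_trans (size_polyC_leq1 _)).
Qed.

(** If [W(t) - W(x)] divides [P(t) - P(x)], then [P] takes a single value on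
    each fibre of [W]; peeling off one factor [W - W(c)] at a time writes it as
    a polynomial in [W]. *)
Lemma comp_factor (W P : {poly F}) H : (1 < size W)%N ->
  P^:P - P%:P = H * (W^:P - W%:P) -> exists P', P = P' \Po W.
Proof.
move=> W1; have prW := primitive_comp_sub W1.
have [n] := ubnP (size P); elim: n P H => // n IH P H ltP PH.
have [P1|P1] := leqP (size P) 1%N.
  by exists P; rewrite (size1_polyC P1) comp_polyC.
pose W0 := W - W.[0]%:P; pose P0 := P - P.[0]%:P.
have [P1' P0E] : exists P1', P0 = P1' * W0.
  exists (eval_in 0 H).
  have := congr1 (eval_in 0) PH.
  by rewrite rmorphM !rmorphB /= !eval_in_lift !eval_inC.
have sW0 : size W0 = size W.
  by rewrite size_polyDl// size_polyN (leq_ltn_trans (size_polyC_leq1 _)).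
have sP0 : size P0 = size P.
  by rewrite size_polyDl// size_polyN (leq_ltn_trans (size_polyC_leq1 _)).
have W00 : W0 != 0 by rewrite -size_poly_gt0 sW0 ltnW.
have P00 : P0 != 0 by rewrite -size_poly_gt0 sP0 ltnW.
have P1'0 : P1' != 0 by apply: contra_neq P00; rewrite P0E => ->; rewrite mul0r.
have sP : size P = (size P1' + size W).-1.
  by rewrite -sP0 P0E size_mul// sW0.
have [] := @gauss_dvd W0 (W^:P - W%:P) (H - P1'^:P) (P1'^:P - P1'%:P) prW W00.
  rewrite mulrBl -PH -!mul_polyC.
  have -> : P = P1' * W0 + P.[0]%:P by rewrite -P0E /P0 addrNK.
  have -> : W^:P = W0^:P + W.[0]%:P%:P by rewrite -map_polyC -rmorphD /W0 subrK.
  have -> : W%:P = W0%:P + W.[0]%:P%:P by rewrite -rmorphD /W0 subrK.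
  by rewrite !(rmorphD, rmorphM) /= !map_polyC /=; ring.
move=> H' /IH [].
  by rewrite -ltnS (leq_trans _ ltP)// ltnS sP; lia.
move=> P'' P1E; exists (P'' * ('X - W.[0]%:P) + P.[0]%:P).
rewrite comp_polyD comp_polyM comp_polyB comp_polyX !comp_polyC -P1E -/W0.
by rewrite -P0E /P0 subrK.
Qed.

End Gauss.

Section Luroth.
Context {F : closedFieldType} (P Q : {poly F}).
Hypothesis P_gt1 : (1 < size P)%N.

Local Notation ev := (bieval P Q).

(* polynomials with coefficients in [F[P, Q]]; working with this ring instead
   of its fraction field keeps everything inside [{poly {poly F}}] *)
Let over (h : {poly {poly F}}) := forall i, exists N, h`_i = ev N.

Let overM c h : (exists N, c = ev N) -> over h -> over (c *: h).
Proof.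
move=> [N ->] oh i; have [M hM] := oh i.
by exists (N * M); rewrite coefZ hM bievalM.
Qed.

Let overB g h : over g -> over h -> over (g - h).
Proof.
move=> og oh i; have [M gM] := og i; have [N hN] := oh i.
by exists (M - N); rewrite coefB gM hN bievalB.
Qed.

Let overXn h n : over h -> over (h * 'X^n).
Proof.
move=> oh i; rewrite coefMXn; case: ifP => _; last exact: oh.
by exists 0; rewrite bieval0.
Qed.

Let over_map (R : {poly F}) : over R^:P.
Proof. by move=> i; exists (R`_i)%:P%:P; rewrite bievalC comp_polyC coef_map. Qed.

Let overC c : (exists N, c = ev N) -> over c%:P.
Proof.
move=> [N ->] i; rewrite coefC; case: ifP => _; first by exists N.
by exists 0; rewrite bieval0.
Qed.

Let evP : exists N, P = ev N.
Proof. by exists 'X%:P; rewrite bievalC comp_polyX. Qed.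

Let evQ : exists N, Q = ev N.
Proof. by exists 'X; rewrite bievalX. Qed.

Let evalXP (R : {poly F}) : (R^:P).['X] = R.
Proof. by rewrite -/(comp_poly 'X R) comp_polyXr. Qed.

(** A polynomial of least degree over [F[P, Q]] that vanishes at the variable:
    up to a factor, the minimal polynomial of [x] over [F(P, Q)]. *)
Let minimal_annihilator : exists G : {poly {poly F}},
  [/\ G != 0, over G & G.['X] = 0] /\
  forall h, over h -> h.['X] = 0 -> exists k H, lead_coef G ^+ k *: h = H * G.
Proof.
pose pr n := `[< exists G, [/\ G != 0, over G, G.['X] = 0 & size G = n] >].
have prP : exists n, pr n.
  exists (size (P^:P - P%:P)); apply/asboolP; exists (P^:P - P%:P); split=> //.
  - rewrite -size_poly_gt0 size_polyDl size_map_polyC ?(leq_trans _ P_gt1)//.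
    by rewrite size_polyN (leq_ltn_trans (size_polyC_leq1 _)).
  - by apply: overB; [exact: over_map|exact: overC].
  - by rewrite hornerD hornerN hornerC evalXP subrr.
have [n /asboolP[G [G0 oG GX sG]] minn] := ex_minnP prP.
exists G; split=> // h.
have [m] := ubnP (size h); elim: m h => // m IH h lthm oh hX.
have [sh|sh] := ltnP (size h) (size G).
  have -> : h = 0.
    apply/eqP/negPn/negP => h0; have : pr (size h) by apply/asboolP; exists h.
    by move/minn; rewrite -sG leqNgt sh.
  by exists 0%N, 0; rewrite scaler0 mul0r.
(* one step of pseudo-division by [G] *)
pose h' := lead_coef G *: h - lead_coef h *: (G * 'X^(size h - size G)).
have sG0 : (0 < size G)%N by rewrite size_poly_gt0.
have sh0 : (0 < size h)%N by rewrite (leq_trans sG0).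
have lth' : (size h' < size h)%N.
  rewrite -[in ltnRHS](prednK sh0) ltnS; apply/leq_sizeP => j.
  rewrite leq_eqVlt => /predU1P[<-|ltj].
    rewrite coefB !coefZ coefMXn ifF; last by lia.
    have -> : ((size h).-1 - (size h - size G) = (size G).-1)%N by lia.
    by rewrite -!lead_coefE mulrC subrr.
  rewrite coefB !coefZ coefMXn ifF; last by lia.
  have hj : (size h <= j)%N := leq_trans (leqSpred _) ltj.
  have Gj : (size G <= j - (size h - size G))%N.
    have le_sub m1 m2 : (m1 <= m2 <= j)%N -> (m1 <= j - (m2 - m1))%N by lia.
    by apply: le_sub; rewrite sh.
  by rewrite (nth_default 0 hj) (nth_default 0 Gj) !mulr0 subrr.
have [||| k [H HE]] := IH h'.
- exact: leq_trans lth' _.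
- apply: overB; apply: overM => //; [exact: oG|exact: oh|exact: overXn].
- by rewrite hornerD hornerN !hornerZ hornerM hX GX mul0r !mulr0 subrr.
exists k.+1, (H + lead_coef G ^+ k * lead_coef h *: 'X^(size h - size G)).
rewrite mulrDl -HE /h' scalerBr !scalerA -exprSr -scalerAl [_ * G]mulrC.
by rewrite subrK.
Qed.

(** The polynomial form of Lueroth's theorem: [F(P, Q)] is generated by a
    polynomial [W], and [P] and [Q] are polynomials in it.  The minimal
    polynomial of [x] over [F(P, Q)] is proportional to [W(t) - W(x)] for any
    of its coefficients [W] of largest degree, because both have the same degree
    in [x]. *)
Lemma luroth : exists W P' Q' N D, [/\ P = P' \Po W, Q = Q' \Po W,
  ev D != 0 & W * ev D = ev N].
Proof.
have [G [[G0 oG GX] Gdvd]] := minimal_annihilator.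
have [c [G1 [c0 prG1 GE]]] := content_primitive G0.
have dvdG1 h : over h -> h.['X] = 0 -> exists H, h = H * G1.
  move=> oh hX; have [k [H HE]] := Gdvd h oh hX.
  apply: (@gauss_dvd _ (lead_coef G ^+ k) G1 (c *: H)) => //.
    by rewrite expf_neq0// lead_coef_eq0.
  by rewrite HE GE -scalerAr scalerAl.
have dvdsub R : (exists N, R = ev N) -> exists H, R^:P - R%:P = H * G1.
  move=> RN; apply: dvdG1; first by apply: overB; [exact: over_map|exact: overC].
  by rewrite hornerD hornerN hornerC evalXP subrr.
have G1X : G1.['X] = 0.
  by have /eqP := GX; rewrite GE hornerZ mulf_eq0 (negPf c0) => /eqP.
have [P1 P1E] := dvdsub P evP.
have G10 : G1 != 0 by apply: contra_neq G0; rewrite GE => ->; rewrite scaler0.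
(* the leading coefficient of [P(t) - P(x)] in [t] is constant *)
have [l l0 leadG1] : exists2 l : F, l != 0 & lead_coef G1 = l%:P.
  have := congr1 lead_coef P1E.
  rewrite lead_coefM lead_coefDl; last first.
    rewrite size_polyN size_map_polyC.
    by rewrite (leq_ltn_trans (size_polyC_leq1 _)).
  rewrite lead_coef_map_inj//; last exact: polyC_inj.
  move=> /(congr1 (fun u : {poly F} => size u)).
  have lP0 : lead_coef P != 0 by rewrite lead_coef_eq0 -size_poly_gt0 ltnW.
  rewrite size_polyC lP0 => /esym/eqP; rewrite size_poly_eq1.
  rewrite -size_poly_eq1 size_mul_eq1 => /andP[_ /size_poly1P[l l0 lE]].
  by exists l.
have cE : exists D, lead_coef G = ev D by exact: oG.
have leadGE : lead_coef G = l%:P * c by rewrite GE lead_coefZ leadG1 mulrC.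
(* otherwise [x] would be a root of a nonzero polynomial over [F] *)
have sYG1 : (1 < sizeY G1)%N.
  rewrite ltnNge; apply/negP => sY.
  have GC : G1 = (\poly_(i < size G1) (G1`_i)`_0)^:P.
    apply/polyP => i; rewrite coef_map coef_poly.
    have GiC : G1`_i = ((G1`_i)`_0)%:P.
      by apply: size1_polyC; rewrite (leq_trans (max_size_coefXY _ _)).
    rewrite [LHS]GiC; congr (_%:P); case: ltnP => // hi.
    by rewrite (nth_default 0 hi) coef0.
  have /eqP := G1X; rewrite GC evalXP => /eqP W0.
  by move: G10; rewrite GC W0 map_poly0 eqxx.
have [j ltj sj] : exists2 j, (j < size G1)%N & size G1`_j = sizeY G1.
  have : (0 < #|'I_(size G1)|)%N by rewrite card_ord size_poly_gt0.
  rewrite /sizeY => /(bigop.eq_bigmax (fun i : 'I_(size G1) => size G1`_i))[j ->].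
  by exists j.
pose W := G1`_j.
have W1 : (1 < size W)%N by rewrite sj.
have [D DE] := cE; have [N NE] := oG j.
have WE : W * ev D = ev (l%:P%:P * N).
  rewrite bievalM bievalC comp_polyC -NE -DE leadGE GE coefZ -/W; ring.
have [H HE] : exists H, W^:P - W%:P = H * G1.
  have [||h hE] := dvdG1 (ev D *: W^:P - (ev (l%:P%:P * N))%:P).
  - by apply: overB; [apply: overM; [exists D|exact: over_map]|apply: overC; exists (l%:P%:P * N)].
  - by rewrite hornerD hornerN hornerC hornerZ evalXP -WE mulrC subrr.
  apply: (@gauss_dvd _ (ev D) G1 h) => //.
    by rewrite -DE lead_coef_eq0.
  by rewrite -hE -WE scalerBr [W * _]mulrC polyCM mul_polyC.
(* both sides have the same degree in [x], so [H] is a nonzero constant *)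
have W0 : W^:P - W%:P != 0.
  have := primitive_comp_sub W1 0; apply: contra_neq => ->.
  by rewrite map_poly0.
have H0 : H != 0.
  by apply: contra_neq W0; rewrite HE => ->; rewrite mul0r.
have sYW : sizeY (W^:P - W%:P) = size W.
  have swapE : swapXY (W^:P - W%:P) = - (W^:P - W%:P).
    have -> : swapXY (W^:P - W%:P) = swapXY W^:P - swapXY W%:P := swapXY_is_zmod_morphism _ _.
    by rewrite swapXY_map_polyC swapXY_polyC opprB.
  rewrite sizeYE swapE size_polyN.
  rewrite size_polyDl size_map_polyC// size_polyN.
  by rewrite (leq_ltn_trans (size_polyC_leq1 _)).
have [k k0 HC] : exists2 k : F, k != 0 & H = k%:P%:P.
  have sH : size (swapXY H) = 1%N.
    have sHG : (size (swapXY H) + size (swapXY G1)).-1 = size W.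
      by rewrite -sYW HE sizeYE rmorphM size_mul ?swapXY_eq0.
    have sG1 : size (swapXY G1) = size W by rewrite -sizeYE -sj.
    have sH0 : (0 < size (swapXY H))%N by rewrite size_poly_gt0 swapXY_eq0.
    by move: sHG sG1 sH0 W1; lia.
  have [h HhE] : exists h : {poly F}, H = h^:P.
    exists (swapXY H)`_0; rewrite -swapXY_polyC -[LHS]swapXYK; congr swapXY.
    by apply: size1_polyC; rewrite sH.
  have h0 : h != 0 by apply: contra_neq H0 => h0; rewrite HhE h0 map_poly0.
  (* a root [y] of [h] would make [W(t) - W(x)] vanish at [t = y] *)
  have [s1|/closed_rootP[y /rootP hy]] := altP (size h =P 1%N).
    have /eqP/size_poly1P[k k0 hE] := s1.
    by exists k => //; rewrite HhE hE map_polyC.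
  have := congr1 (fun u : {poly {poly F}} => u.[y%:P]) HE.
  rewrite HhE hornerM hornerD hornerN hornerC.
  have hor (R : {poly F}) : (R^:P).[y%:P] = (R.[y])%:P by rewrite -horner_map.
  rewrite !hor hy mul0r => /eqP; rewrite subr_eq0 => /eqP WC.
  by move: W1; rewrite -WC ltnNge size_polyC_leq1.
have fac R : (exists N, R = ev N) -> exists R', R = R' \Po W.
  move=> /dvdsub[M ME]; apply: (@comp_factor _ W R (k^-1%:P%:P * M)) => //.
  by rewrite HE HC mulrACA -ME -!polyCM mulVf// mul1r.
have [P' PE] := fac P evP; have [Q' QE] := fac Q evQ.
by exists W, P', Q', (l%:P%:P * N), D; split=> //; rewrite -DE lead_coef_eq0.
Qed.

End Luroth.

(** * Polynomials near a point *)

Section PolynomialEstimates.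
Context {K : numFieldType}.
Implicit Types (p : {poly K}) (x y z : K).

Lemma horner_bounded p (B : K) :
  exists2 M, 0 <= M & forall x, `|x| <= B -> `|p.[x]| <= M.
Proof.
elim/poly_ind: p => [|p c [M M0 pM]].
  by exists 0 => // x _; rewrite horner0 normr0.
have [B0|B0] := boolP (0 <= B); last first.
  exists 0 => // x xB; move: B0; rewrite (le_trans _ xB)//.
exists (M * B + `|c|) => [|x xB]; first by rewrite addr_ge0// mulr_ge0.
rewrite hornerMXaddC (le_trans (ler_normD _ _))// lerD2r normrM.
by rewrite ler_pM// pM.
Qed.

(** Uniform differentiability: both the injectivity of a polynomial near a
    regular point and the linear behaviour of its inverse follow from it. *)
Lemma horner_second_order p z : exists2 M, 0 <= M & forall x y,
  `|x - z| <= 1 -> `|y - z| <= 1 ->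
  `|p.[x] - p.[y] - p^`().[z] * (x - y)| <=
    M * (`|x - z| + `|y - z|) * `|x - y|.
Proof.
elim/poly_ind: p => [|p c [M M0 pM]].
  exists 0 => // x y _ _.
  by rewrite deriv0 !horner0 mul0r !subr0 normr0 !mul0r.
pose b := `|p^`().[z]|.
have b0 : 0 <= b by exact: normr_ge0.
exists ((1 + `|z|) * M + b + (M + b)) => [|x y xz yz].
  by rewrite !(addr_ge0, mulr_ge0)//.
rewrite !hornerMXaddC derivD derivC addr0 derivM derivX mulr1 hornerD hornerMX.
have -> : p.[x] * x + c - (p.[y] * y + c) - (p^`().[z] * z + p.[z]) * (x - y) =
  x * (p.[x] - p.[y] - p^`().[z] * (x - y)) + (x - z) * p^`().[z] * (x - y)
  + (p.[y] - p.[z]) * (x - y) by ring.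
have py : `|p.[y] - p.[z]| <= (M + b) * `|y - z|.
  rewrite -[p.[y] - _](subrK (p^`().[z] * (y - z))).
  rewrite (le_trans (ler_normD _ _))// normrM mulrDl lerD2r.
  rewrite (le_trans (pM y z _ _))// ?subrr ?normr0 ?ler01// addr0.
  by rewrite -mulrA ler_wpM2l// ler_piMr.
have x1 : `|x| <= 1 + `|z|.
  by rewrite -[x](subrK z) (le_trans (ler_normD _ _))// lerD2r.
apply: (le_trans (ler_normD _ _)).
rewrite [leRHS](_ : _ =
  ((1 + `|z|) * (M * (`|x - z| + `|y - z|)) + b * (`|x - z| + `|y - z|))
   * `|x - y| + ((M + b) * (`|x - z| + `|y - z|)) * `|x - y|); last by ring.
rewrite lerD//; last first.
  rewrite normrM ler_wpM2r// (le_trans py)// ler_wpM2l ?addr_ge0//.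
  by rewrite lerDr.
apply: (le_trans (ler_normD _ _)); rewrite [leRHS]mulrDl lerD//.
  by rewrite normrM -mulrA ler_pM// pM.
rewrite !normrM ler_wpM2r// mulrC ler_wpM2l//.
by rewrite lerDl.
Qed.

Lemma horner_lipschitz p z : exists2 M, 0 <= M & forall x,
  `|x - z| <= 1 -> `|p.[x] - p.[z]| <= M * `|x - z|.
Proof.
have [M M0 pM] := horner_second_order p z.
exists (M + `|p^`().[z]|) => [|x xz]; first by rewrite addr_ge0.
rewrite -[p.[x] - _](subrK (p^`().[z] * (x - z))).
rewrite (le_trans (ler_normD _ _))// normrM mulrDl lerD2r.
rewrite (le_trans (pM x z _ _))// ?subrr ?normr0 ?ler01// addr0.
by rewrite -mulrA ler_wpM2l// ler_piMr.
Qed.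

Lemma horner_near p z (e : K) : 0 < e ->
  exists2 d, 0 < d <= 1 & forall x, `|x - z| <= d -> `|p.[x] - p.[z]| < e.
Proof.
move=> e0; have [M M0 pM] := horner_lipschitz p z.
have Me0 : 0 < M + 1 + e by rewrite addr_gt0// ltr_wpDl.
exists (e / (M + 1 + e)) => [|x xd].
  by rewrite divr_gt0//= ler_pdivrMr// mul1r lerDr addr_ge0.
have x1 : `|x - z| <= 1.
  by rewrite (le_trans xd)// ler_pdivrMr// mul1r lerDr addr_ge0.
rewrite (le_lt_trans (pM _ x1))// (le_lt_trans (ler_wpM2l M0 xd))//.
by rewrite mulrCA gtr_pMr// ltr_pdivrMr// mul1r -addrA ltrDl addr_gt0.
Qed.

Lemma horner_neq0_near p z : p.[z] != 0 ->
  exists2 d, 0 < d <= 1 & forall x, `|x - z| <= d -> p.[x] != 0.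
Proof.
rewrite -normr_gt0 => pz0; have [d d01 pd] := horner_near p z pz0; exists d => // x /pd.
by apply: contraTneq => ->; rewrite sub0r normrN ltxx.
Qed.

Lemma root_isolated p z : p != 0 ->
  exists2 d, 0 < d <= 1 & forall x, x != z -> `|x - z| <= d -> p.[x] != 0.
Proof.
move=> p0; have [m [q]] := multiplicity_XsubC p z.
rewrite p0/= => qz ->; have [d d01 qd] := horner_neq0_near qz.
exists d => // x xz xd; rewrite hornerM mulf_neq0 ?qd// hornerE.
by rewrite expf_neq0// hornerXsubC subr_eq0.
Qed.

End PolynomialEstimates.

(** * Induction along a segment *)

(** Segments are connected: both the set of points where [Q] holds and its
    complement in the segment are open. *)
Lemma local_propagation (R : realType) (l r : R) (Q : R -> Prop) : l <= r ->
  (forall x, l <= x <= r -> exists2 d, 0 < d &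
    forall y z, l <= y <= r -> l <= z <= r -> `|y - x| < d -> `|z - x| < d ->
      Q y -> Q z) ->
  Q l -> Q r.
Proof.
move=> lr loc Ql.
pose A : set R := `[l, r]%classic; pose B : set R := A `&` [set x | Q x].
pose nearQ (P : R -> Prop) := [set y : R | exists x d, [/\ 0 < d, `|y - x| < d
  & forall z, l <= z <= r -> `|z - x| < d -> P z]].
have nearQ_open P : open (nearQ P).
  rewrite openE => y [x [d [d0 yx xP]]].
  apply/nbhs_ballP; exists (d - `|y - x|); first by rewrite /= subr_gt0.
  move=> z /=; rewrite /ball/= => yz; exists x, d; split=> //.
  rewrite -(subrK y z) -addrA (le_lt_trans (ler_normD _ _))//.
  by rewrite -ltrBrDr distrC.
have AE y : A y = (l <= y <= r) :> Prop by rewrite /A /= in_itv.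
have near_self P x : (forall y z, l <= y <= r -> l <= z <= r ->
    `|y - x| < P.1 -> `|z - x| < P.1 -> P.2 y -> P.2 z) -> 0 < P.1 ->
    l <= x <= r -> P.2 x -> nearQ P.2 x.
  move=> H d0 Ax Px; exists x, P.1; split=> //; first by rewrite subrr normr0.
  by move=> z Az zx; apply: (H x) => //; rewrite subrr normr0.
suff BA : B = A.
  have : A r by rewrite AE lexx lr.
  by rewrite -BA => -[].
apply: (@segment_connected R l r).
- by exists l; split=> //; rewrite AE lexx lr.
- exists (nearQ Q) => //; apply/seteqP; split=> x [Ax Hx]; split=> //.
    have Ax' : l <= x <= r by rewrite -AE.
    have [d d0 Hd] := loc x Ax'.
    exact: (near_self (d, Q)).
  by case: Hx => y [d [d0 xy HQ]]; apply: HQ => //; rewrite -AE.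
exists (~` nearQ (fun x => ~ Q x)); first exact: open_closedC.
apply/seteqP; split=> x [Ax Hx]; split=> //.
  by move=> [y [d [d0 xy HQ]]]; apply: (HQ x) => //; rewrite -AE.
apply: contrapT => nQx; apply: Hx.
have Ax' : l <= x <= r by rewrite -AE.
have [d d0 Hd] := loc x Ax'.
apply: (near_self (d, fun x => ~ Q x)) => //= y z Ay Az yx zx nQy Qz.
exact: nQy (Hd z y Az Ay zx yx Qz).
Qed.

(** * The modulus as a real number *)

Section ComplexModulus.
Context {R : realType}.
Local Notation C := R[i].
Implicit Types (z w : C) (p : {poly C}).

(** The order on [R[i]] is partial; estimates are done with the modulus taken
    in [R]. *)
Definition cabs z : R := complex.Re `|z|.

Lemma normCE z : `|z| = (cabs z)%:C.
Proof. by rewrite /cabs normc_def. Qed.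

Lemma ge0_ReE z : 0 <= z -> z = (complex.Re z)%:C.
Proof. by case: z => x y; rewrite lecE /= => /andP[/eqP -> _]. Qed.

Lemma cabs_ge0 z : 0 <= cabs z.
Proof. by rewrite -lecR -normCE; exact: normr_ge0. Qed.

Lemma cabsD z w : cabs (z + w) <= cabs z + cabs w.
Proof. by rewrite -lecR rmorphD /= -!normCE ler_normD. Qed.

Lemma cabsM z w : cabs (z * w) = cabs z * cabs w.
Proof. by apply: complexI; rewrite rmorphM /= -!normCE normrM. Qed.

Lemma cabsN z : cabs (- z) = cabs z.
Proof. by apply: complexI; rewrite -!normCE normrN. Qed.

Lemma cabsBC z w : cabs (z - w) = cabs (w - z).
Proof. by rewrite -cabsN opprB. Qed.

Lemma cabsB z w : cabs (z - w) <= cabs z + cabs w.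
Proof. by rewrite -(cabsN w) cabsD. Qed.

Lemma cabs_triangle u z w : cabs (z - w) <= cabs (z - u) + cabs (u - w).
Proof. by rewrite -[z - w](subrKA u) cabsD. Qed.

Lemma cabsX z n : cabs (z ^+ n) = cabs z ^+ n.
Proof. by apply: complexI; rewrite rmorphXn /= -!normCE normrX. Qed.

Lemma cabs0 : cabs 0 = 0.
Proof. by rewrite /cabs normr0. Qed.

Lemma cabs_eq0 z : (cabs z == 0) = (z == 0).
Proof. by rewrite -(inj_eq (@complexI R)) -normCE normr_eq0. Qed.

Lemma cabs_gt0 z : (0 < cabs z) = (z != 0).
Proof. by rewrite lt_neqAle cabs_ge0 andbT eq_sym cabs_eq0. Qed.

Lemma cabs_real (x : R) : cabs x%:C = `|x|.
Proof. by rewrite /cabs normc_def /= expr0n addr0 sqrtr_sqr. Qed.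

Lemma cabs_imag (x : R) : cabs (0 +i* x) = `|x|.
Proof. by rewrite /cabs normc_def /= expr0n add0r sqrtr_sqr. Qed.

Lemma cabs_Re z : `|complex.Re z| <= cabs z.
Proof.
rewrite /cabs normc_def /= -sqrtr_sqr ler_wsqrtr// lerDl; exact: sqr_ge0.
Qed.

Lemma cabs_Im z : `|complex.Im z| <= cabs z.
Proof.
rewrite /cabs normc_def /= -sqrtr_sqr ler_wsqrtr// lerDr; exact: sqr_ge0.
Qed.

Lemma cabs_le_ReIm z : cabs z <= `|complex.Re z| + `|complex.Im z|.
Proof.
have zE : z = (complex.Re z)%:C + (0 +i* complex.Im z).
  by case: z => x y; apply/eqP; rewrite eq_complex /= addr0 add0r !eqxx.
by rewrite {1}zE (le_trans (cabsD _ _))// cabs_real cabs_imag.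
Qed.

Lemma cabs_sq z : cabs z ^+ 2 = complex.Re z ^+ 2 + complex.Im z ^+ 2.
Proof.
by rewrite /cabs normc_def /= sqr_sqrtr// addr_ge0// sqr_ge0.
Qed.

Lemma bounded_cabs p (B : R) :
  exists2 M, 0 <= M & forall z, cabs z <= B -> cabs p.[z] <= M.
Proof.
have [M M0 pM] := horner_bounded p B%:C.
exists (complex.Re M) => [|z zB]; first by rewrite -lecR -ge0_ReE.
by rewrite -lecR -normCE -ge0_ReE// pM// normCE lecR.
Qed.

Lemma second_order_cabs p z : exists2 M, 0 <= M & forall x y,
  cabs (x - z) <= 1 -> cabs (y - z) <= 1 ->
  cabs (p.[x] - p.[y] - p^`().[z] * (x - y)) <=
    M * (cabs (x - z) + cabs (y - z)) * cabs (x - y).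
Proof.
have [M M0 pM] := horner_second_order p z.
exists (complex.Re M) => [|x y xz yz]; first by rewrite -lecR -ge0_ReE.
rewrite -lecR -normCE !rmorphM rmorphD /= -!normCE -ge0_ReE//.
by apply: pM; rewrite normCE -[1]/(1%:C) lecR.
Qed.

Let real_radius (d : C) : 0 < d <= 1 -> d = (complex.Re d)%:C /\ 0 < complex.Re d <= 1.
Proof.
move=> /andP[d0 d1]; have dE := ge0_ReE (ltW d0); split=> //.
by move: d0 d1; rewrite {1 2}dE -[1]/(1%:C) -[0]/(0%:C) ltcR lecR => -> ->.
Qed.

Lemma near_cabs p z (e : R) : 0 < e -> exists2 d, 0 < d <= 1 &
  forall x, cabs (x - z) <= d -> cabs (p.[x] - p.[z]) < e.
Proof.
move=> e0; have [|d /real_radius[dE d01] pd] := @horner_near _ p z e%:C.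
  by rewrite -[0]/(0%:C) ltcR.
exists (complex.Re d) => // x xz; rewrite -ltcR -normCE; apply: pd.
by rewrite dE normCE lecR.
Qed.

Lemma neq0_near_cabs p z : p.[z] != 0 -> exists2 d, 0 < d <= 1 &
  forall x, cabs (x - z) <= d -> p.[x] != 0.
Proof.
move=> /horner_neq0_near[d /real_radius[dE d01] pd].
by exists (complex.Re d) => // x xz; apply: pd; rewrite dE normCE lecR.
Qed.

Lemma isolated_cabs p z : p != 0 -> exists2 d, 0 < d <= 1 &
  forall x, x != z -> cabs (x - z) <= d -> p.[x] != 0.
Proof.
move=> /(root_isolated z)[d /real_radius[dE d01] pd].
by exists (complex.Re d) => // x xnz xz; apply: pd; rewrite // dE normCE lecR.
Qed.

End ComplexModulus.

(** * Vanishing moments and sublevel sets *)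

Section SublevelIntegrals.
Context {R : realType}.
Implicit Types (p q f g : {poly R}) (x y l r : R).
Local Notation mu := (@lebesgue_measure R).

Lemma integrable_horner f l r :
  mu.-integrable `[l, r] (EFin \o (fun x => f.[x])).
Proof.
apply: (@continuous_compact_integrable R (horner f) `[l, r]%classic).
  exact: segment_compact.
by apply: continuous_subspaceT => x; exact: continuous_horner.
Qed.

Lemma integral_deriv f l r : l <= r ->
  \int[mu]_(x in `[l, r]) f^`().[x] = f.[r] - f.[l].
Proof.
rewrite le_eqVlt => /predU1P[->|lr].
  by rewrite set_itv1 Rintegral_set1 subrr.
rewrite /Rintegral (@continuous_FTC2 R (horner f^`()) (horner f))//.
- by apply: continuous_subspaceT => x; exact: continuous_horner.
- split.
  + by move=> x _; exact: derivable_horner.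
  + by apply: cvg_at_right_filter; exact: continuous_horner.
  + by apply: cvg_at_left_filter; exact: continuous_horner.
- by move=> x _; rewrite derivE.
Qed.

(** As a function of [y] this is the distribution function of the image under
    [p] of the measure [q'(x) dx] on [[l, r]]; it is all that moments against
    powers of [p] can see. *)
Definition below p q l r y : R :=
  \int[mu]_(x in `[l, r]) (\1_[set x | p.[x] < y] x * q^`().[x]).

Let measurable_sublevel p y : measurable [set x : R | p.[x] < y].
Proof.
apply: open_measurable.
have -> : [set x : R | p.[x] < y] = horner p @^-1` `]-oo, y[.
  by apply/seteqP; split => x /=; rewrite in_itv.
by apply: open_comp => // x _; exact: continuous_horner.
Qed.

Lemma integrable_below p q l r y : mu.-integrable `[l, r]
  (EFin \o (fun x => \1_[set x | p.[x] < y] x * q^`().[x])).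
Proof.
apply: (le_integrable _ _ _ (integrable_horner q^`() l r)) => //=.
  apply/measurable_EFinP; apply: measurable_funM.
    by apply: measurable_indic; exact: measurable_sublevel.
  exact: measurable_poly.
move=> x _; rewrite lee_fin normrM ler_piMl// indicE ger0_norm//.
by case: (_ \in _).
Qed.

Lemma below_split p q l m r y : l <= m <= r ->
  below p q l r y = below p q l m y + below p q m r y.
Proof.
move=> /andP[lm mr]; apply/eqP; rewrite addrC -subr_eq; apply/eqP.
rewrite /below (Rintegral_itvB (integrable_below p q l r y)) ?bnd_simp//.
rewrite Rintegral_itv_obnd_cbnd//.
apply: integrableS (integrable_below p q m r y) => //.
exact: subset_itv_oc_cc.
Qed.

Let integral_cc_oo (h : R -> R) l r : mu.-integrable `[l, r] (EFin \o h) ->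
  \int[mu]_(x in `[l, r]) h x = \int[mu]_(x in `]l, r[) h x.
Proof.
move=> hi; rewrite -Rintegral_itv_obnd_cbnd ?Rintegral_itv_bndo_bndc//.
  by apply: integrableS hi => //; exact: subset_itv_oo_cc.
by apply: integrableS hi => //; exact: subset_itv_oc_cc.
Qed.

Lemma below_full p q l r y : l <= r ->
  (forall x, l < x < r -> p.[x] < y) -> below p q l r y = q.[r] - q.[l].
Proof.
rewrite le_eqVlt => /predU1P[->|lr] py.
  by rewrite /below set_itv1 Rintegral_set1 subrr.
rewrite -integral_deriv ?(ltW lr)// /below.
rewrite (integral_cc_oo (integrable_below _ _ _ _ _)).
rewrite (integral_cc_oo (integrable_horner _ _ _)).
apply: eq_Rintegral => x; rewrite inE/= in_itv/= => lxr.
by rewrite indicE mem_set ?mul1r//=; exact: py.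
Qed.

Lemma below_empty p q l r y : l <= r ->
  (forall x, l < x < r -> y <= p.[x]) -> below p q l r y = 0.
Proof.
rewrite le_eqVlt => /predU1P[->|lr] py.
  by rewrite /below set_itv1 Rintegral_set1.
rewrite /below (integral_cc_oo (integrable_below _ _ _ _ _)).
have -> : (0 : R) = \int[mu]_(x in `]l, r[) 0 by rewrite Rintegral_cst// mul0r.
apply: eq_Rintegral => x; rewrite inE/= in_itv/= => lxr.
rewrite indicE memNset ?mul0r//=; apply/negP.
by rewrite -leNgt; exact: py.
Qed.

Lemma integral_hornerD f g l r : \int[mu]_(x in `[l, r]) (f + g).[x] =
  \int[mu]_(x in `[l, r]) f.[x] + \int[mu]_(x in `[l, r]) g.[x].
Proof.
rewrite -RintegralD//; try exact: integrable_horner.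
by apply: eq_Rintegral => x _; rewrite hornerD.
Qed.

Lemma integral_hornerZ (c : R) f l r : \int[mu]_(x in `[l, r]) (c *: f).[x] =
  c * \int[mu]_(x in `[l, r]) f.[x].
Proof.
rewrite -RintegralZl//; last exact: integrable_horner.
by apply: eq_Rintegral => x _; rewrite hornerZ.
Qed.

Let bernoulli (t : R) n : -1 <= t -> 1 + t *+ n <= (1 + t) ^+ n.
Proof.
move=> t1; elim: n => [|n IH]; first by rewrite mulr0n addr0.
rewrite exprS (le_trans _ (ler_wpM2l _ IH))//; last by lra.
rewrite -[t *+ n.+1]mulr_natr -[t *+ n]mulr_natr -natr1; have := mulr_ge0 (ler0n R n) (sqr_ge0 t); lra.
Qed.

(* [(1 - u^n)^(2^n)] tends to the indicator of [u < 1/2] *)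
Let step_lt (u : R) : 0 <= u -> u < 2^-1 ->
  (fun n => (1 - u ^+ n) ^+ (2 ^ n)) @ \oo --> (1 : R).
Proof.
move=> u0 u2; apply: (@squeeze_cvgr _ _ _ _ (fun n => 1 - (2 * u) ^+ n)
  (fun=> 1)); last 2 first.
- rewrite -[X in _ --> X](subr0 1); apply: cvgB; first exact: cvg_cst.
  by apply: cvg_expr; rewrite ger0_norm; lra.
- exact: cvg_cst.
near=> n.
have un : 0 <= u ^+ n <= 1.
  by rewrite exprn_ge0//= exprn_ile1//; lra.
rewrite exprn_ile1 ?andbT; [|lra|lra].
have := @bernoulli (- u ^+ n) (2 ^ n)%N; rewrite lerN2; case/andP: un => _ -> /(_ isT).
by rewrite exprMn -natrX mulr_natl mulNrn.
Unshelve. all: by end_near. Qed.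

Let step_gt (u : R) : 2^-1 < u -> u <= 1 ->
  (fun n => (1 - u ^+ n) ^+ (2 ^ n)) @ \oo --> (0 : R).
Proof.
move=> u2 u1; apply: (@squeeze_cvgr _ _ _ _ (fun=> 0)
  (fun n => (2 * u)^-1 ^+ n)); last 2 first.
- exact: cvg_cst.
- apply: cvg_expr; rewrite ger0_norm ?invr_ge0; last by lra.
  by rewrite invf_lt1; lra.
near=> n.
have un : 0 <= u ^+ n <= 1 by rewrite exprn_ge0 ?exprn_ile1//; lra.
case/andP: un => un0 un1.
have t0 : 0 <= (1 - u ^+ n) ^+ (2 ^ n) by rewrite exprn_ge0//; lra.
rewrite t0/= exprVn -[leRHS]mul1r ler_pdivlMr; last by rewrite exprn_gt0; lra.
rewrite exprMn -natrX.
(* [(1 - t)^m * m * t <= (1 - t)^m * (1 + t)^m <= 1] for [t = u^n] *)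
have le1 : (1 - u ^+ n) ^+ (2 ^ n) * (1 + u ^+ n) ^+ (2 ^ n) <= 1.
  rewrite -exprMn exprn_ile1//; last by have := sqr_ge0 (u ^+ n); lra.
  have : 0 <= u ^+ n * (1 - u ^+ n) by rewrite mulr_ge0//; lra.
  by lra.
apply: le_trans le1; rewrite ler_wpM2l//.
have := @bernoulli (u ^+ n) (2 ^ n)%N.
have -> : -1 <= u ^+ n by lra.
move=> /(_ isT); apply: le_trans; rewrite -[u ^+ n *+ _]mulr_natl.
by rewrite lerDr.
Unshelve. all: by end_near. Qed.

(** Integration by parts turns moments of [q p'] into integrals of [q'] against
    polynomials in [p]; the boundary term survives because [p] vanishes at both
    ends. *)
Lemma moment_comp p q : p.[0] = 0 -> p.[1] = 0 ->
  (forall k, \int[mu]_(x in `[0, 1]) (p ^+ k * q * p^`()).[x] = 0) ->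
  forall g, \int[mu]_(x in `[0, 1]) ((g \Po p) * q^`()).[x] =
    g.[0] * (q.[1] - q.[0]).
Proof.
move=> p0 p1 mom g.
have zero h k :
    \int[mu]_(x in `[0, 1]) ((h \Po p) * (p ^+ k * q * p^`())).[x] = 0.
  elim/poly_ind: h k => [|h c IH] k.
    by rewrite comp_poly0 mul0r; under eq_Rintegral do rewrite horner0;
      rewrite Rintegral_cst// mul0r.
  rewrite comp_polyD comp_polyM comp_polyX comp_polyC mulrDl integral_hornerD.
  rewrite mul_polyC integral_hornerZ mom mulr0 addr0.
  have -> : (h \Po p) * p * (p ^+ k * q * p^`()) =
    (h \Po p) * (p ^+ k.+1 * q * p^`()) by rewrite exprS; ring.
  exact: IH.
have := @integral_deriv ((g \Po p) * q) 0 1 ler01.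
rewrite derivM deriv_comp integral_hornerD.
have := zero g^`() 0%N; rewrite expr0 mul1r [q * _]mulrC mulrA => ->.
by rewrite add0r => ->; rewrite !hornerM !horner_comp p0 p1 mulrBr.
Qed.

(** Polynomials in [p] approximate the indicator of [p < y], so the vanishing
    moments determine the integral of [q'] over each sublevel set. *)
Lemma moments_below p q : p.[0] = 0 -> p.[1] = 0 ->
  (forall k, \int[mu]_(x in `[0, 1]) (p ^+ k * q * p^`()).[x] = 0) ->
  forall y, y != 0 -> below p q 0 1 y = (0 < y)%R%:R * (q.[1] - q.[0]).
Proof.
move=> p0 p1 mom y y0.
have [M0 M00 pM0] := horner_bounded p 1.
pose M := M0 + `|y|.
have M_gt0 : 0 < M by rewrite ltr_wpDl// normr_gt0.
have pM x : 0 <= x <= 1 -> `|p.[x] - y| <= M.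
  case/andP=> x0 x1; rewrite (le_trans (ler_normB _ _))// lerD2r pM0//.
  by rewrite ger0_norm.
(* an affine change of variable that maps the values of [p] into [[0, 1]] and
   the level [y] to [1/2] *)
pose U : {poly R} := (2^-1 - y / (2 * M))%:P + (2 * M)^-1 *: 'X.
have UE z : U.[z] = 2^-1 + (z - y) / (2 * M).
  by rewrite hornerD hornerC hornerZ hornerX; ring.
have Uitv x : 0 <= x <= 1 -> 0 <= U.[p.[x]] <= 1.
  move=> /pM; rewrite ler_norml UE => /andP[h1 h2].
  have : - 2^-1 <= (p.[x] - y) / (2 * M) <= 2^-1.
    rewrite ler_pdivlMr ?ler_pdivrMr ?mulr_gt0//.
    by apply/andP; split; lra.
  by case/andP; lra.
have Ult z : (U.[z] < 2^-1) = (z < y).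
  by rewrite UE gtrDl pmulr_llt0 ?invr_gt0 ?mulr_gt0// subr_lt0.
have Ugt z : (2^-1 < U.[z]) = (y < z).
  by rewrite UE ltrDl pmulr_lgt0 ?invr_gt0 ?mulr_gt0// subr_gt0.
pose G n : {poly R} := (1 - U ^+ n) ^+ (2 ^ n).
have GE n z : (G n).[z] = (1 - U.[z] ^+ n) ^+ (2 ^ n).
  by rewrite /G horner_exp hornerD hornerN horner_exp hornerC.
have lim1 : (fun n => \int[mu]_(x in `[0, 1]) ((G n \Po p) * q^`()).[x])
    @ \oo --> (0 < y)%R%:R * (q.[1] - q.[0]).
  have -> : (fun n => \int[mu]_(x in `[0, 1]) ((G n \Po p) * q^`()).[x])
      = (fun n => (G n).[0] * (q.[1] - q.[0])).
    by apply/funext => n; rewrite moment_comp.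
  have U0 : 0 <= U.[0] <= 1 by rewrite -[in U.[0]]p0 Uitv// lexx ler01.
  apply: cvgMl; under eq_fun do rewrite GE.
  case: (ltgtP y 0) y0 => // y0 _ /=.
    by apply: step_gt; [rewrite Ugt|case/andP: U0].
  by apply: step_lt; [case/andP: U0|rewrite Ult].
have lim2 : (fun n => \int[mu]_(x in `[0, 1]) ((G n \Po p) * q^`()).[x])
    @ \oo --> below p q 0 1 y.
  have [] := @dominated_convergence _ _ _ mu `[0, 1]%classic (measurable_itv _)
    (fun n => EFin \o (fun x => ((G n \Po p) * q^`()).[x]))
    (EFin \o (fun x => \1_[set x | p.[x] < y] x * q^`().[x]))
    (EFin \o (fun x => `|q^`().[x]|)).
  - by move=> n; apply/measurable_EFinP; exact: measurable_poly.
  - exact: measurable_int (integrable_below p q 0 1 y).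
  - pose r := p - y%:P.
    have r0 : r != 0.
      apply: contra_neq y0 => /(congr1 (fun u => u.[0])).
      by rewrite /r !hornerE p0 sub0r => /eqP; rewrite oppr_eq0 => /eqP.
    exists [set x | root r x]; split.
    + apply: closed_measurable; rewrite [X in closed X](_ : _ =
        horner r @^-1` [set 0]); last by apply/seteqP; split => x /rootP.
      apply: closed_comp; last exact: closed_eq.
      by move=> x _; exact: continuous_horner.
    + apply: countable_lebesgue_measure0; apply: finite_set_countable.
      apply: (@sub_finite_set _ _ [set` polyrcf.rootsR r]).
        by move=> x /= rx; have := polyrcf.roots_on_rootsR r0 x; rewrite rx.
      exact: finite_seq.
    + move=> x /= nlim; apply: contrapT => rx; apply: nlim.
      rewrite in_itv/= => x01; apply: cvg_EFin; first by near=> n.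
      under eq_fun do rewrite /= hornerM horner_comp GE.
      have /andP[U0 U1] := Uitv _ x01.
      apply: cvgMl; rewrite indicE; have [xy|xy|xy] := ltgtP p.[x] y.
      * by rewrite mem_set//; apply: step_lt => //; rewrite Ult.
      * rewrite memNset/= ?ltNge ?(ltW xy)//.
        by apply: step_gt => //; rewrite Ugt.
      * by case: rx; apply/rootP; rewrite /r hornerD hornerN hornerC xy subrr.
  - exact: integrable_norm (integrable_horner q^`() 0 1).
  - apply: aeW => x n /=; rewrite in_itv/= => x01.
    have /andP[U0 U1] := Uitv _ x01.
    rewrite lee_fin hornerM horner_comp GE normrM ler_piMl//.
    have un : 0 <= U.[p.[x]] ^+ n <= 1 by rewrite exprn_ge0 ?exprn_ile1.
    by rewrite ger0_norm ?exprn_ge0 ?exprn_ile1//; case/andP: un; lra.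
  move=> _ _ cv; apply: fine_cvg; rewrite fineK; first exact: cv.
  exact: integrable_fin_num (integrable_below p q 0 1 y).
exact: cvg_unique lim2 lim1.
Unshelve. all: by end_near. Qed.

End SublevelIntegrals.

(** * Contribution of the simple zeros *)

Section TaylorClass.
Context {R : realType}.
Implicit Types (f g : R -> R) (p q T : {poly R}).

(** [f] has an asymptotic expansion to every order at [0], the same on both
    sides; [f] itself need not be defined at [0]. *)
Definition taylor0 f := forall K : nat, exists T C e, [/\ 0 <= C, 0 < e &
  forall y, 0 < `|y| < e -> `|f y - T.[y]| <= C * `|y| ^+ K].

Lemma taylor0_near f g e : 0 < e -> (forall y, 0 < `|y| < e -> f y = g y) ->
  taylor0 g -> taylor0 f.
Proof.
move=> e0 fg tg K; have [T [C [e' [C0 e'0 gT]]]] := tg K.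
exists T, C, (Num.min e e'); split=> //; first by rewrite lt_min e0.
move=> y /andP[y0]; rewrite lt_min => /andP[ye ye'].
by rewrite fg ?y0// gT// y0.
Qed.

Lemma taylor0_cst c : taylor0 (fun=> c).
Proof.
move=> K; exists c%:P, 0, 1; split=> // y _.
by rewrite hornerC subrr normr0 mul0r.
Qed.

Lemma taylor0_comb a b f g : taylor0 f -> taylor0 g ->
  taylor0 (fun y => a * f y + b * g y).
Proof.
move=> tf tg K.
have [T [C [e [C0 e0 fT]]]] := tf K; have [U [D [d [D0 d0 gU]]]] := tg K.
exists (a *: T + b *: U), (`|a| * C + `|b| * D), (Num.min e d).
split; [by rewrite addr_ge0// mulr_ge0|by rewrite lt_min e0|].
move=> y /andP[y0]; rewrite lt_min => /andP[ye yd].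
rewrite hornerD !hornerZ.
have -> : a * f y + b * g y - (a * T.[y] + b * U.[y]) =
  a * (f y - T.[y]) + b * (g y - U.[y]) by ring.
rewrite (le_trans (ler_normD _ _))// !normrM mulrDl -!mulrA.
by rewrite lerD// ler_wpM2l// ?fT ?gU// y0.
Qed.

Lemma taylor0D f g : taylor0 f -> taylor0 g -> taylor0 (fun y => f y + g y).
Proof.
move=> tf tg; apply: taylor0_near (ltr01 : (0 : R) < 1) _ (taylor0_comb 1 1 tf tg).
by move=> y _; rewrite !mul1r.
Qed.

Lemma taylor0B f g : taylor0 f -> taylor0 g -> taylor0 (fun y => f y - g y).
Proof.
move=> tf tg.
apply: taylor0_near (ltr01 : (0 : R) < 1) _ (taylor0_comb 1 (-1) tf tg).
by move=> y _; rewrite mul1r mulN1r.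
Qed.

(** At a simple zero [z] of [p], every [q] is a power series in [p]. *)
Lemma simple_root_expansion (F : fieldType) (p q : {poly F}) (z : F) (K : nat) :
  p.[z] = 0 -> p^`().[z] != 0 ->
  exists T : {poly F}, ('X - z%:P) ^+ K %| q - (T \Po p).
Proof.
move=> pz dpz; have /dvdpP[u pE] : 'X - z%:P %| p.
  by rewrite dvdp_XsubCl; apply/rootP.
have uz : u.[z] != 0.
  move: dpz; rewrite pE derivM derivXsubC mulr1 hornerD hornerM.
  by rewrite hornerXsubC subrr mulr0 add0r.
elim: K => [|K [T /dvdpP[v qE]]]; first by exists 0; rewrite expr0 dvd1p.
exists (T + (v.[z] / u.[z] ^+ K) *: 'X^K).
have -> : q - ((T + (v.[z] / u.[z] ^+ K) *: 'X^K) \Po p) =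
    (v - (v.[z] / u.[z] ^+ K) *: u ^+ K) * ('X - z%:P) ^+ K.
  rewrite comp_polyD comp_polyZ comp_Xn_poly opprD addrA qE mulrBl.
  by rewrite -scalerAl -exprMn -pE.
rewrite exprS dvdp_mul2r ?expf_neq0 ?polyXsubC_eq0// dvdp_XsubCl; apply/rootP.
by rewrite hornerD hornerN hornerZ horner_exp divfK ?subrr// expf_neq0.
Qed.

Lemma dvd_near (K : numFieldType) (p : {poly K}) (z : K) n :
  ('X - z%:P) ^+ n %| p ->
  exists2 M, 0 <= M & forall x, `|x - z| <= 1 -> `|p.[x]| <= M * `|x - z| ^+ n.
Proof.
move=> /dvdpP[u ->]; have [M M0 uM] := horner_bounded u (1 + `|z|).
exists M => // x xz; rewrite hornerM horner_exp hornerXsubC normrM normrX.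
rewrite ler_wpM2r// uM// -[x](subrK z) (le_trans (ler_normD _ _))//.
by rewrite lerD2r.
Qed.

(** On a small ball the linear term of [horner_second_order] dominates the
    error, which also bounds distances of values from below. *)
Lemma strict_monotone_near p z : p^`().[z] != 0 ->
  exists c d, [/\ 0 < c, 0 < d <= 1,
    forall x y, `|x - z| <= d -> `|y - z| <= d -> y <= x ->
      c * (x - y) <= Num.sg p^`().[z] * (p.[x] - p.[y]) &
    forall x y, `|x - z| <= d -> `|y - z| <= d ->
      c * `|x - y| <= `|p.[x] - p.[y]|].
Proof.
move=> dpz; suff [c [d [c0 d01 pc]]] : exists c d, [/\ 0 < c, 0 < d <= 1 &
    forall x y, `|x - z| <= d -> `|y - z| <= d -> y <= x ->
      c * (x - y) <= Num.sg p^`().[z] * (p.[x] - p.[y])].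
  exists c, d; split=> // x y; wlog yx : x y / y <= x => [H xz yz|xz yz].
    have [yx|/ltW xy] := leP y x; first exact: H.
    by rewrite distrC [leRHS]distrC; exact: H.
  rewrite ger0_norm ?subr_ge0// (le_trans (pc x y xz yz yx))//.
  by rewrite (le_trans (ler_norm _))// normrM normr_sg dpz mul1r.
have [M M0 pM] := horner_second_order p z.
have c0 : 0 < `|p^`().[z]| by rewrite normr_gt0.
set c := `|_| in c0.
have Mc : 0 < 4 * (M + 1) + c by rewrite addr_gt0// mulr_gt0// ltr_wpDl.
pose d := c / (4 * (M + 1) + c).
have d1 : d <= 1 by rewrite ler_pdivrMr// mul1r lerDr mulr_ge0// addr_ge0.
have Md : M * (d + d) <= c / 2.
  have : d * (4 * (M + 1) + c) = c by rewrite divfK// gt_eqF.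
  have : 0 <= d by rewrite divr_ge0// ltW.
  by nra.
exists (c / 2), d; split; rewrite ?divr_gt0// => x y xz yz yx.
have xy0 : 0 <= x - y by rewrite subr_ge0.
have := pM x y (le_trans xz d1) (le_trans yz d1).
have sgc : Num.sg p^`().[z] * p^`().[z] = c by rewrite -normrEsg.
move=> h.
have h1 : `|p.[x] - p.[y] - p^`().[z] * (x - y)| <= c / 2 * (x - y).
  rewrite (le_trans h)// (ger0_norm xy0) ler_wpM2r// (le_trans _ Md)//.
  by rewrite ler_wpM2l// lerD.
have h2 : `|Num.sg p^`().[z] * (p.[x] - p.[y] - p^`().[z] * (x - y))|
    <= c / 2 * (x - y).
  by rewrite normrM normr_sg dpz mul1r.
move: h2; rewrite mulrBr mulrA sgc ler_norml => /andP[h2 _].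
by move: h2; lra.
Qed.

(** [simple_root_expansion] in terms of the value of [p]: since [p] is
    comparable to [x - z], the remainder is [O(p ^ K)]. *)
Lemma simple_root_taylor p q z (K : nat) : p.[z] = 0 -> p^`().[z] != 0 ->
  exists T C d, [/\ 0 <= C, 0 < d &
    forall x, `|x - z| <= d -> `|q.[x] - T.[p.[x]]| <= C * `|p.[x]| ^+ K].
Proof.
move=> pz dpz; have [T /dvd_near[M M0 qT]] := simple_root_expansion q K pz dpz.
have [c [d [c0 /andP[d0 d1] _ pc]]] := strict_monotone_near dpz.
have far x : `|x - z| <= d -> `|x - z| <= c^-1 * `|p.[x]|.
  move=> xd; rewrite mulrC ler_pdivlMr// mulrC.
  have := pc x z xd; rewrite pz subr0 subrr normr0; apply; exact: ltW.
exists T, (M * c^-1 ^+ K), d; split=> //.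
  by rewrite mulr_ge0// exprn_ge0// invr_ge0 ltW.
move=> x xd; have := qT x (le_trans xd d1).
rewrite hornerD hornerN horner_comp => /le_trans; apply.
rewrite -mulrA ler_wpM2l// -exprMn lerXn2r ?nnegrE ?far//.
by rewrite mulr_ge0// invr_ge0 ltW.
Qed.

Lemma below_increasing p q l r x : l <= x <= r ->
  (forall u v, l <= u <= r -> l <= v <= r -> u < v -> p.[u] < p.[v]) ->
  below p q l r p.[x] = q.[x] - q.[l].
Proof.
move=> lxr inc; case/andP: (lxr) => lx xr.
rewrite (below_split _ _ _ lxr) below_full//; last first.
  by move=> u /andP[lu ux]; apply: inc; rewrite ?lx// (ltW lu) (ltW (lt_le_trans ux xr)).
rewrite below_empty ?addr0// => u /andP[xu ur]; apply/ltW/inc => //.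
by rewrite (ltW (le_lt_trans lx xu)) ltW.
Qed.

Lemma below_decreasing p q l r x : l <= x <= r ->
  (forall u v, l <= u <= r -> l <= v <= r -> u < v -> p.[v] < p.[u]) ->
  below p q l r p.[x] = q.[r] - q.[x].
Proof.
move=> lxr dec; case/andP: (lxr) => lx xr.
rewrite (below_split _ _ _ lxr) below_empty//; last first.
  move=> u /andP[lu ux]; apply/ltW/dec => //.
  by rewrite (ltW lu) (ltW (lt_le_trans ux xr)).
rewrite below_full ?add0r// => u /andP[xu ur]; apply/dec => //.
by rewrite (ltW (le_lt_trans lx xu)) ltW.
Qed.

Let poly_value p l r y : l <= r -> (p.[l] <= y <= p.[r]) || (p.[r] <= y <= p.[l]) ->
  exists2 x, l <= x <= r & p.[x] = y.
Proof.
move=> lr h; have [||x xlr /rootP] := @polyrcf.poly_ivt R (p - y%:P) l r => //.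
  rewrite !hornerD !hornerN !hornerC; case/orP: h => /andP[h1 h2].
    by rewrite mulr_le0_ge0// ?subr_le0 ?subr_ge0.
  by rewrite mulr_ge0_le0// ?subr_le0 ?subr_ge0.
rewrite hornerD hornerN hornerC => /eqP; rewrite subr_eq0 => /eqP xy.
by exists x => //; move: xlr; rewrite in_itv.
Qed.

(** Across a simple zero the contribution is [q] at the moving solution of
    [p = y], up to sign and a constant. *)
Lemma below_near_root p q z : p.[z] = 0 -> p^`().[z] != 0 ->
  exists2 d, 0 < d & forall l r, `|l - z| < d -> `|r - z| < d -> l <= r ->
    p.[l] != 0 -> p.[r] != 0 -> taylor0 (below p q l r).
Proof.
move=> pz dpz; have [c [d [c0 /andP[d0 d1] pc far]]] := strict_monotone_near dpz.
exists d => // l r lz rz lr pl pr.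
have nearz x : l <= x <= r -> `|x - z| <= d.
  case/andP=> lx xr; move: lz rz; rewrite !ltr_norml ler_norml.
  by move=> /andP[l1 l2] /andP[r1 r2]; apply/andP; split; lra.
(* if [p] does not change sign on [[l, r]], small levels are not attained and the
   contribution is constant *)
have [|] := boolP (0 <= p.[l] * p.[r]) => [same|].
  have plr : 0 < p.[l] * p.[r] by rewrite lt_neqAle eq_sym mulf_neq0.
  have monop x : l <= x <= r -> (p.[l] <= p.[x] <= p.[r]) || (p.[r] <= p.[x] <= p.[l]).
    move=> lxr; case/andP: (lxr) => lx xr.
    have h1 := pc x l (nearz _ lxr) (ltW lz) lx.
    have h2 := pc r x (ltW rz) (nearz _ lxr) xr.
    have h1' := le_trans (mulr_ge0 (ltW c0) _) h1.
    have h2' := le_trans (mulr_ge0 (ltW c0) _) h2.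
    move: h1' h2'; rewrite !subr_ge0 => /(_ lx) + /(_ xr).
    have [dp|dp|dp] := ltgtP p^`().[z] 0; last by rewrite dp eqxx in dpz.
      by rewrite ltr0_sg// !mulN1r !opprB !subr_ge0 => -> ->; rewrite orbT.
    by rewrite gtr0_sg// !mul1r !subr_ge0 => -> ->.
  have [pl0|pl0] : {0 < p.[l]} + {p.[l] < 0}.
    by case: (ltgtP p.[l] 0) pl => // ? _; [right|left].
    have pr0 : 0 < p.[r] by move: plr; rewrite pmulr_rgt0.
    apply: (@taylor0_near _ (fun=> 0) (Num.min p.[l] p.[r])); last exact: taylor0_cst.
      by rewrite lt_min pl0.
    move=> y /andP[_]; rewrite lt_min => /andP[yl yr].
    have ly : y < p.[l] := le_lt_trans (ler_norm _) yl.
    have ry : y < p.[r] := le_lt_trans (ler_norm _) yr.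
    apply: below_empty => // x /andP[/ltW lx /ltW xr].
    by have := monop x; rewrite lx xr => /(_ isT)/orP[] /andP[h _];
      rewrite (le_trans _ h)// ltW.
  have pr0 : p.[r] < 0 by move: plr; rewrite nmulr_rgt0.
  apply: (@taylor0_near _ (fun=> q.[r] - q.[l]) (Num.min (- p.[l]) (- p.[r])));
    last exact: taylor0_cst.
    by rewrite lt_min !oppr_gt0 pl0.
  move=> y /andP[_]; rewrite lt_min => /andP[yl yr].
  have ly : p.[l] < y by move: yl; rewrite ltr_norml opprK => /andP[].
  have ry : p.[r] < y by move: yr; rewrite ltr_norml opprK => /andP[].
  apply: below_full => // x /andP[/ltW lx /ltW xr].
  by have := monop x; rewrite lx xr => /(_ isT)/orP[] /andP[_ h];
    rewrite (le_lt_trans h).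
rewrite -ltNge => opp K.
have [T [C [e [C0 e0 qT]]]] := simple_root_taylor q K pz dpz.
(* the solutions of [p = y] stay in the range of the expansion *)
have solz y x : l <= x <= r -> p.[x] = y -> `|y| < c * e -> `|x - z| <= e.
  move=> lxr <- yce; rewrite -(ler_pM2l c0) (le_trans _ (ltW yce))//.
  have := far x z (nearz _ lxr); rewrite pz subr0 subrr normr0; apply; exact: ltW.
pose m := Num.min (c * e) (Num.min `|p.[l]| `|p.[r]|).
have m0 : 0 < m by rewrite !lt_min mulr_gt0// !normr_gt0 pl.
have sol y : `|y| < m -> exists x, [/\ l <= x <= r, p.[x] = y & `|x - z| <= e].
  rewrite !lt_min => /and3P[yce yl yr].
  have [|x lxr xy] := @poly_value p l r y lr.
    move: yl yr opp; rewrite !ltr_norml !real_ltr_normr ?num_real//.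
    move=> /andP[l1 l2] /andP[r1 r2].
    have [pl0|pl0|pl0] := ltgtP p.[l] 0; last by rewrite pl0 eqxx in pl.
      rewrite nmulr_rlt0// => pr0.
      move: l1 l2 r1 r2; rewrite (ltr0_norm pl0) (gtr0_norm pr0) => l1 l2 r1 r2.
      by apply/orP; left; apply/andP; move: pr0 l1 r2; clear; split; lra.
    rewrite pmulr_rlt0// => pr0.
    move: l1 l2 r1 r2; rewrite (gtr0_norm pl0) (ltr0_norm pr0) => l1 l2 r1 r2.
    by apply/orP; right; apply/andP; move: pl0 pr0 l2 r1; clear; split; lra.
  by exists x; split=> //; exact: solz xy _.
have [dp|dp|dp] := ltgtP p^`().[z] 0; last by rewrite dp eqxx in dpz.
  have dec u v : l <= u <= r -> l <= v <= r -> u < v -> p.[v] < p.[u].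
    move=> lu lv uv; have := pc v u (nearz _ lv) (nearz _ lu) (ltW uv).
    rewrite ltr0_sg// mulN1r opprB => h; rewrite -subr_gt0 (lt_le_trans _ h)//.
    by rewrite mulr_gt0// subr_gt0.
  exists (q.[r]%:P - T), C, m; split=> // y /andP[_ /sol[x [lxr <- xz]]].
  rewrite below_decreasing// hornerD hornerN hornerC.
  by rewrite (_ : _ - _ = - (q.[x] - T.[p.[x]])) ?normrN ?qT//; ring.
have inc u v : l <= u <= r -> l <= v <= r -> u < v -> p.[u] < p.[v].
  move=> lu lv uv; have := pc v u (nearz _ lv) (nearz _ lu) (ltW uv).
  rewrite gtr0_sg// mul1r => h; rewrite -subr_gt0 (lt_le_trans _ h)//.
  by rewrite mulr_gt0// subr_gt0.
exists (T - q.[l]%:P), C, m; split=> // y /andP[_ /sol[x [lxr <- xz]]].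
rewrite below_increasing// hornerD hornerN hornerC.
by rewrite (_ : _ - _ = q.[x] - T.[p.[x]]) ?qT//; ring.
Qed.

Lemma below_near_nonroot p q z : p.[z] != 0 ->
  exists2 d, 0 < d & forall l r, `|l - z| < d -> `|r - z| < d -> l <= r ->
    taylor0 (below p q l r).
Proof.
move=> pz; have h0 : 0 < `|p.[z]| / 2 by rewrite divr_gt0// normr_gt0.
have [d /andP[d0 d1] pd] := horner_near p z h0.
exists d => // l r lz rz lr.
have nearz x : l < x < r -> `|p.[x] - p.[z]| < `|p.[z]| / 2.
  case/andP=> lx xr; apply: pd; move: lz rz; rewrite !ltr_norml ler_norml.
  by move=> /andP[l1 l2] /andP[r1 r2]; apply/andP; split; lra.
have [pz0|pz0|pz0] := ltgtP p.[z] 0; last by rewrite pz0 eqxx in pz.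
  apply: (taylor0_near h0) (taylor0_cst (q.[r] - q.[l])) => y /andP[_ yz].
  apply: below_full => // x /nearz; move: yz; rewrite (ltr0_norm pz0) !ltr_norml.
  by move=> /andP[y1 y2] /andP[x1 x2]; lra.
apply: (taylor0_near h0) (taylor0_cst 0) => y /andP[_ yz].
apply: below_empty => // x /nearz; move: yz; rewrite (gtr0_norm pz0) !ltr_norml.
by move=> /andP[y1 y2] /andP[x1 x2]; lra.
Qed.

(** The interval is swept from left to right: [below_near_root] and
    [below_near_nonroot] show that the property passes every point, and cutting
    points are moved off the zeros of [p], which are isolated. *)
Lemma below_taylor p q l r : l <= r ->
  (forall x, l <= x <= r -> p.[x] = 0 -> p^`().[x] != 0) ->
  p.[l] != 0 -> p.[r] != 0 -> taylor0 (below p q l r).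
Proof.
move=> lr simple pl pr.
have p0 : p != 0 by apply: contra_neq pl => ->; rewrite horner0.
have near x : l <= x <= r -> exists2 d, 0 < d & forall u v,
    `|u - x| < d -> `|v - x| < d -> u <= v -> p.[u] != 0 -> p.[v] != 0 ->
    taylor0 (below p q u v).
  move=> lxr; have [px|px] := eqVneq p.[x] 0.
    exact: below_near_root px (simple x lxr px).
  by have [d d0 dP] := below_near_nonroot q px; exists d => // u v *; exact: dP.
pose Q x := exists2 d, 0 < d & forall v, l <= v <= r -> `|v - x| < d ->
  p.[v] != 0 -> taylor0 (below p q l v).
suff [d d0 Qr] : Q r by apply: Qr => //; rewrite ?lr ?lexx// subrr normr0.
apply: (local_propagation lr).
  move=> x lxr; have [d d0 dP] := near x lxr.
  exists d => // y z lyr lzr yx zx [e e0 Qy].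
  (* a point close to [y] where [p] does not vanish *)
  have [u [lur ux uy pu]] : exists u, [/\ l <= u <= r, `|u - x| < d,
      `|u - y| < e & p.[u] != 0].
    have [py|py] := eqVneq p.[y] 0; last first.
      by exists y; split=> //; rewrite subrr normr0.
    have ly : l < y.
      rewrite lt_neqAle; case/andP: lyr => -> _; rewrite andbT.
      by apply: contra_neq pl => ->.
    have [h /andP[h0 h1] hP] := root_isolated y p0.
    pose s := Num.min (Num.min h (y - l)) (Num.min (d - `|y - x|) e) / 2.
    have s0 : 0 < s.
      by rewrite divr_gt0// !lt_min h0 e0 !subr_gt0 ly yx.
    have : s * 2 <= Num.min (Num.min h (y - l)) (Num.min (d - `|y - x|) e).
      by rewrite divfK.
    rewrite !le_min => /andP[/andP[s1 s2] /andP[s3 s4]].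
    case/andP: lyr => _ yr.
    have Es : y - s - y = - s by ring.
    exists (y - s); split.
    - by apply/andP; move: ly s0 s2 yr; clear; split; lra.
    - rewrite (_ : y - s - x = (y - x) - s); last by ring.
      by rewrite (le_lt_trans (ler_normB _ _))// (gtr0_norm s0); move: s0 s3; clear; lra.
    - by rewrite Es normrN gtr0_norm//; move: s0 s4; clear; lra.
    - apply: hP; first by rewrite -subr_eq0 Es oppr_eq0 gt_eqF.
      by rewrite Es normrN gtr0_norm//; move: s0 s1; clear; lra.
  exists (d - `|z - x|); first by rewrite subr_gt0.
  move=> v lvr vz pv.
  have vx : `|v - x| < d.
    rewrite -(subrK z v) -addrA (le_lt_trans (ler_normD _ _))//.
    by rewrite -ltrBrDr.
  have tu : taylor0 (below p q l u) by apply: Qy.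
  case/andP: (lur) => lu ur; case/andP: (lvr) => lv vr.
  have [uv|vu] := leP u v.
    apply: (@taylor0_near _ _ 1 ltr01) (taylor0D tu (dP u v ux vx uv pu pv)).
    by move=> y' _; rewrite (below_split _ _ _ (m := u)) ?lu.
  apply: (@taylor0_near _ _ 1 ltr01) (taylor0B tu (dP v u vx ux (ltW vu) pv pu)).
  by move=> y' _; rewrite (@below_split _ p q l v u) ?lv ?(ltW vu)//; ring.
have [d d0 dP] := near l ltac:(by rewrite lexx).
exists d => // v /andP[lv vr] vl pv; apply: dP => //.
by rewrite subrr normr0.
Qed.

End TaylorClass.

(** * Contribution of the endpoints *)

Section Endpoints.
Context {R : realType}.
Implicit Types (p q r T : {poly R}).
Local Notation mu := (@lebesgue_measure R).

Lemma noroot_same_sign p (l r : R) : l <= r ->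
  (forall x, l <= x <= r -> p.[x] != 0) -> 0 < p.[l] * p.[r].
Proof.
move=> lr pN0; rewrite ltNge; apply/negP => /(polyrcf.poly_ivt lr)[x].
by rewrite in_itv/= => /pN0 + /rootP px0; rewrite px0 eqxx.
Qed.

Lemma sg_mul_gt0 (s t : R) : 0 < s * t -> 0 < Num.sg s * t.
Proof.
have [s0|s0|->] := ltgtP s 0; last by rewrite mul0r ltxx.
  by rewrite ltr0_sg// mulN1r oppr_gt0 nmulr_rgt0.
by rewrite gtr0_sg// mul1r pmulr_rgt0.
Qed.

(** The derivative has no zero close to [z] on that side; the factor
    [sg p(z + d)] states monotonicity without a case distinction on its sign. *)
Lemma monotone_right p (z : R) : p != 0 -> p.[z] = 0 -> exists2 d, 0 < d <= 1 &
  (forall x, z < x <= z + d -> p^`().[x] != 0) /\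
  forall u v, z <= u -> u < v -> v <= z + d ->
    0 < Num.sg p.[z + d] * (p.[v] - p.[u]).
Proof.
move=> p0 pz; have dp0 : p^`() != 0.
  rewrite -size_poly_eq0 polyorder.size_deriv -lt0n -subn1 subn_gt0.
  by apply: (root_size_gt1 (a := z)) => //; apply/rootP.
have [d /andP[d0 d1] dpN0] := root_isolated z dp0.
have near x : z < x <= z + d -> p^`().[x] != 0.
  move=> /andP[zx xd]; apply: dpN0; first by rewrite gt_eqF.
  by rewrite ger0_norm ?subr_ge0 ?(ltW zx)// lerBlDl.
exists d; first by rewrite d0.
split=> // u v zu uv vd.
have zd : z < z + d by rewrite ltrDl.
have [c0] := polyrcf.poly_mvt p zd; rewrite in_itv/= pz subr0 => /andP[zc0 c0d] pd.
have [c] := polyrcf.poly_mvt p uv; rewrite in_itv/= => /andP[uc cv] ->.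
rewrite pd mulrA sgrM pmulr_lgt0 ?subr_gt0//.
rewrite (gtr0_sg (_ : 0 < z + d - z)) ?mulr1; last by rewrite addrC addKr.
have [le|lt] := leP c0 c.
  apply: sg_mul_gt0; apply: noroot_same_sign => // x /andP[x1 x2]; apply: near.
  by rewrite (lt_le_trans zc0)//= (le_trans x2)// ltW// (lt_le_trans cv).
apply: sg_mul_gt0; rewrite mulrC.
apply: noroot_same_sign => [|x /andP[x1 x2]]; first exact: ltW.
apply: near; rewrite (lt_le_trans _ x1) ?(le_lt_trans zu)//=.
by rewrite (le_trans x2)// ltW.
Qed.

Lemma monotone_left p (z : R) : p != 0 -> p.[z] = 0 -> exists2 d, 0 < d <= 1 &
  (forall x, z - d <= x < z -> p^`().[x] != 0) /\
  forall u v, z - d <= u -> u < v -> v <= z ->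
    0 < Num.sg p.[z - d] * (p.[u] - p.[v]).
Proof.
move=> p0 pz; pose r := p \Po (- 'X).
have rE x : r.[x] = p.[- x] by rewrite horner_comp hornerN hornerX.
have [||d d01 [dr mono]] := @monotone_right r (- z).
- apply: contra_neq p0 => r0; have : r \Po (- 'X) = p.
    by rewrite -comp_polyA rmorphN /= comp_polyX opprK comp_polyXr.
  by rewrite r0 comp_poly0.
- by rewrite rE opprK.
exists d => //; split=> [x /andP[x1 x2]|u v u1 uv v1].
  have := dr (- x); rewrite deriv_comp hornerM horner_comp derivN derivX.
  rewrite !hornerN hornerX hornerC opprK mulrN mulr1 oppr_eq0; apply.
  by apply/andP; split; lra.
have := mono (- v) (- u); rewrite !rE !opprK opprD opprK.
by apply; lra.
Qed.

(** If the multiplicity of [z] were less than [K], the cofactor of [r] would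
    tend to [0] along the given points, although it does not vanish at [z]. *)
Lemma dvd_of_bound r (z C : R) K :
  (forall e, 0 < e -> exists2 x, 0 < `|x - z| < e &
    `|r.[x]| <= C * `|x - z| ^+ K) -> ('X - z%:P) ^+ K %| r.
Proof.
move=> bnd; have [->|r0] := eqVneq r 0; first exact: dvdp0.
have [m [u]] := multiplicity_XsubC r z; rewrite r0/= => uz rE.
have [Km|mK] := leqP K m; first by rewrite rE dvdp_mull// dvdp_exp2l.
have uz0 : 0 < `|u.[z]| / 2 by rewrite divr_gt0// normr_gt0.
have [d /andP[d0 d1] ud] := horner_near u z uz0.
have C0 : 0 < `|C| + 1 by rewrite ltr_wpDl.
have [|x /andP[x0 xe] rx] := bnd (Num.min d (`|u.[z]| / 2 / (`|C| + 1))).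
  by rewrite lt_min d0 divr_gt0.
move: xe; rewrite lt_min => /andP[xd]; rewrite ltr_pdivlMr// => xC.
have ux : `|u.[x]| <= `|C| * `|x - z|.
  have : `|u.[x]| * `|x - z| ^+ m <= `|C| * `|x - z| * `|x - z| ^+ m.
    rewrite -normrX -normrM -[X in `|X|](_ : r.[x] = _); last first.
      by rewrite rE hornerM horner_exp hornerXsubC.
    rewrite (le_trans rx)// normrX -mulrA -exprS.
    rewrite (le_trans (ler_wpM2r _ (ler_norm C)))// ?exprn_ge0//.
    by rewrite ler_wpM2l// ler_wiXn2l// (le_trans (ltW xd)).
  by rewrite ler_pM2r// exprn_gt0.
have := ud x (ltW xd); rewrite distrC => h.
have := le_lt_trans (lerB_dist u.[z] u.[x]) h.
suff : `|u.[x]| <= `|u.[z]| / 2 by lra.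
rewrite (le_trans ux)// (le_trans _ (ltW xC))// mulrC ler_wpM2l//.
by rewrite lerDl.
Qed.

Lemma positive_increasing p (d : R) : p.[0] = 0 -> 0 < d ->
  (exists2 e, 0 < e & forall x, 0 < x < e -> 0 < p.[x]) ->
  (forall u v, 0 <= u -> u < v -> v <= 0 + d ->
    0 < Num.sg p.[0 + d] * (p.[v] - p.[u])) ->
  forall u v, 0 <= u -> u < v -> v <= d -> p.[u] < p.[v].
Proof.
rewrite add0r => p0 d0 [e e0 pe] mono.
pose x := Num.min d e / 2.
have x0 : 0 < x by rewrite divr_gt0// lt_min d0.
have : x * 2 <= Num.min d e by rewrite divfK.
rewrite le_min => /andP[xd xe].
have := mono 0 x (lexx 0) x0; rewrite p0 subr0 pmulr_lgt0 ?pe//; try by lra.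
move=> /(_ ltac:(lra)); rewrite sgr_gt0 => pd u v u0 uv vd.
by have := mono u v u0 uv vd; rewrite gtr0_sg// mul1r subr_gt0.
Qed.

(** The factor [s] covers both signs that [p] can have to the left of [1]. *)
Lemma positive_decreasing p (d s : R) : p.[1] = 0 -> 0 < d -> s != 0 ->
  (exists2 e, 0 < e & forall x, 1 - e < x < 1 -> 0 < s * p.[x]) ->
  (forall u v, 1 - d <= u -> u < v -> v <= 1 ->
    0 < Num.sg p.[1 - d] * (p.[u] - p.[v])) ->
  forall u v, 1 - d <= u -> u < v -> v <= 1 -> s * p.[v] < s * p.[u].
Proof.
move=> p1 d0 s0 [e e0 pe] mono.
pose x := Num.min d e / 2.
have x0 : 0 < x by rewrite divr_gt0// lt_min d0.
have : x * 2 <= Num.min d e by rewrite divfK.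
rewrite le_min => /andP[xd xe].
have := mono (1 - x) 1; rewrite p1 subr0 => h.
have {h} h : 0 < Num.sg p.[1 - d] * p.[1 - x] by apply: h; lra.
have h' : 0 < s * p.[1 - x] by apply: pe; apply/andP; split; lra.
have sgE : Num.sg p.[1 - d] = Num.sg s.
  have px0 : p.[1 - x] != 0 by apply: contraTneq h' => ->; rewrite mulr0 ltxx.
  apply: (@mulIf _ (Num.sg p.[1 - x])); first by rewrite sgr_eq0.
  have := gtr0_sg h; rewrite sgrM sgr_id => ->.
  by have := gtr0_sg h'; rewrite sgrM => ->.
move=> u v u1 uv v1; have := mono u v u1 uv v1.
rewrite sgE => h''; rewrite -subr_gt0 -mulrBr; move: h''.
case: (ltgtP s 0) s0 => // s0 _; first by rewrite ltr0_sg// mulN1r oppr_gt0 nmulr_rgt0.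
by rewrite gtr0_sg// mul1r pmulr_rgt0.
Qed.

Section TwoEnds.
Context (p q : {poly R}).
Hypotheses (p_neq0 : p != 0) (p0 : p.[0] = 0) (p1 : p.[1] = 0).
Hypothesis simple : forall x, 0 < x < 1 -> p.[x] = 0 -> p^`().[x] != 0.
Hypothesis moments :
  forall k, \int[mu]_(x in `[0, 1]) (p ^+ k * q * p^`()).[x] = 0.
Hypothesis pos0 : exists2 e, 0 < e & forall x, 0 < x < e -> 0 < p.[x].

(* Between the two monotone end intervals only simple zeros occur, so the middle
   part of the sublevel integral has an expansion at the level [0]. *)
Let splitting (s : R) : s != 0 ->
    (exists2 e, 0 < e & forall x, 1 - e < x < 1 -> 0 < s * p.[x]) ->
  exists d, [/\ 0 < d < 2^-1,
    forall u v, 0 <= u -> u < v -> v <= d -> p.[u] < p.[v],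
    forall u v, 1 - d <= u -> u < v -> v <= 1 -> s * p.[v] < s * p.[u],
    taylor0 (below p q d (1 - d)) &
    forall y, y != 0 -> below p q 0 d y + below p q d (1 - d) y +
      below p q (1 - d) 1 y = (0 < y)%R%:R * (q.[1] - q.[0])].
Proof.
move=> s0 pos1.
have [d0 /andP[d00 _] [_ mono0]] := monotone_right p_neq0 p0.
have [d1 /andP[d10 _] [_ mono1]] := monotone_left p_neq0 p1.
have inc := positive_increasing p0 d00 pos0 mono0.
have dec := positive_decreasing p1 d10 s0 pos1 mono1.
pose d := Num.min (Num.min d0 d1) 2^-1 / 2.
have d_gt0 : 0 < d by rewrite divr_gt0// !lt_min d00 d10 invr_gt0/=.
have : d * 2 <= Num.min (Num.min d0 d1) 2^-1 by rewrite divfK.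
rewrite !le_min => /andP[/andP[dd0 dd1] d2].
exists d; split.
- by apply/andP; split; lra.
- by move=> u v u0 uv vd; apply: inc => //; lra.
- by move=> u v u1 uv v1; apply: dec => //; lra.
- apply: below_taylor.
  + by lra.
  + by move=> x /andP[x1 x2]; apply: simple; apply/andP; split; lra.
  + by have := inc 0 d; rewrite p0 => h; rewrite gt_eqF// h//; lra.
  + have := dec (1 - d) 1; rewrite p1 mulr0 => h.
    have {h} : 0 < s * p.[1 - d] by apply: h; lra.
    by apply: contraTneq => ->; rewrite mulr0 ltxx.
- move=> y y0; rewrite -(moments_below p0 p1 moments y0).
  rewrite (@below_split _ p q 0 d 1); last by apply/andP; split; lra.
  rewrite (@below_split _ p q d (1 - d) 1) ?addrA//.
  by apply/andP; split; lra.
Qed.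

(** For a small level [y > 0] the end intervals contribute
    [q(x) - q(0)] and [q(1) - q(x')] where [p(x) = p(x') = y], so the difference
    [q(x) - q(x')] has an expansion in [y].  For [y < 0] they contribute nothing,
    which forces that expansion to be zero. *)
Lemma ends_same_sign :
    (exists2 e, 0 < e & forall x, 1 - e < x < 1 -> 0 < p.[x]) ->
  exists f d, [/\ taylor0 f, 0 < d, forall y, y < 0 -> f y = 0 &
    forall x x', 0 < x < d -> 1 - d < x' < 1 -> p.[x] = p.[x'] ->
      q.[x] - q.[x'] = f p.[x]].
Proof.
move=> pos1; have [|d [/andP[d0 d2] inc dec tm split]] := splitting (oner_neq0 R).
  by case: pos1 => e e0 pe; exists e => // x /pe; rewrite mul1r.
have pinc x : 0 < x <= d -> 0 < p.[x] by move=> /andP[x0 xd]; rewrite -p0 inc.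
have pdec x : 1 - d <= x < 1 -> 0 < p.[x].
  by move=> /andP[x1 x2]; rewrite -p1 -[X in X < _]mul1r -[ltRHS]mul1r dec.
exists (fun y => 0 - below p q d (1 - d) y), d; split=> //.
- by apply: taylor0B => //; exact: taylor0_cst.
- move=> y y0; have := split y; rewrite lt_eqF// => /(_ isT).
  rewrite (below_empty _ (ltW d0)); last first.
    by move=> x /andP[x0 xd]; rewrite (le_trans (ltW y0))// ltW// pinc// x0 ltW.
  rewrite (@below_empty _ p q (1 - d) 1); [|lra|]; last first.
    by move=> x /andP[x0 xd]; rewrite (le_trans (ltW y0))// ltW// pdec// xd ltW.
  by rewrite ltNge (ltW y0)/= mul0r add0r addr0 => ->; rewrite subr0.
- move=> x x' /andP[x0 xd] /andP[x'1 x'2] xx'.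
  have px0 : 0 < p.[x] by apply: pinc; rewrite x0 ltW.
  have := split p.[x]; rewrite gt_eqF// px0 mul1r => /(_ isT).
  rewrite below_increasing; last 2 first.
    by rewrite !ltW.
    by move=> u v /andP[u1 u2] /andP[v1 v2] uv; exact: inc.
  rewrite xx' (@below_decreasing _ p q (1 - d) 1); last 2 first.
    by rewrite !ltW.
    move=> u v /andP[u1 u2] /andP[v1 v2] uv.
    by rewrite -[X in X < _]mul1r -[ltRHS]mul1r dec.
  by lra.
Qed.

(** The levels [y > 0] are attained only near [0] and the levels [y < 0] only
    near [1]; one expansion, of the middle part, therefore describes [q] as a
    function of [p] at both ends. *)
Lemma ends_opposite_sign :
    (exists2 e, 0 < e & forall x, 1 - e < x < 1 -> p.[x] < 0) ->
  exists f d, [/\ taylor0 f, 0 < d,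
    forall x, 0 < x < d -> q.[x] = f p.[x] &
    forall x, 1 - d < x < 1 -> q.[x] = f p.[x]].
Proof.
move=> neg1; have [||d [/andP[d0 d2] inc dec tm split]] := @splitting (-1).
- by rewrite oppr_eq0 oner_neq0.
- by case: neg1 => e e0 pe; exists e => // x /pe; rewrite mulN1r oppr_gt0.
have pinc x : 0 < x <= d -> 0 < p.[x] by move=> /andP[x0 xd]; rewrite -p0 inc.
have dec' u v : 1 - d <= u -> u < v -> v <= 1 -> p.[u] < p.[v].
  by move=> u1 uv v1; have := dec u v u1 uv v1; rewrite !mulN1r ltrN2.
have pdec x : 1 - d <= x < 1 -> p.[x] < 0.
  by move=> /andP[x1 x2]; rewrite -p1 dec'.
exists (fun y => q.[1 - d] - below p q d (1 - d) y), d; split=> //.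
- by apply: taylor0B => //; exact: taylor0_cst.
- move=> x /andP[x0 xd].
  have px0 : 0 < p.[x] by apply: pinc; rewrite x0 ltW.
  have := split p.[x]; rewrite gt_eqF// px0 mul1r => /(_ isT).
  rewrite below_increasing; last 2 first.
    by rewrite !ltW.
    by move=> u v /andP[u1 u2] /andP[v1 v2] uv; exact: inc.
  rewrite (@below_full _ p q (1 - d) 1); [|lra|]; last first.
    by move=> u /andP[u1 u2]; rewrite (lt_trans (pdec u _))// u2 ltW.
  by lra.
- move=> x /andP[x0 xd].
  have px0 : p.[x] < 0 by apply: pdec; rewrite xd ltW.
  have := split p.[x]; rewrite lt_eqF// ltNge (ltW px0)/= mul0r => /(_ isT).
  rewrite (@below_increasing _ p q (1 - d) 1); last 2 first.
    by rewrite !ltW.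
    by move=> u v /andP[u1 u2] /andP[v1 v2] uv; exact: dec'.
  rewrite (below_empty _ (ltW d0)); last first.
    by move=> u /andP[u1 u2]; rewrite (le_trans (ltW px0))// ltW// pinc// u1 ltW.
  by lra.
Qed.

End TwoEnds.
End Endpoints.

(** * Values of the common component at the endpoints *)

Section Valuations.
Context {F : fieldType}.
Implicit Types (P Q W h v : {poly F}) (N D : {poly {poly F}}).

Lemma dvd_XsubC_exp_vanish (z : F) j K h : (j < K)%N ->
  ('X - z%:P) ^+ K %| ('X - z%:P) ^+ j * h -> h.[z] = 0.
Proof.
move=> jK; rewrite -(subnKC jK) exprD exprSr -mulrA dvdp_mul2l; last first.
  by rewrite expf_neq0// polyXsubC_eq0.
by move=> /(dvdp_trans (dvdp_mulIl _ _)); rewrite dvdp_XsubCl => /rootP.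
Qed.

Lemma bieval_dvd P Q Q' N : Q - Q' %| bieval P Q N - bieval P Q' N.
Proof.
rewrite /bieval; set M := map_poly _ N.
have /factor_theorem[G GE] : root (M - M.[Q']%:P) Q'.
  by apply/rootP; rewrite hornerD hornerN hornerC subrr.
have -> : M.[Q] - M.[Q'] = (M - M.[Q']%:P).[Q].
  by rewrite hornerD hornerN hornerC.
by rewrite GE hornerM hornerXsubC dvdp_mulIr.
Qed.

Lemma bieval_graph P T N : bieval P (T \Po P) N = N.[T] \Po P.
Proof. by rewrite /bieval -[RHS]/(comp_poly P _) -horner_map. Qed.

Lemma bieval_comp P Q L N : bieval (P \Po L) (Q \Po L) N = bieval P Q N \Po L.
Proof.
rewrite /bieval -[RHS]/(comp_poly L _) -horner_map -map_poly_comp /=.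
by congr (_.[_]); apply: eq_map_poly => u /=; rewrite comp_polyA.
Qed.

Lemma horner_bieval P Q N x :
  (bieval P Q N).[x] = (map_poly (horner_eval P.[x]) N).[Q.[x]].
Proof.
rewrite /bieval -[LHS]/(horner_eval x _) -horner_map -map_poly_comp /=.
congr (_.[_]); apply: eq_map_poly => u /=.
by rewrite /horner_eval horner_comp.
Qed.

(** If [Q] agrees to high order, at two zeros [z0] and [z1] of [P], with one
    and the same polynomial in [P], then every element of [F(P, Q)] without
    poles there takes the same value at both: it is the value at [0] of a
    rational function of [P] that approximates it. *)
Lemma opposite_value P Q W N D (z0 z1 : F) :
  P != 0 -> P.[z0] = 0 -> P.[z1] = 0 ->
  bieval P Q D != 0 -> W * bieval P Q D = bieval P Q N ->
  (forall K, exists T, ('X - z0%:P) ^+ K %| Q - (T \Po P) /\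
    ('X - z1%:P) ^+ K %| Q - (T \Po P)) ->
  W.[z0] = W.[z1].
Proof.
move=> P0 Pz0 Pz1 D0 WDN jets.
set e := bieval P Q D in D0 WDN.
have [L [u]] := multiplicity_XsubC e z0; rewrite D0/= => uz0 eE.
have [m0 [v0]] := multiplicity_XsubC P z0; rewrite P0/= => vz0 P0E.
have [m1 [v1]] := multiplicity_XsubC P z1; rewrite P0/= => vz1 P1E.
(* an order of contact larger than any order of vanishing that occurs below:
   [D(P, Q)] vanishes to order [L] at [z0], and [P ^ k] with [k <= L] to order at
   most [L m0] and [L m1] *)
pose K := (L * (m0 + m1) + L + 1)%N.
have [T [T0 T1]] := jets K.
pose d := D.[T]; pose n := N.[T].
have approx z : ('X - z%:P) ^+ K %| Q - (T \Po P) ->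
    ('X - z%:P) ^+ K %| e - (d \Po P) /\
    ('X - z%:P) ^+ K %| W * (d \Po P) - (n \Po P).
  move=> dvdT; have eD : ('X - z%:P) ^+ K %| e - (d \Po P).
    by rewrite -bieval_graph (dvdp_trans dvdT) ?bieval_dvd.
  split=> //.
  have -> : W * (d \Po P) - (n \Po P) =
      (bieval P Q N - (n \Po P)) - W * (e - (d \Po P)).
    by rewrite -WDN; ring.
  by rewrite dvdp_sub ?dvdp_mull// -bieval_graph (dvdp_trans dvdT) ?bieval_dvd.
have vanish z m v k h : P = v * ('X - z%:P) ^+ m -> v.[z] != 0 ->
    (k * m < K)%N -> ('X - z%:P) ^+ K %| P ^+ k * h -> h.[z] = 0.
  move=> PE vz kmK; rewrite PE exprMn -exprM mulnC [v ^+ k * _]mulrC -mulrA.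
  move=> /dvd_XsubC_exp_vanish => /(_ kmK)/eqP.
  by rewrite hornerM horner_exp mulf_eq0 expf_eq0 (negPf vz) andbF => /eqP.
have [eD0 WD0] := approx z0 T0; have [eD1 WD1] := approx z1 T1.
have LK : (L < K)%N by rewrite /K addn1 ltnS leq_addl.
have K_gt k m : (k <= L)%N -> (m <= m0 + m1)%N -> (k * m < K)%N.
  by move=> kL mm; rewrite /K addn1 ltnS (leq_trans (leq_mul kL mm))// leq_addr.
have d0 : d != 0.
  apply: contra_neq uz0 => d0; move: eD0; rewrite d0 comp_poly0 subr0 eE mulrC.
  exact: dvd_XsubC_exp_vanish.
have [k [g]] := multiplicity_XsubC d 0; rewrite d0/= subr0 => g0 dE.
have kL : (k <= L)%N.
  rewrite leqNgt; apply/negP => Lk; move/eqP: uz0; apply.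
  apply: (@dvd_XsubC_exp_vanish z0 L L.+1) => //; rewrite mulrC -eE.
  rewrite -[e](subrK (d \Po P)) dvdp_add//.
    by rewrite (dvdp_trans _ eD0)// dvdp_exp2l.
  rewrite dE comp_polyM comp_Xn_poly dvdp_mull//.
  rewrite (dvdp_trans (dvdp_exp2l _ Lk))// dvdp_exp2r// dvdp_XsubCl.
  exact/rootP.
have dP : d \Po P = P ^+ k * (g \Po P) by rewrite dE comp_polyM comp_Xn_poly mulrC.
(* [n] vanishes at [0] at least to the same order as [d] *)
have [n' nE] : exists n', n = n' * 'X^k.
  have [->|n0] := eqVneq n 0; first by exists 0; rewrite mul0r.
  have [j [h]] := multiplicity_XsubC n 0; rewrite n0/= subr0 => h0 nE.
  have [kj|jk] := leqP k j.
    by exists (h * 'X^(j - k)); rewrite -mulrA -exprD subnK.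
  exfalso; have := WD0; rewrite dP nE comp_polyM comp_Xn_poly.
  have -> : P ^+ k = P ^+ j * (P * P ^+ (k - j.+1)).
    by rewrite -exprS -exprD subnSK// subnKC// ltnW.
  have fact (a b c x y w : {poly F}) :
    a * (b * (c * x) * y) - w * b = b * (a * c * x * y - w).
    by ring.
  rewrite fact.
  move=> /(vanish z0 m0 v0) => /(_ P0E vz0) H.
  have /eqP := H (K_gt _ _ (ltnW (leq_trans jk kL)) (leq_addr _ _)).
  rewrite hornerD hornerN !hornerM !horner_comp Pz0 mulr0 !mul0r sub0r.
  by rewrite oppr_eq0; apply/negP; exact: h0.
have final z m v : P = v * ('X - z%:P) ^+ m -> v.[z] != 0 -> P.[z] = 0 ->
    (k * m < K)%N -> ('X - z%:P) ^+ K %| W * (d \Po P) - (n \Po P) ->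
    W.[z] * g.[0] = n'.[0].
  move=> PE vz Pz kmK; rewrite dP nE comp_polyM comp_Xn_poly.
  have fact (a b y w : {poly F}) : a * (b * y) - w * b = b * (a * y - w).
    by ring.
  rewrite fact.
  move=> /(vanish z m v k _ PE vz kmK)/eqP.
  by rewrite hornerD hornerN hornerM !horner_comp Pz subr_eq0 => /eqP.
apply: (mulIf g0).
rewrite (final z0 m0 v0)//; last by rewrite K_gt ?leq_addr.
by rewrite (final z1 m1 v1)//; rewrite K_gt ?leq_addl.
Qed.

End Valuations.

Section ComplexValues.
Context {R : realType}.
Local Notation C := R[i].
Local Notation toC := (map_poly (real_complex R)).
Implicit Types (p q : {poly R}) (P Q W : {poly C}) (N D : {poly {poly C}}).

(** On the real line these evaluate to the real and imaginary parts of [Q]. *)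
Definition reP Q : {poly R} := map_poly (@complex.Re R) Q.
Definition imP Q : {poly R} := map_poly (@complex.Im R) Q.

Lemma reP_imP Q : Q = toC (reP Q) + 'i%:P * toC (imP Q).
Proof.
apply/polyP => i; rewrite coefD coefCM !coef_map_id0//=.
exact: complexE.
Qed.

Lemma horner_reP_imP Q (x : R) :
  Q.[x%:C] = (reP Q).[x] +i* (imP Q).[x].
Proof.
rewrite [in LHS](reP_imP Q) hornerD hornerM hornerC !horner_map.
by rewrite [RHS]complexE.
Qed.

(** Lipschitz continuity in the second variable, uniform in the first: two
    points where [P] agrees are compared through their values of [Q]. *)
Lemma bieval_lipschitz N (B : C) : exists2 M, 0 <= M & forall y u v,
  `|y| <= B -> `|u| <= B -> `|v| <= B ->
  `|(map_poly (horner_eval y) N).[u] - (map_poly (horner_eval y) N).[v]| <=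
    M * `|u - v|.
Proof.
suff [M1 [M2 [M10 M20 H]]] : exists M1 M2, [/\ 0 <= M1, 0 <= M2 &
    forall y u v, `|y| <= B -> `|u| <= B -> `|v| <= B ->
    `|(map_poly (horner_eval y) N).[u]| <= M2 /\
    `|(map_poly (horner_eval y) N).[u] - (map_poly (horner_eval y) N).[v]| <=
    M1 * `|u - v|].
  by exists M1 => // y u v yB uB vB; have [] := H y u v yB uB vB.
have [B0|B0] := boolP (0 <= B); last first.
  exists 0, 0; split=> // y u v yB.
  by have := le_trans (normr_ge0 y) yB; rewrite (negPf B0).
elim/poly_ind: N => [|N c [M1 [M2 [M10 M20 H]]]].
  by exists 0, 0; split=> // y u v _ _ _; rewrite rmorph0 !horner0 subr0 normr0 mul0r.
have [M M0 cM] := horner_bounded c B.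
exists (B * M1 + M2), (M2 * B + M).
split=> [||y u v yB uB vB]; rewrite ?addr_ge0 ?mulr_ge0//.
have [H1 H2] := H y u v yB uB vB; have [H3 _] := H y v u yB vB uB.
rewrite rmorphD rmorphM /= map_polyX map_polyC /= !hornerMXaddC; split.
  by rewrite (le_trans (ler_normD _ _))// lerD ?cM// normrM ler_pM.
set a := (_).[u] in H1 H2 *; set b := (_).[v] in H2 H3 *.
have -> : a * u + horner_eval y c - (b * v + horner_eval y c) =
  u * (a - b) + b * (u - v) by ring.
rewrite (le_trans (ler_normD _ _))// !normrM mulrDl lerD//.
  by rewrite -mulrA ler_pM.
by rewrite ler_wpM2r.
Qed.

End ComplexValues.

(** * Definiteness *)

Section Definiteness.
Context {R : realType}.
Local Notation C := R[i].
Local Notation toC := (map_poly (real_complex R)).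
Local Notation mu := (@lebesgue_measure R).
Implicit Types (p q : {poly R}) (P Q W : {poly C}) (N D : {poly {poly C}}).

Let small (e : R) (s : seq R) : 0 < e -> all (fun x => 0 < x) s ->
  exists2 x, 0 < x & x < e /\ all (fun y => x < y) s.
Proof.
move=> e0; elim: s e e0 => [|y s IH] e e0 /=.
  by exists (e / 2); [rewrite divr_gt0|split=> //; lra].
move=> /andP[y0 s0]; have [|x x0 [xe xs]] := IH (Num.min e y) _ s0.
  by rewrite lt_min e0.
by exists x => //; move: xe; rewrite lt_min => /andP[-> ->].
Qed.

Let horner_le_dist p (z : R) : p.[z] = 0 -> exists2 M, 0 <= M &
  forall x, `|x - z| <= 1 -> `|p.[x]| <= M * `|x - z|.
Proof.
move=> pz; have [M M0 pM] := horner_lipschitz p z.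
by exists M => // x /pM; rewrite pz subr0.
Qed.

Section RealMoments.
Context (p : {poly R}).
Hypotheses (p_neq0 : p != 0) (p0 : p.[0] = 0) (p1 : p.[1] = 0).
Hypothesis simple : forall x, 0 < x < 1 -> p.[x] = 0 -> p^`().[x] != 0.
Hypothesis pos0 : exists2 e, 0 < e & forall x, 0 < x < e -> 0 < p.[x].

Let vanishing q := forall k, \int[mu]_(x in `[0, 1]) (p ^+ k * q * p^`()).[x] = 0.

(* the function [f] of [ends_same_sign] turns out to be flat at [0] *)
Let same_sign_close q K : vanishing q ->
    (exists2 e, 0 < e & forall x, 1 - e < x < 1 -> 0 < p.[x]) ->
  exists B d, [/\ 0 <= B, 0 < d & forall x x', 0 < x < d -> 1 - d < x' < 1 ->
    p.[x] = p.[x'] -> `|q.[x] - q.[x']| <= B * x ^+ K].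
Proof.
move=> mom pos1.
have [f [d [tf d0 f0 qf]]] := ends_same_sign p_neq0 p0 p1 simple mom pos0 pos1.
have [T [B [e [B0 e0 fT]]]] := tf K.
(* the expansion of [f] vanishes because [f] does so on one side *)
have /dvd_near[M M0 TM] : ('X - 0%:P) ^+ K %| T.
  apply: (@dvd_of_bound _ _ _ B) => h h0.
  have [x x0 [xh /= /andP[xe _]]] := @small h [:: e] h0 ltac:(by rewrite /= e0).
  exists (- x); rewrite subr0 normrN (gtr0_norm x0) ?x0//.
  have := fT (- x); rewrite f0 ?oppr_lt0// sub0r !normrN (gtr0_norm x0) x0 xe.
  by move=> /(_ isT).
have [A A0 pA] := horner_le_dist p0.
have A1 : 0 < A + 1 by rewrite ltr_wpDl.
have [e' e'0 pe'] := pos0.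
have [d' d'0 [d'd /= /and4P[d'1 d'e d'e' _]]] :=
  @small d [:: 1; Num.min 1 e / (A + 1); e'] d0
  ltac:(by rewrite /= ltr01 divr_gt0// ?lt_min ?ltr01// e'0).
exists ((B + M) * A ^+ K), d'; split=> //.
  by rewrite mulr_ge0 ?addr_ge0// exprn_ge0.
move=> x x' /andP[x0 xd] /andP[x'1 x'2] xx'.
rewrite qf//; last 2 first.
  - by rewrite x0 (lt_trans xd).
  - by rewrite x'2 andbT (lt_trans _ x'1)// ltrD2l ltrN2.
have px0 : 0 < p.[x] by apply: pe'; rewrite x0 (lt_trans xd).
have pxA : `|p.[x]| <= A * x.
  have := pA x; rewrite subr0 (gtr0_norm x0); apply.
  by rewrite ltW// (lt_trans xd).
have : (A + 1) * x < Num.min 1 e.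
  by rewrite mulrC -ltr_pdivlMr// (lt_trans xd).
rewrite lt_min mulrDl mul1r => /andP[x1 xe].
have fTx : `|f p.[x] - T.[p.[x]]| <= B * `|p.[x]| ^+ K.
  by apply: fT; rewrite normr_gt0 gt_eqF//=; lra.
have Tx : `|T.[p.[x]]| <= M * `|p.[x]| ^+ K.
  by have := TM p.[x]; rewrite subr0; apply; lra.
rewrite -[f _](subrK T.[p.[x]]) (le_trans (ler_normD _ _))//.
rewrite (le_trans (lerD fTx Tx))// -mulrDl -mulrA ler_wpM2l ?addr_ge0//.
by rewrite -exprMn lerXn2r// nnegrE mulr_ge0// ltW.
Qed.

Let opposite_expansion q K : vanishing q ->
    (exists2 e, 0 < e & forall x, 1 - e < x < 1 -> p.[x] < 0) ->
  exists T, ('X - 0%:P) ^+ K %| q - (T \Po p) /\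
    ('X - 1%:P) ^+ K %| q - (T \Po p).
Proof.
move=> mom neg1.
have [f [d [tf d0 qf0 qf1]]] := ends_opposite_sign p_neq0 p0 p1 simple mom pos0 neg1.
have [T [B [e [B0 e0 fT]]]] := tf K.
have [e' e'0 pe'] := pos0; have [e1 e10 pe1] := neg1.
have [A A0 pA] := horner_le_dist p0; have [A' A'0 pA'] := horner_le_dist p1.
exists T; split.
- apply: (@dvd_of_bound _ _ _ (B * A ^+ K)) => h h0.
  have A1 : 0 < A + 1 by rewrite ltr_wpDl.
  have [x x0 [xh /= /and5P[xd xe' x1 xA _]]] :=
    @small h [:: d; e'; 1; e / (A + 1)] h0
      ltac:(by rewrite /= d0 e'0 ltr01 divr_gt0).
  exists x; rewrite subr0 (gtr0_norm x0) ?x0// hornerD hornerN horner_comp.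
  rewrite qf0 ?x0//.
  have pxA : `|p.[x]| <= A * x.
    by have := pA x; rewrite subr0 (gtr0_norm x0); apply; exact: ltW.
  have Ax : A * x < e by move: xA; rewrite ltr_pdivlMr// => xA; nra.
  rewrite (le_trans (fT _ _))//.
    by rewrite normr_gt0 gt_eqF ?pe' ?x0//=; lra.
  by rewrite -mulrA ler_wpM2l// -exprMn lerXn2r// nnegrE mulr_ge0// ltW.
- apply: (@dvd_of_bound _ _ _ (B * A' ^+ K)) => h h0.
  have A1 : 0 < A' + 1 by rewrite ltr_wpDl.
  have [x x0 [xh /= /and5P[xd xe1 x1 xA _]]] :=
    @small h [:: d; e1; 1; e / (A' + 1)] h0
      ltac:(by rewrite /= d0 e10 ltr01 divr_gt0).
  have xE : `|1 - x - 1| = x by rewrite addrC addKr normrN gtr0_norm.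
  exists (1 - x); rewrite xE ?x0// hornerD hornerN horner_comp.
  have pneg : p.[1 - x] < 0 by apply: pe1; rewrite ltrD2l ltrN2 xe1 gtrBl.
  rewrite qf1; last by rewrite ltrD2l ltrN2 xd gtrBl.
  have pxA : `|p.[1 - x]| <= A' * x.
    by have := pA' (1 - x); rewrite xE; apply; exact: ltW.
  have Ax : A' * x < e by move: xA; rewrite ltr_pdivlMr// => xA; nra.
  rewrite (le_trans (fT _ _))//.
    by rewrite normr_gt0 lt_eqF//=; lra.
  by rewrite -mulrA ler_wpM2l// -exprMn lerXn2r// nnegrE mulr_ge0// ltW.
Qed.

Section ComplexMoments.
Context (Q W : {poly C}) (N D : {poly {poly C}}).
Local Notation P := (toC p).
Hypothesis D_neq0 : bieval P Q D != 0.
Hypothesis W_generated : W * bieval P Q D = bieval P Q N.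
Hypothesis moments_re : vanishing (reP Q).
Hypothesis moments_im : vanishing (imP Q).

Let P_real (x : R) : P.[x%:C] = p.[x]%:C.
Proof. exact: horner_map. Qed.

Let value_opposite :
    (exists2 e, 0 < e & forall x, 1 - e < x < 1 -> p.[x] < 0) ->
  W.[0] = W.[1].
Proof.
move=> neg1; apply: (@opposite_value _ P Q W N D) => //.
- by rewrite map_poly_eq0.
- by rewrite (P_real 0) p0.
- by rewrite (P_real 1) p1.
move=> K; have [T1 [T10 T11]] := opposite_expansion K moments_re neg1.
have [T2 [T20 T21]] := opposite_expansion K moments_im neg1.
exists (toC T1 + 'i%:P * toC T2).
have -> : Q - ((toC T1 + 'i%:P * toC T2) \Po P) =
    toC (reP Q - (T1 \Po p)) + 'i%:P * toC (imP Q - (T2 \Po p)).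
  have E r T : toC (r - (T \Po p)) = toC r - (toC T \Po P).
    by rewrite rmorphB /= map_comp_poly.
  rewrite !E {1}(reP_imP Q) comp_polyD comp_polyM comp_polyC mulrBr opprD.
  exact: addrACA.
have dvdC (z : R) r : ('X - z%:P) ^+ K %| r -> ('X - z%:C%:P) ^+ K %| toC r.
  by move=> h; rewrite -(map_polyXsubC (real_complex R)) -rmorphXn dvdp_map.
split; rewrite dvdp_add ?dvdp_mull//; [exact: (dvdC 0)|exact: (dvdC 0)|
  exact: (dvdC 1)|exact: (dvdC 1)].
Qed.

(* The numerator and the denominator of [W] agree at [x] and [x'] up to
   [O(x ^ (L + 1))], and the denominator is of order [x ^ L]. *)
Let branches_close :
    (exists2 e, 0 < e & forall x, 1 - e < x < 1 -> 0 < p.[x]) ->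
  exists B d, [/\ 0 <= B, 0 < d & forall x x' : R,
    0 < x < d -> 1 - d < x' < 1 -> p.[x] = p.[x'] ->
    cabs (W.[x%:C] - W.[x'%:C]) <= B * x].
Proof.
move=> pos1.
have [D0 WE] := (D_neq0, W_generated); set e := bieval P Q D in D0 WE.
have [L [u]] := multiplicity_XsubC e 0; rewrite D0/= => u0 eE.
have [B1 [d1 [B10 d10 re_close]]] := same_sign_close L.+1 moments_re pos1.
have [B2 [d2 [B20 d20 im_close]]] := same_sign_close L.+1 moments_im pos1.
have [MP MP0 PM] := bounded_cabs P (1 : R).
have [MQ MQ0 QM] := bounded_cabs Q (1 : R).
have [MW MW0 WM] := bounded_cabs W (1 : R).
have lipschitz M : exists2 A, 0 <= A & forall x x' : R,
    `|x| <= 1 -> `|x'| <= 1 -> p.[x] = p.[x'] ->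
    cabs ((bieval P Q M).[x%:C] - (bieval P Q M).[x'%:C]) <=
      A * cabs (Q.[x%:C] - Q.[x'%:C]).
  have [A A0 MA] := bieval_lipschitz M (MP + MQ)%:C.
  exists (complex.Re A) => [|x x' x1 x'1 xx'].
    by rewrite -lecR -ge0_ReE.
  have bnd (t : R) : `|t| <= 1 -> `|P.[t%:C]| <= (MP + MQ)%:C /\
      `|Q.[t%:C]| <= (MP + MQ)%:C.
    move=> t1; rewrite !normCE !lecR; split.
      by rewrite (le_trans (PM _ _)) ?cabs_real// lerDl.
    by rewrite (le_trans (QM _ _)) ?cabs_real// lerDr.
  have [bP bQ] := bnd x x1; have [_ bQ'] := bnd x' x'1.
  rewrite !horner_bieval -lecR rmorphM /= -!normCE -ge0_ReE//.
  have -> : P.[x'%:C] = P.[x%:C] by rewrite !P_real xx'.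
  exact: MA.
have [AN AN0 Nlip] := lipschitz N; have [AD AD0 Dlip] := lipschitz D.
have cu0 : 0 < cabs u.[0] / 2 by rewrite divr_gt0// cabs_gt0.
have [du /andP[du0 du1] u_near] := near_cabs u 0 cu0.
pose B3 := (AN + MW * AD) * (B1 + B2) / (cabs u.[0] / 2).
have B30 : 0 <= B3.
  by rewrite divr_ge0 ?(ltW cu0)// !(addr_ge0, mulr_ge0).
pose d := Num.min (Num.min d1 d2) du.
exists B3, d; split=> //; first by rewrite !lt_min d10 d20.
move=> x x'.
rewrite /d !lt_min => /andP[x0 /andP[/andP[xd1 xd2] xdu]].
rewrite ltrBlDr -ltrBlDl !lt_min => /andP[/andP[/andP[x'd1 x'd2] x'du] x'1] xx'.
have x1 : `|x| <= 1 by rewrite (gtr0_norm x0) ltW// (lt_le_trans xdu).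
have x'0 : 0 < x' by have := lt_le_trans x'du du1; rewrite ltrBlDr ltrDl.
have x'1' : `|x'| <= 1 by rewrite (gtr0_norm x'0) ltW.
have Qclose : cabs (Q.[x%:C] - Q.[x'%:C]) <= (B1 + B2) * x ^+ L.+1.
  rewrite !horner_reP_imP (le_trans (cabs_le_ReIm _))//= mulrDl lerD//.
    by apply: re_close => //; rewrite ?x0 ?x'1 ?andbT// ltrBlDr -ltrBlDl.
  by apply: im_close => //; rewrite ?x0 ?x'1 ?andbT// ltrBlDr -ltrBlDl.
have e_lower : cabs u.[0] / 2 * x ^+ L <= cabs e.[x%:C].
  rewrite eE hornerM horner_exp hornerXsubC subr0 cabsM cabsX cabs_real.
  rewrite (gtr0_norm x0) ler_wpM2r ?exprn_ge0 ?ltW//.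
  have := u_near x%:C; rewrite subr0 cabs_real (gtr0_norm x0) => /(_ (ltW xdu)).
  have := cabs_triangle u.[x%:C] u.[0] 0; rewrite !subr0 cabsBC.
  by lra.
have key : cabs (W.[x%:C] - W.[x'%:C]) * cabs e.[x%:C] <=
    (AN + MW * AD) * ((B1 + B2) * x ^+ L.+1).
  rewrite -cabsM.
  have -> : (W.[x%:C] - W.[x'%:C]) * e.[x%:C] =
      ((W * e).[x%:C] - (W * e).[x'%:C]) - W.[x'%:C] * (e.[x%:C] - e.[x'%:C]).
    by rewrite !hornerM; ring.
  rewrite WE (le_trans (cabsB _ _))// mulrDl lerD//.
    by rewrite (le_trans (Nlip _ _ x1 x'1' xx'))// ler_wpM2l.
  rewrite cabsM -mulrA ler_pM ?cabs_ge0//; first by apply: WM; rewrite cabs_real.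
  by rewrite (le_trans (Dlip _ _ x1 x'1' xx'))// ler_wpM2l.
have xL : 0 < x ^+ L by rewrite exprn_gt0.
rewrite /B3 -(ler_pM2r cu0) mulrAC divfK ?gt_eqF// -(ler_pM2r xL).
rewrite -mulrA (le_trans (ler_wpM2l (cabs_ge0 _) e_lower))// (le_trans key)//.
by rewrite exprS le_eqVlt; apply/orP; left; apply/eqP; ring.
Qed.

Let value_same :
    (exists2 e, 0 < e & forall x, 1 - e < x < 1 -> 0 < p.[x]) ->
  W.[0] = W.[1].
Proof.
move=> pos1; have [B3 [d [B30 d0 W_close]]] := branches_close pos1.
apply/eqP; rewrite -subr_eq0 -cabs_eq0 eq_le cabs_ge0 andbT leNgt.
apply/negP => gap.
have gap4 : 0 < cabs (W.[0] - W.[1]) / 4 by rewrite divr_gt0.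
have [h0 /andP[h00 _] W0] := near_cabs W 0 gap4.
have [h1 /andP[h10 _] W1] := near_cabs W 1 gap4.
have [e1 e10 pe1] := pos1; have [e0 e00 pe0] := pos0.
have [x' x'0 [x'd /= /and4P[x'h1 x'e1 x'1 _]]] := @small d [:: h1; e1; 1] d0
  ltac:(by rewrite /= h10 e10 ltr01).
have px' : 0 < p.[1 - x'] by apply: pe1; apply/andP; split; lra.
have [hx /andP[hx0 _] p_small] := horner_near p 0 px'.
have B31 : 0 < B3 + 1 by rewrite ltr_wpDl.
have [x x0 [xd /= /and5P[xh0 xe0 xhx xB _]]] := @small d
  [:: h0; e0; hx; cabs (W.[0] - W.[1]) / 4 / (B3 + 1)] d0
  ltac:(by rewrite /= h00 e00 hx0 divr_gt0).
have px0 : 0 < p.[x] by apply: pe0; rewrite x0.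
have pxx' : p.[x] < p.[1 - x'].
  have := p_small x; rewrite p0 !subr0 (gtr0_norm x0) (gtr0_norm px0).
  by apply; exact: ltW.
(* [p] takes the small value [p x] between [1 - x'] and [1] *)
have [x'' x''1 px''] : exists2 x'', 1 - x' < x'' < 1 & p.[x''] = p.[x].
  have [||t] := @polyrcf.poly_ivtoo R (p - p.[x]%:P) (1 - x') 1; first by lra.
    by rewrite !hornerD !hornerN !hornerC p1 sub0r mulrN oppr_lt0 mulr_gt0// subr_gt0.
  rewrite in_itv/= => t1 /rootP; rewrite hornerD hornerN hornerC => /eqP.
  by rewrite subr_eq0 => /eqP pt; exists t.
have x''d : 1 - d < x'' < 1.
  by case/andP: x''1 => t1 ->; rewrite andbT (lt_trans _ t1)// ltrD2l ltrN2.
have WX := W_close x x'' ltac:(by rewrite x0) x''d (esym px'').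
have W0x : cabs (W.[x%:C] - W.[0]) < cabs (W.[0] - W.[1]) / 4.
  by apply: W0; rewrite subr0 cabs_real (gtr0_norm x0) ltW.
have W1x : cabs (W.[x''%:C] - W.[1]) < cabs (W.[0] - W.[1]) / 4.
  apply: W1; rewrite -[1]/(1%:C) -rmorphB /= cabs_real.
  by case/andP: x''1 => t1 t2; rewrite ltr0_norm ?subr_lt0// opprB lerBlDr -lerBlDl (le_trans _ (ltW t1))// lerD2l lerN2 ltW.
have : B3 * x < cabs (W.[0] - W.[1]) / 4.
  by move: xB; rewrite ltr_pdivlMr// => /(lt_trans _); apply; rewrite mulrC ltr_pM2l// ltrDl.
have := cabs_triangle W.[x%:C] W.[0] W.[1].
have := cabs_triangle W.[x''%:C] W.[x%:C] W.[1].
rewrite (cabsBC W.[0] W.[x%:C]); lra.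
Qed.

(** The sign of [p] to the left of [1] decides between the two arguments:
    continuity along two branches of the inverse of [p], or one expansion valid
    at both ends. *)
Lemma endpoint_values : W.[0] = W.[1].
Proof.
have [d /andP[d0 _] [_ mono]] := monotone_left p_neq0 p1.
have s0 : 0 < Num.sg p.[1 - d] * p.[1 - d].
  by have := mono (1 - d) 1; rewrite p1 subr0; apply; lra.
have pN0 : p.[1 - d] != 0 by apply: contraTneq s0 => ->; rewrite mulr0 ltxx.
case: (ltgtP p.[1 - d] 0) pN0 => // pd _.
  apply: value_opposite; exists d => // x /andP[x1 x2].
  have := mono x 1; rewrite p1 subr0 ltr0_sg// mulN1r oppr_gt0.
  by apply; lra.
apply: value_same; exists d => // x /andP[x1 x2].
have := mono x 1; rewrite p1 subr0 gtr0_sg// mul1r.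
by apply; lra.
Qed.

End ComplexMoments.
End RealMoments.
End Definiteness.

(** The interval is normalized to [[0, 1]] and the sign of [p] to the right of
    [0] to [+].  Lueroth's theorem provides [W] with [P] and [Q] polynomials in
    it; since [W] is rational in [P] and [Q], its values at the endpoints are
    controlled by [endpoint_values]. *)
Lemma definite_real (R : realType) (a b : R) (P : {poly R}) : a < b ->
  P != 0 -> P.[a] = 0 -> P.[b] = 0 ->
  (forall x, a < x < b -> P.[x] = 0 -> P^`().[x] != 0) ->
  definite (map_poly (real_complex R) P) a%:C b%:C.
Proof.
move=> ab P0 Pa Pb simple Q moments.
pose toC := map_poly (real_complex R).
have ba0 : b - a != 0 by rewrite subr_eq0 gt_eqF.
pose L : {poly R} := (b - a) *: 'X + a%:P.
have LE x : L.[x] = (b - a) * x + a by rewrite hornerD hornerZ hornerX hornerC.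
have dL : L^`() = (b - a)%:P.
  by rewrite derivD derivZ derivX derivC addr0 -mul_polyC mulr1.
pose p := P \Po L.
have pE x : p.[x] = P.[L.[x]] by rewrite horner_comp.
have p_neq0 : p != 0.
  rewrite -size_poly_eq0 size_comp_poly2 ?size_poly_eq0//.
  by rewrite size_polyDl size_scale// size_polyX// (leq_ltn_trans (size_polyC_leq1 _)).
have p0 : p.[0] = 0 by rewrite pE LE mulr0 add0r.
have p1 : p.[1] = 0 by rewrite pE LE mulr1 subrK.
have dp x : p^`().[x] = P^`().[L.[x]] * (b - a).
  by rewrite deriv_comp hornerM horner_comp dL hornerC.
have psimple x : 0 < x < 1 -> p.[x] = 0 -> p^`().[x] != 0.
  move=> /andP[x0 x1]; rewrite pE dp LE => px; rewrite mulf_neq0// simple//.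
  have ba : 0 < b - a by rewrite subr_gt0.
  rewrite ltrDr mulr_gt0//= -ltrBrDr -[ltRHS]mulr1 ltr_pM2l//.
pose Q1 := Q \Po toC L.
have momE k : (\int[lebesgue_measure]_(x in `[0, 1]) (p ^+ k * reP Q1 * p^`()).[x] = 0) /\
    (\int[lebesgue_measure]_(x in `[0, 1]) (p ^+ k * imP Q1 * p^`()).[x] = 0).
  have := moments k; rewrite /segment_integral => /eqP.
  rewrite eq_complex => /andP[/eqP re0 /eqP im0].
  have hE (t : R) : (toC P).[a%:C + t%:C * (b%:C - a%:C)] ^+ k *
      Q.[a%:C + t%:C * (b%:C - a%:C)] * (toC P)^`().[a%:C + t%:C * (b%:C - a%:C)]
      * (b%:C - a%:C) =
      (p ^+ k * reP Q1 * p^`()).[t] +i* (p ^+ k * imP Q1 * p^`()).[t].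
    have LtE : a%:C + t%:C * (b%:C - a%:C) = (L.[t])%:C.
      by rewrite LE rmorphD rmorphM rmorphB /= addrC mulrC.
    have QE : Q.[(L.[t])%:C] = (reP Q1).[t] +i* (imP Q1).[t].
      by rewrite -horner_reP_imP horner_comp horner_map.
    rewrite LtE QE deriv_map !horner_map -rmorphB /= -mulrA -rmorphM /= -dp.
    rewrite !hornerM !horner_exp !pE -rmorphXn /=.
    move: (_ ^+ k) (reP Q1).[t] (imP Q1).[t] p^`().[t] => x y z w.
    by apply/eqP; rewrite eq_complex /=; apply/andP; split; apply/eqP; ring.
  by split; [rewrite -[RHS]re0|rewrite -[RHS]im0]; apply: eq_Rintegral => t _;
    rewrite hE.
have sP : (1 < size (toC P))%N.
  rewrite size_map_poly; apply: (root_size_gt1 (a := a)) => //; exact/rootP.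
have [W [P' [Q' [N [D [PE QE D0 WE]]]]]] := @luroth R[i] (toC P) Q sP.
exists P', Q', W; split=> //.
pose L' := toC L.
have W0 : (W \Po L').[0] = W.[a%:C].
  by rewrite horner_comp -[0]/(0%:C) horner_map LE mulr0 add0r.
have W1 : (W \Po L').[1] = W.[b%:C].
  by rewrite horner_comp -[1]/(1%:C) horner_map LE mulr1 subrK.
rewrite -W0 -W1.
have toCp : toC p = toC P \Po L' by exact: map_comp_poly.
have D0' : bieval (toC p) Q1 D != 0.
  rewrite toCp bieval_comp -size_poly_eq0 size_comp_poly2 ?size_poly_eq0//.
  rewrite size_map_poly.
  by rewrite size_polyDl size_scale// size_polyX// (leq_ltn_trans (size_polyC_leq1 _)).
have WE' : (W \Po L') * bieval (toC p) Q1 D = bieval (toC p) Q1 N.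
  by rewrite toCp !bieval_comp -comp_polyM WE.
have [d /andP[d0 _] [_ mono]] := monotone_right p_neq0 p0.
have s0 : 0 < Num.sg p.[0 + d] * p.[0 + d].
  by have := mono 0 (0 + d); rewrite p0 subr0; apply; rewrite // ltrDl.
have pN0 : p.[0 + d] != 0 by apply: contraTneq s0 => ->; rewrite mulr0 ltxx.
case: (ltgtP p.[0 + d] 0) pN0 => // pd _; last first.
  apply: (@endpoint_values R p) D0' WE' _ _ => //; last 2 first.
  - by move=> k; have [] := momE k.
  - by move=> k; have [] := momE k.
  exists d => // x /andP[x1 x2].
  have := mono 0 x; rewrite p0 subr0 gtr0_sg// mul1r.
  by apply; rewrite // add0r ltW.
(* replacing [p] by [- p] amounts to substituting [- x] in [N] and [D] *)
pose neg := map_poly (comp_poly (- 'X : {poly R[i]})).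
have bievalN M : bieval (toC (- p)) Q1 (neg M) = bieval (toC p) Q1 M.
  rewrite /bieval /neg -map_poly_comp /=; congr (_.[_]); apply: eq_map_poly => u /=.
  rewrite -comp_polyA; congr (_ \Po _).
  by rewrite rmorphN /= comp_polyX /toC rmorphN /= opprK.
have signE k (q : {poly R}) : (- p) ^+ k * q * (- p)^`() =
    (- (-1) ^+ k) *: (p ^+ k * q * p^`()).
  rewrite [(- p) ^+ k]exprNn derivN scaleNr -mul_polyC polyC_exp polyCN.
  by rewrite mulrN !mulrA.
apply: (@endpoint_values R (- p) _ _ _ _ _ Q1 _ (neg N) (neg D)).
- by rewrite oppr_eq0.
- by rewrite hornerN p0 oppr0.
- by rewrite hornerN p1 oppr0.
- by move=> x x01 /eqP; rewrite derivN !hornerN !oppr_eq0 => /eqP; exact: psimple.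
- exists d => // x /andP[x1 x2]; rewrite hornerN oppr_gt0.
  have := mono 0 x; rewrite p0 subr0 ltr0_sg// mulN1r oppr_gt0.
  by apply; rewrite // add0r ltW.
- by rewrite bievalN.
- by rewrite !bievalN.
- by move=> k; rewrite signE integral_hornerZ; have [-> _] := momE k; rewrite mulr0.
- by move=> k; rewrite signE integral_hornerZ; have [_ ->] := momE k; rewrite mulr0.
Qed.

(** * Curves in the complex plane *)

Section RealDerivatives.
Context {R : realType}.
Implicit Types (f g : R -> R) (t : R).

Lemma der_cst (c t : R) : is_derive t 1 (fun=> c : R) 0.
Proof. exact: is_derive_cst. Qed.

Lemma der_add f g t (u v : R) : is_derive t 1 f u -> is_derive t 1 g v ->
  is_derive t 1 (fun s => f s + g s) (u + v).
Proof. by move=> df dg; exact: is_deriveD. Qed.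

Lemma der_mul f g t (u v : R) : is_derive t 1 f u -> is_derive t 1 g v ->
  is_derive t 1 (fun s => f s * g s) (u * g t + f t * v).
Proof.
move=> df dg; apply: is_derive_eq (is_deriveM df dg) _.
by rewrite -[f t *: v]/(f t * v) -[g t *: u]/(g t * u) addrC [g t * u]mulrC.
Qed.

Lemma der_inv f t (u : R) : f t != 0 -> is_derive t 1 f u ->
  is_derive t 1 (fun s => (f s)^-1) (- (f t)^-1 * (f t)^-1 * u).
Proof.
move=> ft [df fu]; apply: DeriveDef; first exact: derivableV.
by rewrite deriveV// fu -[_ *: u]/(_ * u) expr2 invfM !mulNr.
Qed.

Lemma der_affine f (k c t u : R) : is_derive (k * t + c) 1 f u ->
  is_derive t 1 (fun s => f (k * s + c)) (k * u).
Proof.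
move=> [df fu].
have dl : is_derive t 1 (fun s : R => k * s + c) k.
  apply: is_derive_eq
    (der_add (der_mul (der_cst k t) (is_derive_id t 1)) (der_cst c t)) _.
  by rewrite mul0r mulr1 add0r addr0.
have [dl1 dl2] := dl; apply: DeriveDef.
  move/derivable1_diffP : dl1 => dl1; move/derivable1_diffP : df => df.
  by apply/derivable1_diffP; exact: (differentiable_comp dl1 df).
rewrite -derive1E -[fun s => f _]/(f \o (fun s : R => k * s + c)).
by rewrite (derive1_comp dl1 df) !derive1E fu dl2 mulrC.
Qed.

Lemma der_squeeze0 f g t : (\forall s \near t, `|f s| <= g s) -> g t = 0 ->
  is_derive t 1 g 0 -> is_derive t 1 f 0.
Proof.
move=> fg gt0 [dg gv].
have ft : f t = 0.
  by have := nbhs_singleton fg; rewrite gt0 normr_le0 => /eqP.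
have lim0 : h^-1 *: ((f \o shift t) (h *: (1 : R)) - f t) @[h --> 0^'] --> (0 : R).
  have lg : h^-1 *: ((g \o shift t) (h *: (1 : R)) - g t) @[h --> 0^'] --> (0 : R).
    by rewrite -[X in _ --> X]gv; exact: dg.
  have {}lg := cvg_norm lg; rewrite normr0 in lg; apply/norm_cvg0P.
  have near0 : \forall h \near 0^', `|f (h + t)| <= g (h + t).
    have : \forall h \near 0, `|f (h + t)| <= g (h + t).
      by move: fg; rewrite (near_shift 0) subr0.
    by move=> ?; exact: nbhs_dnbhs.
  apply: (@squeeze_cvgr _ _ _ _ (fun=> 0)
    (fun h => `|h^-1 *: ((g \o shift t) (h *: (1 : R)) - g t)|));
    [|exact: cvg_cst|exact: lg].
  near=> h; rewrite normr_ge0/= ft gt0 !subr0 !normrM ler_wpM2l//.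
  rewrite -[h *: 1]/(h * 1) mulr1 (le_trans _ (ler_norm _))//.
  by near: h.
apply: DeriveDef; first by apply/cvg_ex; exists 0.
exact: (cvg_lim _ lim0).
Unshelve. all: by end_near. Qed.

End RealDerivatives.

Section ComplexCurves.
Context {R : realType}.
Local Notation C := R[i].
Implicit Types (g h : R -> C) (P : {poly C}) (t s : R).

(** The componentwise derivative as a relation: it carries differentiability,
    unlike an equation on [velocity]. *)
Definition cder g t (v : C) : Prop :=
  is_derive t 1 (fun s => complex.Re (g s)) (complex.Re v) /\
  is_derive t 1 (fun s => complex.Im (g s)) (complex.Im v).

Lemma cder_velocity g t v : cder g t v -> velocity g t = v.
Proof.
by move=> [[_ re] [_ im]]; rewrite /velocity !derive1E re im; case: (v).
Qed.

Lemma smooth_cder g t : smooth g -> cder g t (velocity g t).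
Proof.
move=> /(_ 0%N t)[re im]; rewrite /velocity !derive1E.
by split; [exact: (derivableP re)|exact: (derivableP im)].
Qed.

Lemma cder_cst (c : C) t : cder (fun=> c) t 0.
Proof. by split; exact: der_cst. Qed.

Lemma cder_add g h t u v : cder g t u -> cder h t v ->
  cder (fun s => g s + h s) t (u + v).
Proof.
move=> [gr gi] [hr hi].
have reD (x y : C) : complex.Re (x + y) = complex.Re x + complex.Re y.
  by case: x; case: y.
have imD (x y : C) : complex.Im (x + y) = complex.Im x + complex.Im y.
  by case: x; case: y.
split; rewrite (reD, imD); under eq_fun do rewrite (reD, imD).
  exact: der_add.
exact: der_add.
Qed.

Lemma ReM (x y : C) : complex.Re (x * y) =
  complex.Re x * complex.Re y + - 1 * (complex.Im x * complex.Im y).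
Proof. by case: x; case: y => *; rewrite /= mulN1r. Qed.

Lemma ImM (x y : C) : complex.Im (x * y) =
  complex.Re x * complex.Im y + complex.Im x * complex.Re y.
Proof. by case: x; case: y. Qed.

Lemma cder_mul g h t u v : cder g t u -> cder h t v ->
  cder (fun s => g s * h s) t (u * h t + g t * v).
Proof.
move=> [gr gi] [hr hi]; split.
  under eq_fun do rewrite ReM.
  apply: is_derive_eq (der_add (der_mul gr hr)
    (der_mul (der_cst (-1) t) (der_mul gi hi))) _.
  by case: u gr gi; case: v hr hi; case: (g t); case: (h t) => * /=; ring.
under eq_fun do rewrite ImM.
apply: is_derive_eq (der_add (der_mul gr hi) (der_mul gi hr)) _.
by case: u gr gi; case: v hr hi; case: (g t); case: (h t) => * /=; ring.
Qed.

Lemma cder_horner P g t v : cder g t v ->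
  cder (fun s => P.[g s]) t (P^`().[g t] * v).
Proof.
move=> dg; elim/poly_ind: P => [|P c IH].
  under eq_fun do rewrite horner0.
  by rewrite deriv0 horner0 mul0r; exact: cder_cst.
under eq_fun do rewrite hornerMXaddC.
rewrite (_ : _ * v = (P^`().[g t] * v * g t + P.[g t] * v) + 0).
  by apply: cder_add (cder_cst c t); exact: cder_mul.
by rewrite derivD derivC derivM derivX !hornerE; ring.
Qed.

Lemma cder_affine g (k c t : R) v : cder g (k * t + c) v ->
  cder (fun s => g (k * s + c)) t (k%:C * v).
Proof.
move=> [dr di]; split.
  rewrite (_ : complex.Re _ = k * complex.Re v).
    exact: (der_affine (f := fun s => complex.Re (g s))).
  by case: v dr di => x y _ _ /=; rewrite mul0r subr0.
rewrite (_ : complex.Im _ = k * complex.Im v).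
  exact: (der_affine (f := fun s => complex.Im (g s))).
by case: v dr di => x y _ _ /=; rewrite mul0r addr0.
Qed.

Lemma cder_near g h t v : (\forall s \near t, g s = h s) -> cder g t v ->
  cder h t v.
Proof.
move=> gh [dr di]; split.
  by apply: (near_eq_is_derive _ dr); near=> s; rewrite (near gh s).
by apply: (near_eq_is_derive _ di); near=> s; rewrite (near gh s).
Unshelve. all: by end_near. Qed.

Lemma smooth_affine g (k c : R) : smooth g -> smooth (fun s => g (k * s + c)).
Proof.
move=> sg.
have real (f : R -> R) : (forall n t, derivable (derive1n n f) t 1) ->
    forall n, derive1n n (fun s => f (k * s + c)) =
      (fun s => k ^+ n * derive1n n f (k * s + c)) /\
      forall t, derivable (derive1n n (fun s => f (k * s + c))) t 1.
  move=> df; have der n t : is_derive t 1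
      (fun s => k ^+ n * derive1n n f (k * s + c))
      (k ^+ n.+1 * derive1n n.+1 f (k * t + c)).
    have d := derivableP (df n (k * t + c)).
    apply: is_derive_eq (der_mul (der_cst (k ^+ n) t) (der_affine d)) _.
    by rewrite mul0r add0r derive1nS derive1E mulrA -exprSr.
  elim=> [|n [IH1 IH2]].
    split; first by apply/funext => s; rewrite expr0 mul1r.
    move=> t; have [d _] := der 0%N t.
    by move: d; rewrite (_ : (fun s => _) = (fun s => f (k * s + c)))//;
      apply/funext => s; rewrite expr0 mul1r.
  have E : derive1n n.+1 (fun s => f (k * s + c)) =
      (fun s => k ^+ n.+1 * derive1n n.+1 f (k * s + c)).
    rewrite derive1nS IH1; apply/funext => s; rewrite derive1E.
    by have [_ ->] := der n s.
  split=> [//|t]; rewrite E; case: (der n.+1 t) => d _; exact: d.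
move=> n t; split.
  have [_] := real (fun s => complex.Re (g s)) (fun m u => (sg m u).1) n; exact.
have [_] := real (fun s => complex.Im (g s)) (fun m u => (sg m u).2) n; exact.
Qed.

(** The functions obtained from [B] by rational operations.  If [B] is closed
    under derivation up to these operations, they are all smooth; this makes
    the solutions of an autonomous rational differential equation smooth. *)
Inductive rational_in (B : (R -> R) -> Prop) : (R -> R) -> Prop :=
| rational_cst c : rational_in B (fun=> c)
| rational_base f : B f -> rational_in B f
| rational_add (f k : R -> R) : rational_in B f -> rational_in B k ->
    rational_in B (fun t => f t + k t)
| rational_mul (f k : R -> R) : rational_in B f -> rational_in B k ->
    rational_in B (fun t => f t * k t)
| rational_inv (f : R -> R) : rational_in B f -> (forall t, f t != 0) ->
    rational_in B (fun t => (f t)^-1).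

Definition crational_in B g := rational_in B (fun t => complex.Re (g t)) /\
  rational_in B (fun t => complex.Im (g t)).

Section Rational.
Context (B : (R -> R) -> Prop).
Hypothesis closed : forall f, B f -> exists2 f', rational_in B f' &
  forall t, is_derive t (1 : R) f (f' t).

Lemma rational_derive f : rational_in B f -> exists2 f', rational_in B f' &
  forall t, is_derive t (1 : R) f (f' t).
Proof.
elim=> {f} [c|f /closed//|f g _ [f' rf' df] _ [g' rg' dg]
  |f g rf [f' rf' df] rg [g' rg' dg]|f rf [f' rf' df] f0].
- by exists (fun=> 0); [exact: rational_cst|move=> t; exact: der_cst].
- by exists (fun t => f' t + g' t); [exact: rational_add|move=> t; exact: der_add].
- exists (fun t => f' t * g t + f t * g' t); last by move=> t; exact: der_mul.
  by apply: rational_add; exact: rational_mul.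
- exists (fun t => -1 * (f t)^-1 * (f t)^-1 * f' t).
    have := rational_inv rf f0; move=> ri.
    by do ![apply: rational_mul => //]; exact: rational_cst.
  by move=> t; rewrite mulN1r; exact: der_inv.
Qed.

Lemma rational_smooth f : rational_in B f ->
  forall n t, derivable (derive1n n f) t 1.
Proof.
move=> rf n; suff [rn dn] : rational_in B (derive1n n f) /\
    forall t, derivable (derive1n n f) t 1 by [].
have step (k : R -> R) : rational_in B k -> forall t, derivable k t 1.
  by move=> /rational_derive[h' _ dh] t; have [] := dh t.
suff rn : rational_in B (derive1n n f) by split=> //; exact: step.
elim: n => // n IH; rewrite derive1nS.
have [h' rh' dh] := rational_derive IH.
rewrite (_ : derive1 _ = h')//; apply/funext => t; rewrite derive1E.
by have [] := dh t.
Qed.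

Lemma crational_smooth g : crational_in B g -> smooth g.
Proof.
by move=> [rr ri] n t; split;
  [exact: (rational_smooth rr)|exact: (rational_smooth ri)].
Qed.

End Rational.

Lemma crational_cst B c : crational_in B (fun=> c).
Proof. by split; exact: rational_cst. Qed.

Lemma crational_add B g h : crational_in B g -> crational_in B h ->
  crational_in B (fun t => g t + h t).
Proof.
move=> [gr gi] [hr hi]; split.
  rewrite (_ : (fun t => _) = (fun t => complex.Re (g t) + complex.Re (h t))).
    exact: rational_add.
  by apply/funext => t; case: (g t); case: (h t).
rewrite (_ : (fun t => _) = (fun t => complex.Im (g t) + complex.Im (h t))).
  exact: rational_add.
by apply/funext => t; case: (g t); case: (h t).
Qed.

Lemma crational_mul B g h : crational_in B g -> crational_in B h ->
  crational_in B (fun t => g t * h t).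
Proof.
move=> [gr gi] [hr hi]; split.
  rewrite (_ : (fun t => _) = (fun t => complex.Re (g t) * complex.Re (h t) +
    - 1 * (complex.Im (g t) * complex.Im (h t)))).
    apply: rational_add; first exact: rational_mul.
    by apply: rational_mul; [exact: rational_cst|exact: rational_mul].
  by apply/funext => t; rewrite ReM.
rewrite (_ : (fun t => _) = (fun t => complex.Re (g t) * complex.Im (h t) +
  complex.Im (g t) * complex.Re (h t))).
  by apply: rational_add; exact: rational_mul.
by apply/funext => t; rewrite ImM.
Qed.

Lemma crational_inv B g : crational_in B g -> (forall t, g t != 0) ->
  crational_in B (fun t => (g t)^-1).
Proof.
move=> [gr gi] g0.
pose n t := complex.Re (g t) * complex.Re (g t) +
  complex.Im (g t) * complex.Im (g t).
have rn : rational_in B n by apply: rational_add; exact: rational_mul.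
have n0 t : n t != 0.
  have := g0 t; rewrite -cabs_eq0 -sqrf_eq0 cabs_sq !expr2.
  exact.
have ri := rational_inv rn n0; split.
  rewrite (_ : (fun t => _) = (fun t => complex.Re (g t) * (n t)^-1)).
    exact: rational_mul.
  by apply/funext => t; rewrite /n; case: (g t) => x y /=; rewrite !expr2.
rewrite (_ : (fun t => _) = (fun t => -1 * complex.Im (g t) * (n t)^-1)).
  by apply: rational_mul => //; apply: rational_mul => //; exact: rational_cst.
by apply/funext => t; rewrite /n; case: (g t) => x y /=; rewrite !expr2 mulN1r mulNr.
Qed.

Lemma crational_horner B P g : crational_in B g ->
  crational_in B (fun t => P.[g t]).
Proof.
move=> rg; elim/poly_ind: P => [|P c IH].
  by under eq_fun do rewrite horner0; exact: crational_cst.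
under eq_fun do rewrite hornerMXaddC.
by apply: crational_add; [exact: crational_mul|exact: crational_cst].
Qed.

Lemma crational_real B (f : R -> R) : rational_in B f ->
  crational_in B (fun t => (f t)%:C).
Proof. by move=> rf; split => //=; exact: rational_cst. Qed.

Let id_closed (f : R -> R) : f = id -> exists2 f', rational_in (fun f : R -> R => f = id) f' &
  forall t, is_derive t (1 : R) f (f' t).
Proof.
by move=> ->; exists (fun=> 1); [exact: rational_cst|move=> t; exact: is_derive_id].
Qed.

Lemma smooth_segment (z w : C) : smooth (fun t => z + t%:C * w).
Proof.
apply: (crational_smooth id_closed); apply: crational_add (crational_cst _ z) _.
apply: crational_mul (crational_cst _ w); apply: crational_real.
exact: rational_base.
Qed.

Lemma cder_segment (z w : C) t : cder (fun s => z + s%:C * w) t w.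
Proof.
have d : cder (fun s => s%:C * w) t (1 * w + t%:C * 0).
  by apply: cder_mul (cder_cst w t); split=> /=; [exact: is_derive_id|exact: der_cst].
by have := cder_add (cder_cst z t) d; rewrite mul1r mulr0 addr0 add0r.
Qed.

(** Lifts through a polynomial of a smooth curve that avoids its critical
    values solve a rational differential equation. *)
Lemma smooth_lift P g (B0 : (R -> R) -> Prop) (w : R -> C) :
  (forall f, B0 f -> exists2 f', rational_in B0 f' &
    forall t, is_derive t (1 : R) f (f' t)) ->
  crational_in B0 w -> (forall t, P^`().[g t] != 0) ->
  (forall t, cder g t (w t / P^`().[g t])) -> smooth g.
Proof.
move=> closed rw P0 dg.
pose B f := [\/ B0 f, f = (fun t => complex.Re (g t)) |
  f = (fun t => complex.Im (g t))].
have sub f : rational_in B0 f -> rational_in B f.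
  elim=> {f} [c|f Bf|f h _ rf _ rh|f h _ rf _ rh|f _ rf f0].
  - exact: rational_cst.
  - by apply: rational_base; apply: Or31.
  - exact: rational_add.
  - exact: rational_mul.
  - exact: rational_inv.
have rg : crational_in B g.
  by split; apply: rational_base; [apply: Or32|apply: Or33].
have rv : crational_in B (fun t => w t / P^`().[g t]).
  apply: crational_mul; first by case: rw => ? ?; split; exact: sub.
  by apply: crational_inv => //; exact: crational_horner.
apply: (@crational_smooth B) rg => f [/closed[f' rf' df]|->|->].
- by exists f' => //; exact: sub.
- by exists (fun t => complex.Re (w t / P^`().[g t])); [case: rv|move=> t; case: (dg t)].
- by exists (fun t => complex.Im (w t / P^`().[g t])); [case: rv|move=> t; case: (dg t)].
Qed.

(** A rational reparametrization of [[0, 1]] that maps the whole line into the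
    slightly larger interval [[- 1/8, 9/8]]: smoothness is required on the line,
    while a local inverse is defined on a disc only.  The form
    [x / (1 + x ^ 2)] is bounded, and increasing for [|x| < 1]. *)
Definition theta (s : R) : R :=
  2^-1 + 5 / 4 * ((s - 2^-1) * (1 + (s - 2^-1) * (s - 2^-1))^-1).

Definition dtheta (s : R) : R := 5 / 4 *
  ((1 - (s - 2^-1) * (s - 2^-1)) * (1 + (s - 2^-1) * (s - 2^-1))^-1
     * (1 + (s - 2^-1) * (s - 2^-1))^-1).

Let den_gt0 (x : R) : 0 < 1 + x * x.
Proof. by rewrite ltr_wpDr// -expr2 sqr_ge0. Qed.

Lemma theta0 : theta 0 = 0.
Proof. by rewrite /theta; field. Qed.

Lemma theta1 : theta 1 = 1.
Proof. by rewrite /theta; field. Qed.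

Lemma theta_der s : is_derive s (1 : R) theta (dtheta s).
Proof.
have d1 : is_derive s (1 : R) (fun u => u - 2^-1) 1.
  by apply: is_derive_eq (der_add (is_derive_id s 1) (der_cst (- 2^-1) s)) _;
    rewrite addr0.
have d2 := der_add (der_cst 1 s) (der_mul d1 d1).
have n0 : 1 + (s - 2^-1) * (s - 2^-1) != 0 by rewrite gt_eqF.
have d3 := der_inv (f := fun s => 1 + (s - 2^-1) * (s - 2^-1)) n0 d2.
apply: is_derive_eq
  (der_add (der_cst 2^-1 s) (der_mul (der_cst (5 / 4) s) (der_mul d1 d3))) _.
by rewrite /dtheta; move: n0; set x := s - 2^-1 => n0; field.
Qed.

Lemma theta_range s : `|theta s - 2^-1| <= 5 / 8.
Proof.
rewrite /theta addrC addKr; set x := s - 2^-1.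
rewrite normrM [`|x * _|]normrM normfV (gtr0_norm (den_gt0 x)).
rewrite (ger0_norm (_ : 0 <= 5 / 4)) ?divr_ge0//.
have : `|x| / (1 + x * x) <= 2^-1; last by lra.
rewrite ler_pdivrMr//; have := sqr_ge0 (1 - `|x|).
have : `|x| * `|x| = x * x by rewrite -!expr2 real_normK ?num_real.
by nra.
Qed.

Lemma theta_affine s u : theta s - theta u = 5 / 4 * (s - u) *
  (1 - (s - 2^-1) * (u - 2^-1)) *
  (1 + (s - 2^-1) * (s - 2^-1))^-1 * (1 + (u - 2^-1) * (u - 2^-1))^-1.
Proof.
have := den_gt0 (s - 2^-1); have := den_gt0 (u - 2^-1); rewrite /theta.
move=> /lt0r_neq0 u0 /lt0r_neq0 s0; move: u0 s0.
have -> : s - u = (s - 2^-1) - (u - 2^-1) by ring.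
by set x := s - 2^-1; set y := u - 2^-1 => u0 s0; field; rewrite u0.
Qed.

Lemma theta_increasing s u : 0 <= s <= 1 -> 0 <= u <= 1 -> s < u ->
  theta s < theta u.
Proof.
move=> /andP[s0 s1] /andP[u0 u1] su; rewrite -subr_gt0 theta_affine.
rewrite !mulr_gt0 ?invr_gt0 ?subr_gt0//; nra.
Qed.

Lemma theta_inj s u : 0 <= s <= 1 -> 0 <= u <= 1 -> theta s = theta u -> s = u.
Proof.
move=> s01 u01 E; have [su|us|//] := ltgtP s u.
  by have := theta_increasing s01 u01 su; rewrite E ltxx.
by have := theta_increasing u01 s01 us; rewrite E ltxx.
Qed.

Lemma dtheta_gt0 s : 0 <= s <= 1 -> 0 < dtheta s.
Proof.
move=> /andP[s0 s1]; rewrite /dtheta mulr_gt0// !mulr_gt0 ?invr_gt0//.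
nra.
Qed.

Let rational_id : rational_in (fun f : R -> R => f = id) id.
Proof. exact: rational_base. Qed.

Let rational_shift : rational_in (fun f : R -> R => f = id) (fun s => s - 2^-1).
Proof. by apply: rational_add rational_id _; exact: rational_cst. Qed.

Let rational_den : rational_in (fun f : R -> R => f = id)
  (fun s => (1 + (s - 2^-1) * (s - 2^-1))^-1).
Proof.
apply: rational_inv => [|s]; last by rewrite gt_eqF.
by apply: rational_add; [exact: rational_cst|exact: rational_mul].
Qed.

Lemma rational_dtheta : rational_in (fun f : R -> R => f = id) dtheta.
Proof.
apply: rational_mul; first exact: rational_cst.
apply: rational_mul rational_den; apply: rational_mul rational_den.
have r1 := rational_mul (rational_cst _ (-1)) (rational_mul rational_shift rational_shift).
have -> : (fun s : R => 1 - (s - 2^-1) * (s - 2^-1)) =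
    (fun s => 1 + -1 * ((s - 2^-1) * (s - 2^-1))).
  by apply/funext => s; rewrite mulN1r.
exact: (rational_add (rational_cst _ 1) r1).
Qed.

Lemma id_base_closed (f : R -> R) : f = id ->
  exists2 f', rational_in (fun f : R -> R => f = id) f' &
    forall t, is_derive t (1 : R) f (f' t).
Proof. exact: id_closed. Qed.

End ComplexCurves.

(** * The unbounded component *)

Section Slit.
Context {R : realType}.
Local Notation C := R[i].

(** A ray from [0] to infinity; a curve that avoids it except at its ends leaves
    [0] on the boundary of the unbounded component. *)
Definition slit (z : C) : Prop := complex.Re z = 0 /\ complex.Im z <= 0.

Let ray (s : R) : C^o := 0 +i* (- s).

Let ray_norm (s t : R) : `|ray s - ray t : C^o| = `|s - t|%:C.
Proof.
rewrite (_ : ray s - ray t = 0 +i* (t - s)); last first.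
  by rewrite /ray; apply/eqP; rewrite eq_complex /= subr0 opprK addrC !eqxx.
by rewrite normCE cabs_imag distrC.
Qed.

Let ball_radius (e : C) : 0 < e -> e = (complex.Re e)%:C /\ 0 < complex.Re e.
Proof.
move=> e0; have eE := ge0_ReE (ltW e0); split=> //.
by move: e0; rewrite {1}eE -[0]/(0%:C) ltcR.
Qed.

Let ray_continuous : continuous ray.
Proof.
move=> s; apply/cvg_ballP => e /ball_radius[eE e0]; near=> t.
rewrite /ball /= ray_norm eE ltcR; near: t.
by have := nbhsx_ballx s _ e0.
Unshelve. all: by end_near. Qed.

(** The slit without its vertex is connected, unbounded and disjoint from [K]:
    it lies in one component of the complement, and [0] adheres to it. *)
Lemma slit_boundary (K : set C^o) : K 0 -> (forall z, K z -> slit z -> z = 0) ->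
  exists2 U : set C^o, unbounded_component K U & boundary U 0.
Proof.
move=> K0 Kslit.
pose S : set C^o := ray @` `]0, +oo[%classic.
have SK : S `<=` ~` K.
  move=> _ [s /= + <-]; rewrite in_itv/= andbT => s0 /Kslit h.
  have /(congr1 (@complex.Im R))/eqP : ray s = 0.
    by apply: h; rewrite /slit /= oppr_le0 ltW.
  by rewrite /= oppr_eq0 gt_eqF.
have Sc : connected S.
  apply: connected_continuous_connected; first exact/connected_intervalP/interval_is_interval.
  by apply: continuous_subspaceT => s; exact: ray_continuous.
have S1 : S (ray 1) by exists 1 => //=; rewrite in_itv/= ltr01.
have SU : S `<=` connected_component (~` K) (ray 1).
  exact: connected_component_max.
exists (connected_component (~` K) (ray 1)).
  split; first by exists (ray 1) => //; exact: SK.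
  move=> [M [Mreal HM]].
  have M1 : M < (`|complex.Re M| + 1)%:C.
    move/complex_realP : Mreal => [m ->]; rewrite ltcR.
    by rewrite (le_lt_trans (ler_norm m))// ltrDl.
  pose s := `|complex.Re M| + 2.
  have s0 : 0 < s by rewrite ltr_wpDl.
  have Us : connected_component (~` K) (ray 1) (ray s).
    by apply: SU; exists s => //=; rewrite in_itv/= s0.
  have := HM _ M1 _ Us; rewrite /= (_ : ray s = 0 +i* (- s))// normCE cabs_imag.
  by rewrite normrN lecR gtr0_norm// lerD2l; lra.
split.
  move=> B /nbhs_ballP[e /ball_radius[eE e0] Be].
  exists (ray (complex.Re e / 2)); split.
    by apply: SU; exists (complex.Re e / 2) => //=; rewrite in_itv/= divr_gt0.
  apply: Be; rewrite /ball/= sub0r normrN normCE cabs_imag eE ltcR /=.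
  by rewrite normrN gtr0_norm ?divr_gt0//; lra.
move=> /interior_subset /connected_component_sub; exact.
Qed.

End Slit.

(** * Concatenation of pieces *)

Section Assembly.
Context {R : realType}.
Local Notation C := R[i].
Implicit Types (f g : R -> C) (P : {poly C}) (s t u : R).

Definition regular_piece g : Prop :=
  smooth g /\ forall t, 0 <= t <= 1 -> velocity g t != 0.

Definition simple_arc f : Prop := forall s t, 0 <= s <= 1 -> 0 <= t <= 1 ->
  f s = f t -> s = t.

(** The exact condition that transversality puts on two pieces that are not
    neighbours. *)
Definition cross f g : Prop := forall s t, 0 <= s <= 1 -> 0 <= t <= 1 ->
  f s = g t ->
  [/\ 0 < s < 1, 0 < t < 1 & Defs.transversal (velocity f s) (velocity g t)].

Definition consecutive f g : Prop := forall s t, 0 <= s <= 1 -> 0 <= t <= 1 ->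
  f s = g t -> s = 1 /\ t = 0.

Definition loop_ends f g : Prop := forall s t, 0 <= s <= 1 -> 0 <= t <= 1 ->
  f s = g t -> s = 0 /\ t = 1.

Section Concatenation.
Context (P : {poly C}) (N : nat) (gs : nat -> R -> C).
Local Notation vs i := (fun t => P.[gs i t]).
Hypothesis N0 : (0 < N)%N.
Hypothesis reg : forall i, (i < N)%N -> regular_piece (gs i).
Hypothesis joined : forall i, (i.+1 < N)%N -> gs i 1 = gs i.+1 0.
Hypothesis arcs : forall i, (i < N)%N -> simple_arc (vs i).
Hypothesis nexts : forall i, (i.+1 < N)%N -> consecutive (vs i) (vs i.+1).
Hypothesis others : forall i j, (i.+1 < j < N)%N ->
  cross (vs i) (vs j) \/ [/\ i = 0%N, j = N.-1 & loop_ends (vs i) (vs j)].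
Hypothesis start : P.[gs 0%N 0] = 0.
Hypothesis finish : P.[gs N.-1 1] = 0.
Hypothesis off_slit : forall i t, (i < N)%N -> 0 <= t <= 1 -> slit (vs i t) ->
  (i = 0%N /\ t = 0) \/ (i = N.-1 /\ t = 1).

(* the minimum puts the parameter [1] into the last cell *)
Let idx (t : R) : nat := minn (Num.truncn (t * N%:R)) N.-1.
Let loc (t : R) : R := t * N%:R - (idx t)%:R.
Let G (t : R) : C := gs (idx t) (loc t).
Let ts : seq R := [seq i.+1%:R / N%:R | i <- iota 0 N].

Let NR0 : 0 < N%:R :> R.
Proof. by rewrite ltr0n. Qed.

Let idx_lt t : (idx t < N)%N.
Proof. by rewrite /idx gtn_min [(N.-1 < N)%N]ltn_predL N0 orbT. Qed.

Let loc01 t : 0 <= t <= 1 -> 0 <= loc t <= 1.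
Proof.
move=> /andP[t0 t1]; rewrite /loc /idx.
have tN : 0 <= t * N%:R by rewrite mulr_ge0// ltW.
have /andP[h1 h2] := Num.Theory.truncn_itv tN.
have [le|lt] := leqP (Num.truncn (t * N%:R)) N.-1.
  by rewrite subr_ge0 h1/= lerBlDl natr1 ltW.
apply/andP; split.
  by rewrite subr_ge0 (le_trans _ h1)// ler_nat ltnW.
by rewrite lerBlDl natr1 prednK// ler_piMl// ltW.
Qed.

(* inside a closed cell [[i / N, (i + 1) / N]] the path is [gs i] *)
Let GE i t : (i < N)%N -> 0 <= t * N%:R - i%:R <= 1 ->
  G t = gs i (t * N%:R - i%:R).
Proof.
move=> iN /andP[t0 t1]; rewrite /G /loc.
have tN : 0 <= t * N%:R by rewrite (le_trans _ (_ : i%:R <= _))// -subr_ge0.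
have [lt|] := ltP (t * N%:R) i.+1%:R.
  have -> : idx t = i.
    have h : i%:R <= t * N%:R < i.+1%:R by rewrite lt andbT -subr_ge0.
    rewrite /idx (Num.Theory.truncn_def h).
    by apply/minn_idPl; rewrite -ltnS prednK.
  by [].
rewrite -natr1 => ge.
have tE : t * N%:R = i.+1%:R by rewrite -natr1; apply/eqP; rewrite eq_le ge andbT; lra.
have [iN'|] := ltnP i.+1 N.
  have -> : idx t = i.+1.
    rewrite /idx tE Num.Theory.natrK.
    by apply/minn_idPl; rewrite -ltnS prednK.
  by rewrite tE subrr -natr1 addrC addKr joined.
move=> Ni; have NE : N = i.+1 by apply/eqP; rewrite eqn_leq Ni iN.
by rewrite /idx tE Num.Theory.natrK NE /= (minn_idPr (leqnSn i)).
Qed.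

Let G_near i t : (i < N)%N -> 0 < t * N%:R - i%:R < 1 ->
  \forall s \near t, G s = gs i (N%:R * s + - i%:R).
Proof.
move=> iN /andP[t0 t1].
have : \forall s \near t, 0 < s * N%:R - i%:R < 1.
  have op : open [set s : R | 0 < s * N%:R - i%:R < 1].
    rewrite (_ : [set s | _] = [set` `]i%:R / N%:R, i.+1%:R / N%:R[]); last first.
      apply/seteqP; split => s /=; rewrite in_itv/= ltr_pdivrMr// ltr_pdivlMr//;
      rewrite subr_gt0 ltrBlDr -natr1 addrC //.
    exact: interval_open.
  by move: op; rewrite openE => /(_ t); apply => /=; rewrite t0.
apply: filterS => s /andP[s0 s1]; rewrite (GE iN) ?(ltW s0) ?(ltW s1)//.
by rewrite mulrC.
Qed.

Let nth_ts i : (i < N)%N -> nth 0 ts i = i.+1%:R / N%:R.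
Proof. by move=> iN; rewrite (nth_map 0%N) ?size_iota// nth_iota. Qed.

Let size_ts : size ts = N.
Proof. by rewrite size_map size_iota. Qed.

Let nth_ts0 i : (i < N)%N -> nth 0 (0 :: ts) i = i%:R / N%:R.
Proof. by case: i => [|i] iN; rewrite ?mul0r//= nth_ts// ltnW. Qed.

Let ts_partition : itv_partition 0 1 ts.
Proof.
split.
  apply/(pathP 0) => i; rewrite size_ts => iN.
  by rewrite nth_ts0// nth_ts// ltr_pM2r ?invr_gt0// ltr_nat.
rewrite -nth_last size_ts (set_nth_default 0) ?nth_ts ?prednK ?size_ts//.
  by rewrite divff// gt_eqF.
Qed.

Let cell i t : (i < N)%N ->
  t \in `[nth 0 (0 :: ts) i, nth 0 ts i] -> 0 <= t * N%:R - i%:R <= 1.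
Proof.
move=> iN; rewrite nth_ts0// nth_ts// in_itv/= ler_pdivrMr// ler_pdivlMr//.
by rewrite subr_ge0 lerBlDl natr1.
Qed.

Let piecewise : piecewise_smooth ts G.
Proof.
split=> // i; rewrite size_ts => iN.
have [sg vg] := reg iN.
exists (fun t => gs i (N%:R * t + - i%:R)); split.
- exact: smooth_affine.
- by move=> t /(cell iN) tc; rewrite (GE iN tc) mulrC.
- move=> t /(cell iN) tc.
  have := cder_affine (smooth_cder (N%:R * t + - i%:R) sg).
  move=> /cder_velocity ->; rewrite mulf_neq0//.
    by rewrite -[0]/(0%:C) (inj_eq (@complexI R)) gt_eqF.
  by apply: vg; rewrite mulrC.
Qed.

Let velocity_gamma t : 0 < loc t < 1 ->
  velocity (fun s => P.[G s]) t = N%:R%:C * velocity (vs (idx t)) (loc t).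
Proof.
move=> l01; have near := G_near (idx_lt t) l01.
have [sg _] := reg (idx_lt t).
have locE : loc t = N%:R * t + - (idx t)%:R by rewrite mulrC.
have d := cder_horner P (smooth_cder (loc t) sg).
rewrite (cder_velocity d); rewrite locE in d.
have d' := cder_affine (g := vs (idx t)) d.
have : cder (fun s => P.[G s]) t (N%:R%:C * (P^`().[gs (idx t) (loc t)] *
    velocity (gs (idx t)) (loc t))).
  rewrite locE; apply: cder_near d'.
  by apply: filterS near => s ->.
exact: cder_velocity.
Qed.

Let gammaE t : P.[G t] = vs (idx t) (loc t).
Proof. by []. Qed.

Let idx_loc_inj t u : idx t = idx u -> loc t = loc u -> t = u.
Proof.
rewrite /loc => -> /addIr; apply: mulIf; exact: lt0r_neq0.
Qed.

Let notin_ts t : 0 <= t <= 1 -> 0 < loc t < 1 -> t \notin ts.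
Proof.
move=> t01 /andP[l0 l1]; apply/negP => /mapP[i _ tE].
move: l0 l1; rewrite /loc tE divfK ?gt_eqF// subr_gt0 ltrBlDl natr1 !ltr_nat !ltnS.
by move=> h1 h2; have := leq_trans h2 h1; rewrite ltnn.
Qed.

Let interior t : 0 <= t <= 1 -> 0 < loc t < 1 -> 0 < t < 1.
Proof.
move=> /andP[t0 t1] /andP[l0 l1]; rewrite !lt_neqAle t0 t1 !andbT; apply/andP; split.
  apply: contraTneq l0 => <-.
  by rewrite /loc mul0r sub0r oppr_gt0 -leNgt ler0n.
apply: contraTneq l1 => ->; rewrite /loc mul1r ltrBlDl -leNgt natr1 ler_nat.
exact: idx_lt.
Qed.

Let transversal_scale (k : R) (v w : C) : k != 0 -> Defs.transversal v w ->
  Defs.transversal (k%:C * v) (k%:C * w).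
Proof.
move=> k0 vw x y; rewrite !mulrA -!rmorphM /= => /vw[/eqP + /eqP].
by rewrite !mulf_eq0 (negPf k0) !orbF => /eqP -> /eqP ->.
Qed.

Let idx_mono t u : t <= u -> (idx t <= idx u)%N.
Proof.
move=> tu; rewrite /idx leq_min geq_minr andbT geq_min.
by rewrite Num.Theory.le_truncn// ler_pM2r.
Qed.

Let self_intersections :
  transversal_self_intersections ts (fun t => P.[G t]).
Proof.
move=> t u t0 tu u1; rewrite !gammaE => E ends.
have t01 : 0 <= t <= 1 by rewrite t0 (le_trans (ltW tu)).
have u01 : 0 <= u <= 1 by rewrite u1 (le_trans t0 (ltW tu)).
have lt01 := loc01 t01; have lu01 := loc01 u01.
have idx_le := idx_mono (ltW tu).
have neq : t <> u by move=> tuE; move: tu; rewrite tuE ltxx.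
have [ij|ij|ij] := ltngtP (idx t).+1 (idx u); last 2 first.
- have {}ij : idx t = idx u by apply/eqP; rewrite eqn_leq idx_le -ltnS.
  case: neq; apply: idx_loc_inj => //.
  by apply: (arcs (idx_lt t)) => //; rewrite {2}ij.
- have [] := nexts (i := idx t) _ lt01 lu01; rewrite ?ij ?idx_lt//.
  move=> l1 l0; case: neq; apply: (mulIf (lt0r_neq0 NR0)).
  have : t * N%:R = loc t + (idx t)%:R by rewrite /loc subrK.
  have : u * N%:R = loc u + (idx u)%:R by rewrite /loc subrK.
  by rewrite l1 l0 -ij -natr1 add0r addrC => -> ->.
have [H|[i0 jN H]] := @others (idx t) (idx u) ltac:(by rewrite ij idx_lt).
  have [s1 s2 tr] := H _ _ lt01 lu01 E.
  have /andP[t0' _] := interior t01 s1; have /andP[_ u1'] := interior u01 s2.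
  split=> //; [exact: notin_ts|exact: notin_ts|].
  rewrite !velocity_gamma//; apply: transversal_scale => //; exact: lt0r_neq0.
have [l0 l1] := H _ _ lt01 lu01 E; case: ends; split.
  have : t * N%:R = loc t + (idx t)%:R by rewrite /loc subrK.
  by rewrite l0 i0 addr0 => /eqP; rewrite mulf_eq0 (gt_eqF NR0) orbF => /eqP.
apply: (mulIf (lt0r_neq0 NR0)).
have : u * N%:R = loc u + (idx u)%:R by rewrite /loc subrK.
by rewrite l1 jN addrC natr1 prednK// mul1r.
Qed.

Let slit_ends t : 0 <= t <= 1 -> slit P.[G t] -> t = 0 \/ t = 1.
Proof.
move=> t01; rewrite gammaE => /(off_slit (idx_lt t) (loc01 t01)).
have tE : t * N%:R = loc t + (idx t)%:R by rewrite /loc subrK.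
case=> -[i0 l0]; [left|right]; apply: (mulIf (lt0r_neq0 NR0)); rewrite tE i0 l0.
  by rewrite mul0r addr0.
by rewrite addrC natr1 prednK// mul1r.
Qed.

(** The pieces are run through at constant speed [N] on the cells
    [[i / N, (i + 1) / N]].  Two parameters with the same value lie in the same
    cell, in neighbouring cells, or in distant ones, and the hypotheses on pieces
    settle each case; only the first and the last piece may meet at the base
    point. *)
Lemma property_E_of_pieces : property_E P (gs 0%N 0) (gs N.-1 1).
Proof.
have G0 : G 0 = gs 0%N 0.
  by rewrite (GE N0) ?mul0r ?subr0// lexx ler01.
have N1 : (N.-1 < N)%N by rewrite prednK.
have NE : N%:R - N.-1%:R = 1 :> R.
  by rewrite -[X in X%:R - _](prednK N0) -natr1 addrC addKr.
have G1 : G 1 = gs N.-1 1.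
  by rewrite (GE N1) mul1r NE// ler01 lexx.
split; first by rewrite start finish.
exists G, ts; rewrite start; split=> //.
  move=> t t01 Gt0; apply: slit_ends => //.
  by rewrite Gt0; split=> /=.
apply: slit_boundary.
  by exists 0; rewrite /= ?in_itv/= ?lexx ?ler01// G0.
move=> z [t]; rewrite /= in_itv/= => t01 <- sl.
by case: (slit_ends t01 sl) => ->; rewrite ?G0 ?G1.
Qed.

End Concatenation.
End Assembly.

(** * Local inverses and lifted edges *)

Section LocalInverse.
Context {R : realType}.
Local Notation C := R[i].
Implicit Types (P : {poly C}) (x y z w : C) (s t r e : R).

(** Over the complex numbers [P - w] splits, so a small value of [P - w] at [z]
    comes from a root close to [z]. *)
Lemma root_near P z w e : (1 < size P)%N -> 0 < e ->
  cabs (P.[z] - w) < cabs (lead_coef P) * e ^+ (size P).-1 ->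
  exists2 x, cabs (x - z) < e & P.[x] = w.
Proof.
move=> P1 e0 small; pose Q := P - w%:P.
have sQ : size Q = size P.
  by rewrite size_polyDl// size_polyN (leq_ltn_trans (size_polyC_leq1 _)).
have lQ : lead_coef Q = lead_coef P.
  by rewrite lead_coefDl// size_polyN (leq_ltn_trans (size_polyC_leq1 _)).
have [rs QE] := closed_field_poly_normal Q.
have [/hasP[x xrs xz]|/hasPn far] := boolP (has (fun x => cabs (x - z) < e) rs).
  exists x => //; apply/eqP; rewrite -subr_eq0.
  have : root Q x.
    rewrite QE rootZ ?root_prod_XsubC// lQ lead_coef_eq0 -size_poly_gt0.
    exact: ltnW.
  by rewrite rootE hornerD hornerN hornerC.
have lP0 : lead_coef Q != 0 by rewrite lQ lead_coef_eq0 -size_poly_gt0 ltnW.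
have srs : size rs = (size P).-1.
  by rewrite -sQ QE size_scale// size_prod_XsubC.
exfalso; move: small; rewrite -srs ltNge; apply/negP; rewrite negbK.
have -> : P.[z] - w = Q.[z] by rewrite hornerD hornerN hornerC.
rewrite QE hornerZ cabsM lQ ler_wpM2l ?cabs_ge0// {QE srs}.
elim: rs far => [|x rs IH] far; first by rewrite big_nil hornerC expr0 /cabs normr1.
rewrite big_cons hornerM hornerXsubC cabsM exprS; apply: ler_pM.
- exact: ltW.
- by rewrite exprn_ge0// ltW.
- by have := far x (mem_head _ _); rewrite -leNgt cabsBC.
by apply: IH => y yrs; apply: far; rewrite inE yrs orbT.
Qed.

(** The Lipschitz bound by [A] makes [h] differentiable and, in path
    constructions, transfers closeness of values to closeness of preimages. *)
Definition is_local_inverse P z e (r A : R) (h : C -> C) : Prop :=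
  (forall w, cabs (w - P.[z]) < r ->
    [/\ cabs (h w - z) < e, P.[h w] = w & P^`().[h w] != 0]) /\
  (forall w w', cabs (w - P.[z]) < r -> cabs (w' - P.[z]) < r ->
    cabs (h w - h w') <= A * cabs (w - w')).

(** [P] is injective near [z] with a lower Lipschitz bound, because its linear
    part dominates there, and surjective onto a small disc by [root_near]; this
    replaces the inverse function theorem. *)
Lemma local_inverse P z e : P^`().[z] != 0 -> 0 < e ->
  exists r A h d, [/\ 0 < r, 0 <= A, is_local_inverse P z e r A h, 0 < d &
    forall x, cabs (x - z) < d -> cabs (P.[x] - P.[z]) < r /\ h P.[x] = x].
Proof.
move=> dPz e0; have P1 : (1 < size P)%N.
  rewrite ltnNge; apply/negP => /size1_polyC PE.
  by move: dPz; rewrite PE derivC horner0 eqxx.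
have [M M0 PM] := second_order_cabs P z.
have c0 : 0 < cabs P^`().[z] by rewrite cabs_gt0.
set c := cabs _ in c0.
have [d1 /andP[d10 d11] dP0] := neq0_near_cabs dPz.
pose d := Num.min (Num.min d1 e) (c / (4 * (M + 1))).
have M1 : 0 < 4 * (M + 1) by rewrite mulr_gt0// ltr_wpDl.
have d0 : 0 < d by rewrite !lt_min d10 e0 divr_gt0.
have dd1 : d <= d1 by rewrite /d !ge_min lexx.
have de : d <= e by rewrite /d !ge_min lexx !orbT.
have Md : 4 * (M + 1) * d <= c.
  by rewrite mulrC -ler_pdivlMr// /d !ge_min lexx !orbT.
have inj x y : cabs (x - z) < d -> cabs (y - z) < d ->
    c / 2 * cabs (x - y) <= cabs (P.[x] - P.[y]).
  move=> xz yz.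
  have x1 : cabs (x - z) <= 1 by lra.
  have y1 : cabs (y - z) <= 1 by lra.
  have h := PM x y x1 y1.
  have h2 : M * (cabs (x - z) + cabs (y - z)) * cabs (x - y) <=
      c / 2 * cabs (x - y).
    rewrite ler_wpM2r ?cabs_ge0//; have := cabs_ge0 (x - z); nra.
  have := cabsB (P.[x] - P.[y]) (P.[x] - P.[y] - P^`().[z] * (x - y)).
  rewrite opprB addrC subrK cabsM -/c; lra.
have l0 : 0 < cabs (lead_coef P).
  by rewrite cabs_gt0 lead_coef_eq0 -size_poly_gt0 ltnW.
pose r := cabs (lead_coef P) * d ^+ (size P).-1.
have r0 : 0 < r by rewrite mulr_gt0// exprn_gt0.
have ex w : cabs (w - P.[z]) < r -> exists x, cabs (x - z) < d /\ P.[x] = w.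
  by rewrite cabsBC => /(root_near P1 d0)[x xz Px]; exists x.
pose h w := xget z [set x | cabs (x - z) < d /\ P.[x] = w].
have hP w : cabs (w - P.[z]) < r -> cabs (h w - z) < d /\ P.[h w] = w.
  by move=> /ex[x Hx]; rewrite /h; case: xgetP => [_ -> //|/(_ x)].
have [d2 /andP[d20 d21] Pnear] := near_cabs P z r0.
exists r, (2 / c), h, (Num.min d d2); split=> //.
- by rewrite divr_ge0// ltW.
- split=> [w /hP[wz Pw]|w w' /hP[wz Pw] /hP[wz' Pw']].
    split=> //; first exact: lt_le_trans de.
    by apply: dP0; rewrite ltW// (lt_le_trans wz).
  have := inj _ _ wz wz'; rewrite Pw Pw' => h1.
  by rewrite mulrAC ler_pdivlMr//; lra.
- by rewrite lt_min d0.
move=> x; rewrite lt_min => /andP[xd xd2].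
have Pxr : cabs (P.[x] - P.[z]) < r by apply: Pnear; exact: ltW.
split=> //; have [hz PhE] := hP _ Pxr.
have := inj _ _ hz xd; rewrite PhE subrr cabs0 pmulr_rle0 ?divr_gt0// => h0.
apply/eqP; rewrite -subr_eq0 -cabs_eq0 eq_le h0; exact: cabs_ge0.
Qed.

Let cder_continuous (g : R -> C) t v (e : R) : cder g t v -> 0 < e ->
  \forall s \near t, cabs (g s - g t) < e.
Proof.
move=> [[dr _] [di _]] e0; have e2 : 0 < e / 2 by rewrite divr_gt0.
have cr := differentiable_continuous ((derivable1_diffP _ _).1 dr).
have ci := differentiable_continuous ((derivable1_diffP _ _).1 di).
move/cvgrPdist_lt : cr => /(_ _ e2) nr; move/cvgrPdist_lt : ci => /(_ _ e2) ni.
near=> s; rewrite (le_lt_trans (cabs_le_ReIm _))//.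
have hr : `|complex.Re (g t) - complex.Re (g s)| < e / 2 by near: s.
have hi : `|complex.Im (g t) - complex.Im (g s)| < e / 2 by near: s.
move: hr hi; case: (g s) => a b; case: (g t) => a' b' /=.
by rewrite distrC [`|b' - b|]distrC => h1 h2; rewrite [ltRHS]splitr ltrD.
Unshelve. all: by end_near. Qed.

(** With [x0 = h(u(t))], the Taylor estimate of [P] at [x0] bounds the error of
    the linear approximation [x0 + (u - u(t)) / P'(x0)] of [h] by a multiple of
    [|u - u(t)| ^ 2], which has derivative [0]. *)
Lemma local_inverse_der P z e r A h (u : R -> C) t v : 0 <= A ->
  is_local_inverse P z e r A h -> (forall s, cabs (u s - P.[z]) < r) ->
  cder u t v -> cder (fun s => h (u s)) t (v / P^`().[h (u t)]).
Proof.
move=> A0 [hP hA] ur du; have [_ Pht D0] := hP _ (ur t).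
set x0 := h (u t) in Pht D0 *; set D := P^`().[x0] in D0 *.
have [M M0 PM] := second_order_cabs P x0.
pose E s := h (u s) - (x0 + (u s - u t) * D^-1).
have lin : cder (fun s => x0 + (u s - u t) * D^-1) t (v / D).
  have d1 := cder_mul (cder_add du (cder_cst (- u t) t)) (cder_cst D^-1 t).
  have := cder_add (cder_cst x0 t) d1.
  by rewrite mulr0 !addr0 add0r.
suff dE : cder E t 0.
  have := cder_add lin dE; rewrite addr0.
  by under eq_fun do rewrite /E addrC subrK.
have Dc : 0 < cabs D by rewrite cabs_gt0.
pose B := M * A ^+ 2 / cabs D.
(* the multiple of [|u s - u t| ^ 2], written so that it can be differentiated *)
pose q s := B * ((complex.Re (u s) - complex.Re (u t)) *
  (complex.Re (u s) - complex.Re (u t)) +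
  (complex.Im (u s) - complex.Im (u t)) * (complex.Im (u s) - complex.Im (u t))).
have qE s : q s = B * cabs (u s - u t) ^+ 2.
  by rewrite cabs_sq !expr2 /q; case: (u s) => ? ?; case: (u t).
have dq : is_derive t (1 : R) q 0.
  case: du => dr di.
  have d1 := der_add dr (der_cst (- complex.Re (u t)) t).
  have d2 := der_add di (der_cst (- complex.Im (u t)) t).
  apply: is_derive_eq (der_mul (der_cst B t)
    (der_add (der_mul d1 d1) (der_mul d2 d2))) _.
  by rewrite !subrr; ring.
have Eq : \forall s \near t, cabs (E s) <= q s.
  have A1 : 0 < (A + 1)^-1 by rewrite invr_gt0 ltr_wpDl.
  have near := cder_continuous du A1.
  near=> s; have us : cabs (u s - u t) < (A + 1)^-1 by near: s.
  have [_ Phs _] := hP _ (ur s).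
  have kA := hA _ _ (ur s) (ur t); rewrite -/x0 in kA.
  have k1 : cabs (h (u s) - x0) <= 1.
    rewrite (le_trans kA)//; move: us.
    rewrite -[X in _ < X]mul1r ltr_pdivlMr ?ltr_wpDl// => us.
    by have := cabs_ge0 (u s - u t); lra.
  have := PM (h (u s)) x0 k1; rewrite subrr cabs0 addr0 Phs Pht.
  move=> /(_ ler01) h1.
  have -> : E s = - ((u s - u t - D * (h (u s) - x0)) * D^-1).
    have DK : D * (h (u s) - x0) * D^-1 = h (u s) - x0 by rewrite mulrAC mulfV// mul1r.
    by rewrite [in RHS]mulrBl DK /E; ring.
  rewrite cabsN cabsM qE /B mulrAC.
  have -> : cabs D^-1 = (cabs D)^-1.
    by apply: (mulIf (lt0r_neq0 Dc)); rewrite -cabsM mulVf// mulVf ?lt0r_neq0// /cabs normr1.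
  rewrite ler_wpM2r ?invr_ge0 ?cabs_ge0// (le_trans h1)// -mulrA -expr2 -mulrA.
  by rewrite ler_wpM2l// -exprMn lerXn2r// nnegrE ?cabs_ge0// mulr_ge0 ?cabs_ge0.
have q0 : q t = 0 by rewrite /q !subrr; ring.
split; (apply: der_squeeze0 q0 dq; apply: filterS Eq => s; apply: le_trans).
  exact: cabs_Re.
exact: cabs_Im.
Unshelve. all: by end_near. Qed.

Definition edge w w' s : C := w + (theta s)%:C * (w' - w).

Lemma edge0 w w' : edge w w' 0 = w.
Proof. by rewrite /edge theta0 mul0r addr0. Qed.

Lemma edge1 w w' : edge w w' 1 = w'.
Proof. by rewrite /edge theta1 mul1r addrC subrK. Qed.

Lemma cder_edge w w' s : cder (edge w w') s ((dtheta s)%:C * (w' - w)).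
Proof.
have d : cder (fun u => (theta u)%:C) s (dtheta s)%:C.
  by split => /=; [exact: theta_der|exact: der_cst].
have := cder_add (cder_cst w s) (cder_mul d (cder_cst (w' - w) s)).
by rewrite mulr0 addr0 add0r.
Qed.

(** The factor [1/2] leaves room for [theta] to leave [[0, 1]]. *)
Lemma edge_lift P z e r A h w w' : 0 <= A -> is_local_inverse P z e r A h ->
  cabs (w - P.[z]) < r / 2 -> cabs (w' - P.[z]) < r / 2 -> w != w' ->
  exists g : R -> C, [/\ regular_piece g, g 0 = h w, g 1 = h w',
    (fun s => P.[g s]) = edge w w' & forall s, cabs (g s - z) < e].
Proof.
move=> A0 hP wr w'r ww'; have [hP1 _] := hP.
have inr s : cabs (edge w w' s - P.[z]) < r.
  have -> : edge w w' s - P.[z] =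
      (1 - theta s)%:C * (w - P.[z]) + (theta s)%:C * (w' - P.[z]).
    by rewrite /edge rmorphB /=; ring.
  rewrite (le_lt_trans (cabsD _ _))// !cabsM !cabs_real.
  have := theta_range s; rewrite ler_norml => /andP[h1 h2].
  have a1 : `|theta s| <= 9 / 8 by rewrite ler_norml; apply/andP; split; lra.
  have a2 : `|1 - theta s| <= 9 / 8 by rewrite ler_norml; apply/andP; split; lra.
  have a3 : `|1 - theta s| + `|theta s| <= 5 / 4.
    by case: (ger0P (theta s)); case: (ger0P (1 - theta s)) => *; lra.
  have := cabs_ge0 (w - P.[z]); have := normr_ge0 (theta s).
  have := normr_ge0 (1 - theta s); have := cabs_ge0 (w' - P.[z]).
  by nra.
have dg s : cder (fun s => h (edge w w' s)) s
    ((dtheta s)%:C * (w' - w) / P^`().[h (edge w w' s)]).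
  by apply: (local_inverse_der A0 hP) => //; exact: cder_edge.
have dP0 s : P^`().[h (edge w w' s)] != 0 by have [] := hP1 _ (inr s).
exists (fun s => h (edge w w' s)); split.
- split.
    apply: (smooth_lift (P := P) (w := fun s => (dtheta s)%:C * (w' - w))
      (@id_base_closed R)) => //.
    apply: crational_mul; last exact: crational_cst.
    by apply: crational_real; exact: rational_dtheta.
  move=> s s01; rewrite (cder_velocity (dg s)).
  rewrite !mulf_neq0 ?invr_eq0//; last by rewrite subr_eq0 eq_sym.
  by rewrite -[0]/(0%:C) (inj_eq (@complexI R)) gt_eqF// dtheta_gt0.
- by rewrite edge0.
- by rewrite edge1.
- by apply/funext => s; have [] := hP1 _ (inr s).
- by move=> s; have [] := hP1 _ (inr s).
Qed.

End LocalInverse.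

(** * Curves and axis-parallel edges *)

Section Coordinates.
Context {R : realType}.
Local Notation C := R[i].
Implicit Types (z w : C) (s t : R) (f g : R -> C).

Definition co (b : bool) z : R := if b then complex.Re z else complex.Im z.

Lemma coB b z w : co b (z - w) = co b z - co b w.
Proof. by case: b z w => -[? ?] [? ?]. Qed.

Lemma co_real b (x : R) z : co b (x%:C * z) = x * co b z.
Proof. by case: b z => -[p q] /=; rewrite mul0r ?subr0 ?addr0. Qed.

Lemma coD b z w : co b (z + w) = co b z + co b w.
Proof. by case: b z w => -[? ?] [? ?]. Qed.

(** What an edge carried by the line [co b = A] needs in order to cross [f]
    transversally. *)
Definition pierces b (A : R) f : Prop := forall t, 0 <= t <= 1 ->
  co b (f t) = A -> 0 < t < 1 /\ co b (velocity f t) != 0.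

Definition meets_finitely b (A : R) f : Prop := exists ys : seq R,
  forall t, 0 <= t <= 1 -> co b (f t) = A -> co (~~ b) (f t) \in ys.

Definition misses f z : Prop := forall t, 0 <= t <= 1 -> f t <> z.

(** All but finitely many axis-parallel lines may carry a new edge; this leaves
    room to choose the corners of a rectilinear path. *)
Definition tame f : Prop := forall b, exists bad : seq R, forall A,
  A \notin bad -> pierces b A f /\ meets_finitely b A f.

(** An injective coordinate takes each value at most once, and only the values
    at the two ends have to be excluded. *)
Lemma tame_curve f : (forall b,
    (exists c, forall t, 0 <= t <= 1 -> co b (f t) = c) \/
    (forall s t, 0 <= s <= 1 -> 0 <= t <= 1 -> co b (f s) = co b (f t) -> s = t) /\
    (forall t, 0 < t < 1 -> co b (velocity f t) != 0)) ->
  tame f.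
Proof.
move=> H b; case: (H b) => [[c fc]|[finj fv]].
  exists [:: c] => A; rewrite inE => Ac; split.
    by move=> t /fc -> cA; rewrite cA eqxx in Ac.
  by exists [::] => t /fc -> cA; rewrite cA eqxx in Ac.
have i0 : 0 <= (0 : R) <= 1 by rewrite lexx ler01.
have i1 : 0 <= (1 : R) <= 1 by rewrite lexx ler01.
exists [:: co b (f 0); co b (f 1)] => A; rewrite !inE negb_or => /andP[A0 A1].
split.
  move=> t t01 ftA; suff t01' : 0 < t < 1 by split => //; exact: fv.
  move: t01 => /andP[t0 t1]; rewrite !lt_neqAle t0 t1 !andbT; apply/andP; split.
    by apply: contraNneq A0 => ->; rewrite ftA.
  by apply: contraNneq A1 => <-; rewrite ftA.
have [[t [t01 ftA]]|no] := pselect (exists t, 0 <= t <= 1 /\ co b (f t) = A).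
  exists [:: co (~~ b) (f t)] => s s01 fsA.
  by rewrite (finj s t)// ?inE ?eqxx// fsA.
by exists [::] => t t01 ftA; case: no; exists t.
Qed.

Lemma transversal_co b (v w : C) : co b v != 0 -> co b w = 0 ->
  co (~~ b) w != 0 -> Defs.transversal v w.
Proof.
move=> v0 w0 w1 x y E.
have := congr1 (co b) E; have := congr1 (co (~~ b)) E.
rewrite !coD !co_real w0 mulr0 addr0 => E1.
have c0 d : co d (0 : C) = 0 by case: d.
rewrite c0 => /eqP; rewrite mulf_eq0 (negPf v0) orbF => /eqP x0; split=> //.
move: E1; rewrite x0 mul0r add0r c0 => /eqP.
by rewrite mulf_eq0 (negPf w1) orbF => /eqP.
Qed.

Lemma transversal_sym (v w : C) : Defs.transversal v w -> Defs.transversal w v.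
Proof. by move=> vw x y; rewrite addrC => /vw[]. Qed.

Lemma cross_sym f g : cross f g -> cross g f.
Proof.
move=> fg s t s01 t01 E; have [] := fg t s t01 s01 (esym E).
by split => //; exact: transversal_sym.
Qed.

Section Edge.
Context (b : bool) (w w' : C).
Hypotheses (ww' : co b w' = co b w) (nww' : co (~~ b) w' != co (~~ b) w).

Lemma co_edge s : co b (edge w w' s) = co b w.
Proof. by rewrite /edge coD co_real coB ww' subrr mulr0 addr0. Qed.

Lemma co_edgeN s : co (~~ b) (edge w w' s) =
  co (~~ b) w + theta s * (co (~~ b) w' - co (~~ b) w).
Proof. by rewrite /edge coD co_real coB. Qed.

Lemma edge_injN s t : 0 <= s <= 1 -> 0 <= t <= 1 ->
  co (~~ b) (edge w w' s) = co (~~ b) (edge w w' t) -> s = t.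
Proof.
move=> s01 t01; rewrite !co_edgeN => /addrI /(mulIf _) E.
by apply: theta_inj => //; apply: E; rewrite subr_eq0.
Qed.

Lemma edge_arc : simple_arc (edge w w').
Proof. by move=> s t s01 t01 /(congr1 (co (~~ b))); exact: edge_injN. Qed.

Lemma velocity_edge s : co b (velocity (edge w w') s) = 0.
Proof.
by rewrite (cder_velocity (cder_edge w w' s)) co_real coB ww' subrr mulr0.
Qed.

Lemma velocity_edgeN s : 0 <= s <= 1 -> co (~~ b) (velocity (edge w w') s) != 0.
Proof.
move=> s01; rewrite (cder_velocity (cder_edge w w' s)) co_real coB.
by rewrite mulf_neq0 ?subr_eq0// gt_eqF// dtheta_gt0.
Qed.

Let i01 (s : R) : 0 < s < 1 -> 0 <= s <= 1.
Proof. by move=> /andP[/ltW -> /ltW ->]. Qed.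

Lemma tame_edge : tame (edge w w').
Proof.
apply: tame_curve => c; have [->|] := eqVneq c b.
  by left; exists (co b w) => t _; exact: co_edge.
move=> cb; have -> : c = ~~ b by move: cb; case: (c); case: (b).
by right; split => [|t /i01]; [exact: edge_injN|exact: velocity_edgeN].
Qed.

(** Transversality is automatic: the velocity of the edge has a vanishing
    [b]-coordinate, that of [f] has not. *)
Lemma edge_cross f : pierces b (co b w) f -> misses f w -> misses f w' ->
  cross f (edge w w').
Proof.
move=> fA fw fw' t s t01 s01 E.
have [t01' v0] := fA t t01 (etrans (congr1 (co b) E) (co_edge s)).
split=> //; last by apply: (@transversal_co b) => //;
  [exact: velocity_edge|exact: velocity_edgeN].
move: (s01) => /andP[s0 s1]; rewrite !lt_neqAle s0 s1 !andbT; apply/andP; split.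
  by apply/eqP => s0E; apply: (fw t) => //; rewrite E -s0E edge0.
by apply/eqP => s1E; apply: (fw' t) => //; rewrite E s1E edge1.
Qed.

Lemma edge_consecutive f : f 1 = w ->
  (forall t, 0 <= t <= 1 -> co b (f t) = co b w -> t = 1) ->
  consecutive f (edge w w').
Proof.
move=> f1 fA t s t01 s01 E.
have t1 : t = 1 by apply: fA => //; rewrite E co_edge.
split=> //; apply: edge_arc => //; first by rewrite lexx ler01.
by rewrite -E t1 f1 edge0.
Qed.

Lemma edge_misses z : co b z != co b w -> misses (edge w w') z.
Proof. by move=> zw s _ E; rewrite -E co_edge eqxx in zw. Qed.

Lemma edge_pierces A : A != co b w -> pierces b A (edge w w').
Proof. by move=> Aw s _; rewrite co_edge => E; rewrite E eqxx in Aw. Qed.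

Lemma edge_piercesN A : A != co (~~ b) w -> A != co (~~ b) w' ->
  pierces (~~ b) A (edge w w').
Proof.
move=> Aw Aw' s s01 E; split; last exact: velocity_edgeN.
move: (s01) => /andP[s0 s1]; rewrite !lt_neqAle s0 s1 !andbT; apply/andP; split.
  by apply: contraNneq Aw => s0E; rewrite -E -s0E edge0.
by apply: contraNneq Aw' => s1E; rewrite -E s1E edge1.
Qed.

Lemma edge_last s : 0 <= s <= 1 -> co (~~ b) (edge w w' s) = co (~~ b) w' -> s = 1.
Proof.
move=> s01 E; apply: edge_injN => //; first by rewrite ler01 lexx.
by rewrite edge1.
Qed.

End Edge.

Lemma real_avoid (l r : R) (xs : seq R) : l < r ->
  exists2 x, l < x < r & x \notin xs.
Proof.
elim: xs l r => [|y xs IH] l r lr; first by exists ((l + r) / 2) => //; lra.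
have [ry|yr] := lerP r y.
  have [x /andP[lx xr] xxs] := IH _ _ lr; exists x; first by rewrite lx xr.
  by rewrite inE negb_or xxs andbT lt_eqF// (lt_le_trans xr).
have lr' : Num.max l y < r by rewrite gt_max lr yr.
have [x /andP[+ xr] xxs] := IH _ _ lr'; rewrite gt_max => /andP[lx yx].
by exists x; rewrite ?lx ?xr// inE negb_or xxs andbT gt_eqF.
Qed.

Lemma common_list (T : eqType) (l : seq T) (Q : T -> seq R -> Prop) :
  (forall a xs ys, {subset xs <= ys} -> Q a xs -> Q a ys) ->
  (forall a, a \in l -> exists xs, Q a xs) ->
  exists xs, forall a, a \in l -> Q a xs.
Proof.
move=> mono; elim: l => [|a l IH] H; first by exists [::].
have [|xs Hxs] := IH; first by move=> c cl; apply: H; rewrite inE cl orbT.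
have [ys Hys] := H a (mem_head _ _).
exists (xs ++ ys) => c; rewrite inE => /orP[/eqP ->|cl].
  by apply: mono Hys => x xy; rewrite mem_cat xy orbT.
by apply: mono (Hxs _ cl) => x xx; rewrite mem_cat xx.
Qed.

End Coordinates.

(** * Rectilinear continuation of a path *)

Section Route.
Context {R : realType}.
Local Notation C := R[i].
Implicit Types (z w : C) (s t X : R) (f g : R -> C) (l : seq (R -> C)).

(** A path starts with the piece [s0] and will end with the piece [fe], whose
    values run along the real axis from [wb] to [0].  In between come edges, each
    a lift of an axis-parallel segment.  The edges already built are listed with
    the newest one first. *)
Context (P : {poly C}) (s0 fe : R -> C) (wb : R).
Local Notation v f := (fun t => P.[f t]).

Hypothesis reg0 : regular_piece s0.
Hypothesis start : P.[s0 0] = 0.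
Hypothesis inj0 : forall b s t, 0 <= s <= 1 -> 0 <= t <= 1 ->
  co b (v s0 s) = co b (v s0 t) -> s = t.
Hypothesis vel0 : forall b t, 0 < t < 1 -> co b (velocity (v s0) t) != 0.
Hypothesis re0 : forall t, 0 <= t <= 1 -> complex.Re (v s0 t) != wb.

Hypothesis rege : regular_piece fe.
Hypothesis fe_start : P.[fe 0] = wb%:C.
Hypothesis fe_finish : P.[fe 1] = 0.
Hypothesis fe_real : forall t, 0 <= t <= 1 -> complex.Im (v fe t) = 0.
Hypothesis fe_inj : forall s t, 0 <= s <= 1 -> 0 <= t <= 1 ->
  complex.Re (v fe s) = complex.Re (v fe t) -> s = t.
Hypothesis fe_vel : forall t, 0 < t < 1 -> complex.Re (velocity (v fe) t) != 0.

Let i0 : 0 <= (0 : R) <= 1. Proof. by rewrite lexx ler01. Qed.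
Let i1 : 0 <= (1 : R) <= 1. Proof. by rewrite lexx ler01. Qed.

Definition current l : R -> C := head s0 l.
Definition older l : seq (R -> C) := behead (rcons l s0).

(** The pairwise conditions on pieces, in the order in which the pieces are
    added. *)
Fixpoint routed l : Prop := if l is g :: l' then
  [/\ current l' 1 = g 0, consecutive (v (current l')) (v g),
      forall f, f \in older l' -> cross (v f) (v g) & routed l'] else True.

Definition good_edge f : Prop := [/\ regular_piece f, simple_arc (v f) &
  forall t, 0 <= t <= 1 -> ~ slit (v f t)].

Let rcons_cur l : rcons l s0 = current l :: older l.
Proof. by case: l. Qed.

Lemma assemble l : routed l -> (forall f, f \in l -> good_edge f) ->
  current l 1 = fe 0 -> consecutive (v (current l)) (v fe) ->
  (forall f, f \in behead l -> cross (v f) (v fe)) -> (0 < size l)%N ->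
  property_E P (s0 0) (fe 1).
Proof.
move=> rt edges joined next crosses l0.
pose gs i := nth s0 (rcons (s0 :: rev l) fe) i.
have gsE i : (i <= size l)%N -> gs i = nth s0 (s0 :: rev l) i.
  by move=> il; rewrite /gs nth_rcons /= size_rev ltnS il.
have gse : gs (size l).+1 = fe by rewrite /gs nth_rcons /= size_rev ltnn eqxx.
have gs_edge i : (0 < i <= size l)%N -> gs i \in l.
  case: i => // i /= il; rewrite gsE//= -mem_rev mem_nth// size_rev//.
have chain k : forall i j, (i.+1 < j <= size k)%N -> routed k ->
    cross (v (nth s0 (s0 :: rev k) i)) (v (nth s0 (s0 :: rev k) j)).
  elim: k => [|g k IH] i j /andP[ij jk]; first by move: (leq_trans ij jk).
  move=> [_ _ crs rk]; rewrite rev_cons -rcons_cons !nth_rcons /= size_rev.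
  have ik : (i < size k)%N by rewrite -ltnS (leq_trans ij).
  rewrite ltnS (ltnW ik); move: jk; rewrite leq_eqVlt => /orP[/eqP jE|jk].
    rewrite jE /= ltnn eqxx; apply: crs.
    case: k ik {IH rk jE} => // c k /= ik; rewrite rev_cons -rcons_cons.
    rewrite nth_rcons /= size_rev ik -mem_rev /older /= rev_rcons.
    by rewrite mem_nth//= size_rev.
  rewrite jk; apply: IH => //; rewrite ij -ltnS; exact: jk.
have last_cur k : nth s0 (s0 :: rev k) (size k) = current k.
  by case: k => //= c k; rewrite rev_cons nth_rcons size_rev ltnn eqxx.
have chain1 k : forall i, (i < size k)%N -> routed k ->
    nth s0 (s0 :: rev k) i 1 = nth s0 (s0 :: rev k) i.+1 0 /\
    consecutive (v (nth s0 (s0 :: rev k) i)) (v (nth s0 (s0 :: rev k) i.+1)).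
  elim: k => [|g k IH] i //; rewrite ltnS => ik [jn cs _ rk].
  rewrite rev_cons -rcons_cons !nth_rcons /= size_rev !ltnS ik.
  move: ik; rewrite leq_eqVlt => /orP[/eqP ->|ik].
    by rewrite ltnn eqxx last_cur.
  by rewrite ik; exact: IH.
have -> : s0 = gs 0%N by rewrite gsE.
rewrite -gse.
apply: (@property_E_of_pieces _ P (size l).+2 gs) => //.
- move=> i; rewrite ltnS leq_eqVlt => /orP[/eqP ->|]; first by rewrite gse.
  rewrite ltnS; case: i => [|i] il; first by rewrite gsE.
  by have [] := edges _ (gs_edge i.+1 il).
- move=> i; rewrite !ltnS leq_eqVlt => /orP[/eqP ->|il].
    by rewrite gse gsE// last_cur.
  by rewrite !gsE ?(ltnW il)//; have [] := chain1 l i il rt.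
- move=> i; rewrite ltnS leq_eqVlt => /orP[/eqP ->|].
    rewrite gse => s t s01 t01 /(congr1 (@complex.Re R)); exact: fe_inj.
  rewrite ltnS; case: i => [|i] il.
    by rewrite gsE// => s t s01 t01 /(congr1 (@co R true)); exact: inj0.
  by have [] := edges _ (gs_edge i.+1 il).
- move=> i; rewrite !ltnS leq_eqVlt => /orP[/eqP ->|il].
    by rewrite gse gsE// last_cur.
  by rewrite !gsE ?(ltnW il)//; have [] := chain1 l i il rt.
- move=> i j /andP[ij]; rewrite ltnS leq_eqVlt => /orP[/eqP jE|jl]; last first.
    left; rewrite ltnS in jl; rewrite !gsE ?(leq_trans (ltnW (ltnW ij)))//.
    by apply: chain => //; rewrite ij.
  rewrite jE in ij *; rewrite gse; case: i ij => [|i] ij.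
    right; split=> //; rewrite gsE// => s t s01 t01 E.
    have s0E : s = 0.
      apply: (inj0 (b := false)) => //; rewrite start E /co fe_real//.
    split=> //; apply: fe_inj => //; rewrite fe_finish -E s0E start//.
  have il : (i.+1 < size l)%N := ij; left; apply: crosses; rewrite gsE ?(ltnW il)//=.
  case: (l) il => //= c k il; rewrite rev_cons nth_rcons size_rev.
  by rewrite !ltnS in il; rewrite il -mem_rev mem_nth// size_rev.
- by rewrite [_.-1]/= gse fe_finish.
move=> i t; rewrite ltnS leq_eqVlt => /orP[/eqP ->|].
  rewrite gse => t01 [re _]; right; split=> //; apply: fe_inj => //.
  by rewrite fe_finish.
rewrite ltnS; case: i => [|i] il t01.
  rewrite gsE// => -[re _]; left; split=> //; apply: (inj0 (b := true)) => //.
  by rewrite start.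
by have [_ _ no] := edges _ (gs_edge i.+1 il) => /no.
Qed.

(** The path will reach [wb] along the vertical line through it, so that line
    has to be kept free from the beginning. *)
Definition avoids_base f : Prop :=
  [/\ pierces true wb f, meets_finitely true wb f & misses f wb%:C].

Definition tail l : C := P.[current l 1].

(** The invariant that allows an edge with constant coordinate [b] to be added at
    the end of the path.  The piece [fe] is treated as an obstacle from the
    start.  The last piece is exempt from [ready_older]; it meets the line of the
    new edge only at the common corner. *)
Record ready b l : Prop := Ready {
  ready_routed : routed l;
  ready_edge : forall f, f \in l -> good_edge f;
  ready_tame : forall f, f \in l -> tame (v f);
  ready_cross : forall f, f \in l -> cross (v f) (v fe);
  ready_base : forall f, f \in l -> avoids_base (v f);
  ready_older : forall f, f \in fe :: older l ->
    [/\ pierces b (co b (tail l)) (v f),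
        meets_finitely b (co b (tail l)) (v f) & misses (v f) (tail l)];
  ready_last : forall t, 0 <= t <= 1 ->
    co b (v (current l) t) = co b (tail l) -> t = 1;
  ready_re : complex.Re (tail l) != wb;
  ready_im : complex.Im (tail l) != 0 }.

Let tame_start : tame (v s0).
Proof. by apply: tame_curve => b; right; split; [exact: inj0|exact: vel0]. Qed.

Let tame_finish : tame (v fe).
Proof.
by apply: tame_curve => -[]; [right; split; [exact: fe_inj|exact: fe_vel]|
  left; exists 0; exact: fe_real].
Qed.

Let start_base : avoids_base (v s0).
Proof.
split=> [t t01 E|| t t01 E]; last by have := re0 t01; rewrite E eqxx.
  by have := re0 t01; rewrite -E eqxx.
by exists [::] => t t01 E; have := re0 t01; rewrite -E eqxx.
Qed.

Let re_start_neq0 t : 0 < t <= 1 -> forall b, co b (v s0 t) != 0.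
Proof.
move=> /andP[t0 t1] b; apply/eqP => E.
suff tE : t = 0 by rewrite tE ltxx in t0.
apply: (inj0 (b := b)) => //; first by rewrite t1 ltW.
by rewrite E start; case: b E.
Qed.

(** The first edge is vertical; both coordinates of the values of [s0] are
    injective, so its end is away from the real axis and from the abscissas of
    the ends of [fe]. *)
Lemma ready_nil : ready true [::].
Proof.
have i01 : 0 < (1 : R) <= 1 by rewrite ltr01 lexx.
have im1 := re_start_neq0 i01 false; have re1 := re_start_neq0 i01 true.
split=> //.
- move=> f; rewrite inE => /eqP ->; split.
  + move=> t t01 E; split; last first.
      apply: fe_vel; move: (t01) => /andP[t0 t1].
      rewrite !lt_neqAle t0 t1 !andbT; apply/andP; split.
        apply: contraNneq (re0 i1) => tE; rewrite -[X in X == _]E -tE.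
        by rewrite fe_start.
      apply: contraNneq re1 => tE.
      by rewrite [X in X == _](esym E) tE fe_finish.
    move: (t01) => /andP[t0 t1].
    rewrite !lt_neqAle t0 t1 !andbT; apply/andP; split.
      apply: contraNneq (re0 i1) => tE; rewrite -[X in X == _]E -tE.
      by rewrite fe_start.
    apply: contraNneq re1 => tE.
    by rewrite [X in X == _](esym E) tE fe_finish.
  + by exists [:: 0] => t t01 _; rewrite inE /= fe_real.
  by move=> t t01 E; move: im1; rewrite -[v s0 1]E /= fe_real// eqxx.
- by move=> t t01; apply: inj0.
exact: re0.
Qed.

Lemma ready_all b l f : ready b l -> f \in fe :: rcons l s0 -> tame (v f).
Proof.
move=> rd; rewrite inE mem_rcons inE => /or3P[/eqP ->|/eqP ->|fl].
- exact: tame_finish.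
- exact: tame_start.
exact: ready_tame rd _ fl.
Qed.

Definition corner b w X : C :=
  if b then complex.Re w +i* X else X +i* complex.Im w.

Lemma co_corner b w X : co b (corner b w X) = co b w.
Proof. by case: b. Qed.

Lemma co_cornerN b w X : co (~~ b) (corner b w X) = X.
Proof. by case: b. Qed.

Definition off_slit z (e : R) : Prop :=
  forall x, cabs (x - z) < e -> ~ slit P.[x].

Section Step.
Context (z : C) (e r A : R) (h : C -> C).
Hypotheses (A0 : 0 <= A) (hP : is_local_inverse P z e r A h)
  (ze : off_slit z e).
Local Notation in_disc w := (cabs (w - P.[z]) < r / 2).

Lemma add_edge b l w' : routed l -> current l 1 = h (tail l) ->
  in_disc (tail l) -> in_disc w' ->
  co b w' = co b (tail l) -> co (~~ b) w' != co (~~ b) (tail l) ->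
  (forall t, 0 <= t <= 1 -> co b (v (current l) t) = co b (tail l) -> t = 1) ->
  (forall f, f \in older l -> [/\ pierces b (co b (tail l)) (v f),
    misses (v f) (tail l) & misses (v f) w']) ->
  exists g, [/\ v g = edge (tail l) w', routed (g :: l), good_edge g,
    g 0 = current l 1 & g 1 = h w'].
Proof.
move=> rt curE wd w'd ww' nww' last old.
have neq : tail l != w' by apply: contraNneq nww' => <-.
have [g [gr g0 g1 vg gz]] := edge_lift A0 hP wd w'd neq.
exists g; split=> //.
- split=> //; rewrite ?vg //.
  + by rewrite curE g0.
  + by apply: (edge_consecutive ww' nww').
  by move=> f /old[fp fm fm']; exact: (edge_cross ww' nww').
- split=> //; first by rewrite vg; exact: (edge_arc nww').
  by move=> t _; exact: ze.
by rewrite curE.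
Qed.

(** The free coordinate [X] of the next corner avoids finitely many values:
    those of the lines on which some piece is badly placed for the following
    edge ([bad]), those for which the corner would lie on an earlier piece
    ([ys]), and any prescribed ones ([av]). *)
Lemma extend b l (lo hi : R) (av : seq R) : lo < hi -> ready b l ->
  current l 1 = h (tail l) -> in_disc (tail l) ->
  (forall X, lo < X < hi -> in_disc (corner b (tail l) X)) ->
  exists X g, [/\ lo < X < hi, X \notin av, ready (~~ b) (g :: l) &
    g 1 = h (corner b (tail l) X) /\ v g = edge (tail l) (corner b (tail l) X)].
Proof.
move=> lohi rd curE wd wd'.
have [bad badP] : exists bad : seq R, forall f, f \in fe :: rcons l s0 ->
    forall X, X \notin bad -> pierces (~~ b) X (v f) /\ meets_finitely (~~ b) X (v f).
  apply: (common_list (T := (R -> C)%type) (Q := fun f bad => forall X, X \notin bad ->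
    pierces (~~ b) X (v f) /\ meets_finitely (~~ b) X (v f)))
    => [f xs ys sub H X Xy|f fl].
    by apply: H; apply: contra Xy; exact: sub.
  exact: (ready_all rd fl).
have [ys ysP] : exists ys : seq R, forall f, f \in fe :: older l -> forall t,
    0 <= t <= 1 -> co b (v f t) = co b (tail l) -> co (~~ b) (v f t) \in ys.
  apply: (common_list (T := (R -> C)%type) (Q := fun f ys => forall t, 0 <= t <= 1 ->
    co b (v f t) = co b (tail l) -> co (~~ b) (v f t) \in ys))
    => [f xs ys sub H t t01 E|f fl]; first exact/sub/H.
  by have [_ [ys H] _] := ready_older rd fl; exists ys.
have [X Xlh] := real_avoid (av ++ bad ++ ys ++ [:: co (~~ b) (tail l); wb; 0]) lohi.
rewrite !mem_cat !negb_or => /and5P[Xav Xbad Xys Xw /and3P[Xwb X0 _]].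
set w := tail l in curE wd wd' ysP Xw *; pose w' := corner b w X.
have ww' : co b w' = co b w by exact: co_corner.
have w'X : co (~~ b) w' = X by exact: co_cornerN.
have nww' : co (~~ b) w' != co (~~ b) w by rewrite w'X.
have missw' f : f \in fe :: older l -> misses (v f) w'.
  move=> fl t t01 E; move: Xys; rewrite -w'X -E ysP// E //.
have last := ready_last rd.
have old f : f \in fe :: older l -> [/\ pierces b (co b w) (v f),
    misses (v f) w & misses (v f) w'].
  by move=> fl; have [fp _ fm] := ready_older rd fl; split=> //; exact: missw'.
have [|g [vg rg gg g0 g1]] := add_edge (ready_routed rd) curE wd (wd' X Xlh) ww' nww' last.
  by move=> f fl; apply: old; rewrite inE fl orbT.
exists X, g; split=> //.
have crossE f : f \in fe :: older l -> cross (v f) (edge w w').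
  by move=> /old[fp fm fm']; exact: (edge_cross ww' nww').
have rewb : complex.Re w != wb := ready_re rd.
have imw : complex.Im w != 0 := ready_im rd.
have tailE : tail (g :: l) = w'.
  by rewrite /tail /= -[LHS]/(v g 1) vg edge1.
split=> //.
- by move=> f; rewrite inE => /orP[/eqP ->//|]; exact: ready_edge rd _.
- move=> f; rewrite inE => /orP[/eqP ->|]; last exact: ready_tame rd _.
  by rewrite vg; exact: (tame_edge ww' nww').
- move=> f; rewrite inE => /orP[/eqP ->|]; last exact: ready_cross rd _.
  by rewrite vg; apply/cross_sym/crossE; rewrite inE eqxx.
- move=> f; rewrite inE => /orP[/eqP ->|]; last exact: ready_base rd _.
  rewrite vg; case: (b) ww' nww' w'X Xw => /= ww'b nww'b w'Xb Xwb'.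
    have wbE : wb != co true w by rewrite eq_sym.
    split; first exact: (edge_pierces (b := true)).
      exists [::] => t _; rewrite (co_edge (b := true))// => E.
      by rewrite E eqxx in wbE.
    exact: (edge_misses (b := true)).
  split.
  + apply: (@edge_piercesN _ false) => //=; first by rewrite eq_sym.
    by rewrite eq_sym.
  + by exists [:: complex.Im w] => t _ _; rewrite inE (co_edge (b := false)).
  by apply: (edge_misses (b := false)) => //=; rewrite eq_sym.
- rewrite tailE w'X => f fl.
  have fl' : f \in fe :: rcons l s0 by move: fl; rewrite /older /=.
  have [fp ff] := badP f fl' X Xbad; split=> //.
  move: fl'; rewrite rcons_cur !inE orbCA => /orP[/eqP -> |fl'].
    move=> t t01 E; have t1 : t = 1 by apply: last => //; rewrite E.
    by move: nww'; rewrite -E t1 /w /tail eqxx.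
  by apply: missw'; rewrite inE.
- rewrite tailE /current [head _ _]/= => t t01; rewrite -[P.[g t]]/(v g t) vg.
  exact: (edge_last nww').
- by rewrite tailE /w'; case: (b) Xwb.
by rewrite tailE /w'; case: (b) X0.
Qed.

End Step.

(** Ends of paths are generic points, so a given point is only approached. *)
Definition reach x : Prop := forall eps : R, 0 < eps ->
  exists2 l, ready true l & cabs (current l 1 - x) < eps.

Definition regular_point z : Prop :=
  P^`().[z] != 0 /\ exists2 e : R, 0 < e & off_slit z e.

Lemma reach_start : reach (s0 1).
Proof. by move=> e e0; exists [::]; [exact: ready_nil|rewrite subrr cabs0]. Qed.

Let near_inverse z : regular_point z -> exists (e r A : R) (h : C -> C) (d : R),
  [/\ [/\ 0 < r, 0 <= A & 0 < d], is_local_inverse P z e r A h, off_slit z e &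
    forall x, cabs (x - z) < d -> cabs (P.[x] - P.[z]) < r / 8 /\ h P.[x] = x].
Proof.
move=> [dz [e e0 ze]].
have [r [A [h [d [r0 A0 hP d0 hd]]]]] := local_inverse dz e0.
have r8 : 0 < r / 8 by rewrite divr_gt0.
have [d1 /andP[d10 _] near] := near_cabs P z r8.
exists e, r, A, h, (Num.min d d1); split=> //.
  by split=> //; rewrite lt_min d0.
move=> x; rewrite lt_min => /andP[xd xd1]; split; first exact/near/ltW.
by have [] := hd x xd.
Qed.

Let corner_near b w z X (p q : R) : cabs (w - z) < p ->
  `|X - co (~~ b) z| < q -> cabs (corner b w X - z) < p + q.
Proof.
move=> wz Xz; rewrite (le_lt_trans (cabs_le_ReIm _))//.
have h1 := le_lt_trans (cabs_Re _) wz; have h2 := le_lt_trans (cabs_Im _) wz.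
move: h1 h2 Xz; case: w {wz} => w1 w2; case: z => z1 z2; rewrite /corner /co.
by case: b => /= h1 h2 Xz; [|rewrite addrC]; exact: ltrD.
Qed.

(** Two points close to a regular point [z] are joined by a vertical and a
    horizontal edge, lifted by the local inverse at [z]. *)
Lemma reach_local z : regular_point z -> exists2 d : R, 0 < d &
  forall x y, cabs (x - z) < d -> cabs (y - z) < d -> reach x -> reach y.
Proof.
move=> /near_inverse[e [r [A [h [d [[r0 A0 d0] hP ze hd]]]]]]; exists d => //.
move=> x y xz yz rx eps eps0.
have xd : 0 < d - cabs (x - z) by rewrite subr_gt0.
have [l rl lx] := rx _ xd.
have uz : cabs (current l 1 - z) < d.
  by rewrite (le_lt_trans (cabs_triangle x _ _))// -ltrBrDr.
have [wz hw] := hd _ uz; have [qz hq] := hd _ yz.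
set q := P.[y] in qz hq; rewrite -/(tail l) in wz hw.
(* each corner misses its target by less than [eta] in one coordinate *)
pose eta := Num.min (eps / (4 * (A + 1))) (r / 16).
have A1 : 0 < A + 1 by rewrite ltr_wpDl.
have eta0 : 0 < eta by rewrite lt_min !divr_gt0// mulr_gt0.
have etar : eta <= r / 16 by rewrite /eta ge_min lexx orbT.
have etaA : eta * (4 * (A + 1)) <= eps.
  by rewrite -ler_pdivlMr ?mulr_gt0// /eta ge_min lexx.
have lt_eta c : c - eta < c + eta by rewrite ltrD2l gtrN.
have inq X c : c - eta < X < c + eta -> `|X - c| < eta.
  by move=> /andP[h1 h2]; rewrite ltr_norml; apply/andP; split; lra.
have wider w p : cabs (w - P.[z]) < p -> p <= r / 2 -> cabs (w - P.[z]) < r / 2.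
  exact: lt_le_trans.
have qc b X : `|X - co (~~ b) q| < eta -> `|X - co (~~ b) P.[z]| < r / 8 + r / 16.
  move=> Xq; rewrite -[X - _](subrKA (co (~~ b) q)).
  rewrite (le_lt_trans (ler_normD _ _))// addrC ltrD//; last exact: lt_le_trans etar.
  rewrite -coB (le_lt_trans _ qz)//; case: (~~ b); [exact: cabs_Re|exact: cabs_Im].
have [||X [g [Xi _ rg [g1 vg]]]] :=
  extend A0 hP ze [::] (lt_eta (complex.Im q)) rl (esym hw).
- by apply: wider wz _; lra.
- by move=> X /inq/(qc true) Xq; apply: wider (corner_near wz Xq) _; lra.
set w1 := corner true (tail l) X in g1 vg.
have tail1 : tail (g :: l) = w1 by rewrite /tail -[LHS]/(v g 1) vg edge1.
have w1z : cabs (w1 - P.[z]) < r / 4 + r / 16.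
  have := corner_near (b := true) wz (qc true _ (inq _ _ Xi)).
  by move=> /lt_le_trans; apply; lra.
have [|||X' [g' [Xi' _ rg' [g1' vg']]]] :=
  @extend z e r A h A0 hP ze (~~ true) (g :: l) _ _ [::] (lt_eta (complex.Re q)) rg.
- by rewrite tail1.
- by rewrite tail1; apply: wider w1z _; lra.
- rewrite tail1 => X' /inq/(qc false) Xq'.
  by apply: wider (corner_near (b := false) w1z Xq') _; lra.
exists (g' :: g :: l) => //; rewrite /current /= g1' tail1.
set w2 := corner _ w1 X'.
have w2q : cabs (w2 - q) <= eta + eta.
  rewrite (le_trans (cabs_le_ReIm _))// /w2 /w1 /=.
  by move: (inq _ _ Xi) (inq _ _ Xi'); case: (q) => ? ? /= ? ?; rewrite lerD// ltW.
have [_ hL] := hP; rewrite -hq (le_lt_trans (hL _ _ _ _))//.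
- apply: lt_le_trans (corner_near (b := false) w1z (qc false _ (inq _ _ Xi'))) _.
  lra.
- by rewrite (lt_trans qz)//; lra.
have := ler_wpM2l A0 w2q; have := mulr_ge0 A0 (ltW eta0); nra.
Qed.

(** Three more edges lead from a generic end point close to [fe 0] to [fe 0]
    itself: a vertical one to a generic height [X], a horizontal one to the
    abscissa [wb], and a vertical one down to [wb]. *)
Lemma reach_finish : regular_point (fe 0) -> reach (fe 0) ->
  property_E P (s0 0) (fe 1).
Proof.
move=> /near_inverse[e [r [A [h [d [[r0 A0 d0] hP ze hd]]]]]] rc.
rewrite fe_start in hd.
have [l rl lx] := rc _ d0; have [wz hw] := hd _ lx.
rewrite -/(tail l) in wz hw; set w := tail l in wz hw.
have wider u p : cabs (u - P.[fe 0]) < p -> p <= r / 2 ->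
  cabs (u - P.[fe 0]) < r / 2 by exact: lt_le_trans.
have [ys ysP] : exists ys : seq R, forall f, f \in rcons l s0 -> forall t,
    0 <= t <= 1 -> complex.Re (v f t) = wb -> complex.Im (v f t) \in ys.
  apply: (common_list (T := (R -> C)%type) (Q := fun f ys => forall t, 0 <= t <= 1 ->
    complex.Re (v f t) = wb -> complex.Im (v f t) \in ys))
    => [f xs ys sub H t t01 E|f]; first exact/sub/H.
  rewrite mem_rcons inE => /orP[/eqP ->|/(ready_base rl)[_ [ys H] _]].
    by have [_ [ys H] _] := start_base; exists ys.
  by exists ys.
have r8 : - (r / 8) < r / 8 by lra.
have [||X [g1 [Xi Xys rg [g11 vg1]]]] :=
  extend A0 hP ze ys r8 rl (esym hw).
- by rewrite fe_start; apply: lt_le_trans wz _; lra.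
- move=> X; rewrite -ltr_norml => Xr; rewrite fe_start.
  apply: (lt_le_trans (corner_near (b := true) wz (q := r / 8) _)); last by lra.
  by rewrite /= subr0.
set w1 := corner true w X in g11 vg1.
have tail1 : tail (g1 :: l) = w1 by rewrite /tail -[LHS]/(v g1 1) vg1 edge1.
have X0 : X != 0 by have := ready_im rg; rewrite tail1.
have Xr : `|X| < r / 8 by rewrite ltr_norml.
have w1wb : complex.Re w1 != wb := ready_re rl.
pose w2 : C := wb +i* X.
have w2z : cabs (w2 - P.[fe 0]) < r / 2.
  rewrite fe_start (_ : w2 - _ = 0 +i* X); last first.
    by apply/eqP; rewrite eq_complex /= subrr subr0 !eqxx.
  by rewrite cabs_imag; lra.
have base f : f \in rcons l s0 -> avoids_base (v f).
  by rewrite mem_rcons inE => /orP[/eqP ->//|]; exact: ready_base rl _.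
have miss2 f : f \in rcons l s0 -> misses (v f) w2.
  by move=> fl t t01 E; have := ysP f fl t t01; rewrite E => /(_ erefl) /(negP Xys).
have [|||||||g2 [vg2 rg2 gg2 g20 g21]] :=
  @add_edge (fe 0) e r A h A0 hP ze false (g1 :: l) w2 (ready_routed rg).
- by rewrite tail1.
- rewrite tail1 fe_start.
  apply: (lt_le_trans (corner_near (b := true) wz (q := r / 8) _)); last by lra.
  by rewrite /= subr0.
- exact: w2z.
- by rewrite tail1.
- by rewrite tail1 /= eq_sym.
- exact: ready_last rg.
- move=> f fl; have [|fp _ fm] := ready_older rg (f := f).
    by rewrite inE fl orbT.
  by split=> //; exact: miss2.
have tail2 : tail (g2 :: g1 :: l) = w2.
  by rewrite /tail -[LHS]/(v g2 1) vg2 edge1.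
rewrite tail1 in vg2.
have w12 : co false w2 = co false w1 by [].
have nw12 : co (~~ false) w2 != co (~~ false) w1 by rewrite /= eq_sym.
have [|||||||g3 [vg3 rg3 gg3 g30 g31]] :=
  @add_edge (fe 0) e r A h A0 hP ze true (g2 :: g1 :: l) wb%:C rg2.
- by rewrite tail2.
- by rewrite tail2.
- by rewrite fe_start subrr cabs0 divr_gt0.
- by rewrite tail2.
- by rewrite tail2 /= eq_sym.
- move=> t t01; rewrite tail2 -[P.[_]]/(v g2 t) vg2.
  exact: (edge_last nw12).
- rewrite tail2 => f; rewrite [older _]/= -/(rcons l s0) inE => /orP[/eqP ->|fl].
    have [p1 _ m1] := ready_base rg (mem_head _ _).
    split=> //; rewrite vg1; apply: (edge_misses (co_corner true w X)).
    by rewrite [co true w2]/= eq_sym.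
  by have [p1 _ m1] := base f fl; split=> //; exact: miss2.
rewrite tail2 in vg3.
have w23 : co true (wb%:C : C) = co true w2 by [].
have nw23 : co (~~ true) (wb%:C : C) != co (~~ true) w2 by rewrite /= eq_sym.
have [|_ hPc] := hd (fe 0); first by rewrite subrr cabs0.
apply: (@assemble (g3 :: g2 :: g1 :: l)) => //.
- move=> f; rewrite !inE => /or4P[/eqP ->|/eqP ->|/eqP ->|fl] //.
    exact: ready_edge rg _ (mem_head _ _).
  exact: ready_edge rl _ fl.
- by rewrite /current /= g31 -fe_start hPc.
- move=> s t s01 t01; rewrite /current [head _ _]/= -[P.[_]]/(v g3 s) vg3 => E.
  split.
    apply: (edge_last nw23) => //; rewrite E; exact: fe_real.
  have := congr1 (co true) E; rewrite (co_edge w23) => /esym Et.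
  by apply: fe_inj => //; rewrite fe_start; exact: Et.
move=> f; rewrite !inE => /or3P[/eqP ->|/eqP ->|fl].
- have [fp _ fm] := ready_older rg (mem_head _ _).
  rewrite vg2; apply/cross_sym/(edge_cross w12 nw12) => //.
  + by rewrite tail1 in fp.
  + by rewrite tail1 in fm.
  move=> t t01 /(congr1 (@complex.Im R)); rewrite fe_real//= => E.
  by rewrite -E eqxx in X0.
- exact: ready_cross rg _ (mem_head _ _).
exact: ready_cross rl _ fl.
Qed.

End Route.

(** * The base curve *)

Section BaseCurve.
Context {R : realType}.
Local Notation C := R[i].
Implicit Types (Q : {poly C}) (z w : C) (x y s t e r : R).

Definition coP (b : bool) Q : {poly R} := if b then reP Q else imP Q.

Lemma horner_coP b Q x : (coP b Q).[x] = co b Q.[x%:C].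
Proof. by rewrite horner_reP_imP; case: b. Qed.

Lemma deriv_coP b Q : (coP b Q)^`() = coP b Q^`().
Proof.
apply/polyP => i; case: b; rewrite coef_deriv !coef_map_id0//= coef_deriv.
  by rewrite raddfMn.
by rewrite raddfMn.
Qed.

Lemma Re_neq0 z r : cabs (z - r%:C) < `|r| -> complex.Re z != 0.
Proof.
move=> zr; have := le_lt_trans (cabs_Re _) zr; case: z zr => u v _ /=.
by apply: contraTneq => ->; rewrite sub0r normrN ltxx.
Qed.

Lemma regular_pointI Q z : Q^`().[z] != 0 -> ~ slit Q.[z] -> regular_point Q z.
Proof.
move=> dz nz; split=> //.
have [e0 e00 far] : exists2 e : R, 0 < e &
    forall w, cabs (w - Q.[z]) < e -> ~ slit w.
  have [re0|re0] := eqVneq (complex.Re Q.[z]) 0.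
    have im0 : 0 < complex.Im Q.[z].
      by rewrite ltNge; apply/negP => im; apply: nz.
    exists (complex.Im Q.[z]) => // w wz [_ imw].
    have := le_lt_trans (cabs_Im _) wz; case: (w) imw => u v /= v0.
    by case: (Q.[z]) im0 => u' v' /= v'0; rewrite ltr_norml => /andP[h _]; lra.
  exists `|complex.Re Q.[z]|; first by rewrite normr_gt0.
  move=> w wz [rew _]; have := le_lt_trans (cabs_Re _) wz.
  case: (w) rew => u v /= ->; case: (Q.[z]) => u' v' /=.
  by rewrite sub0r normrN ltxx.
have [d /andP[d0 _] near] := near_cabs Q z e00.
by exists d => // x xz; apply/far/near/ltW.
Qed.

Lemma along_curve Q (S : C -> Prop) (q : {poly C}) (l r : R) :
  (forall z, regular_point Q z -> exists2 d : R, 0 < d & forall u v,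
    cabs (u - z) < d -> cabs (v - z) < d -> S u -> S v) ->
  l <= r -> (forall x, l <= x <= r -> regular_point Q q.[x%:C]) ->
  S q.[l%:C] -> S q.[r%:C].
Proof.
move=> loc lr reg Sl.
apply: (local_propagation (Q := fun x => S q.[x%:C]) lr) Sl => x xlr.
have [d d0 dS] := loc _ (reg x xlr).
have [d1 /andP[d10 _] near] := near_cabs q x%:C d0.
have close y : `|y - x| < d1 -> cabs (q.[y%:C] - q.[x%:C]) < d.
  by move=> yx; apply: near; rewrite -rmorphB /= cabs_real ltW.
by exists d1 => // y z _ _ /close yx /close zx; exact: dS.
Qed.

Section Real.
Context (p : {poly R}).
Local Notation P := (map_poly (real_complex R) p).

Lemma horner_toC x : P.[x%:C] = (p.[x])%:C.
Proof. by rewrite horner_map. Qed.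

Lemma deriv_toC : P^`() = map_poly (real_complex R) p^`().
Proof. by rewrite deriv_map. Qed.

Lemma regular_real x : p.[x] != 0 -> p^`().[x] != 0 -> regular_point P x%:C.
Proof.
move=> px dpx; apply: regular_pointI.
  rewrite deriv_toC horner_map /= -[0]/(0%:C) (inj_eq (@complexI R)) //.
by rewrite horner_toC => -[/= re _]; rewrite re eqxx in px.
Qed.

Section Perturbation.
Context (al be : R).
Hypothesis albe : al < be.
Hypothesis pal : p.[al] != 0.
Hypothesis pbe : p.[be] != 0.
Hypothesis dpal : p^`().[al] != 0.
Hypothesis dpbe : p^`().[be] != 0.
Hypothesis simple : forall x, al <= x <= be -> p.[x] = 0 -> p^`().[x] != 0.

(* The points [x + i e phi x] avoid both the slit and the critical points: at a
   zero of [p] the imaginary part of [P] is about [e phi p' > 0], and at a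
   critical point of [p] the height [e phi] does not vanish. *)
Let phi : {poly R} := (p^`() + p ^+ 2) * (('X - al%:P) * (be%:P - 'X)).

Let phiE x : phi.[x] = (p^`().[x] + p.[x] ^+ 2) * ((x - al) * (be - x)).
Proof. by rewrite !(hornerE, horner_exp). Qed.

Let bump x : al < x < be -> 0 < (x - al) * (be - x).
Proof. by move=> /andP[h1 h2]; rewrite mulr_gt0// subr_gt0. Qed.

(* every point of the segment has a neighbourhood over which the curves
   [x + i e phi x] are regular for all small [e] *)
Let local_perturbation x0 : al <= x0 <= be -> exists d e0, [/\ 0 < d, 0 < e0 &
  forall x e, `|x - x0| < d -> 0 < e -> e < e0 ->
    regular_point P (x +i* (e * phi.[x]))].
Proof.
move=> x0ab; set z0 : C := x0%:C.
have [B B0 phiB] := horner_bounded phi (`|x0| + 1).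
have B1 : 0 < B + 1 by rewrite ltr_wpDl.
have close r x e : 0 < r -> r <= 1 -> `|x - x0| < r / 2 -> 0 < e ->
    e < r / 2 / (B + 1) ->
    cabs ((x +i* (e * phi.[x])) - z0) < r /\ `|e * phi.[x]| < r / 2.
  move=> r0 r1 xx e0 er.
  have xB : `|x| <= `|x0| + 1.
    rewrite -[x](subrK x0) (le_trans (ler_normD _ _))// addrC lerD2l.
    by rewrite (le_trans (ltW xx))//; lra.
  have ph : `|e * phi.[x]| < r / 2.
    rewrite normrM gtr0_norm// (le_lt_trans (ler_wpM2l (ltW e0) (phiB x xB)))//.
    move: er; rewrite ltr_pdivlMr// => er; apply: le_lt_trans er.
    by rewrite (ler_wpM2l (ltW e0))// lerDl.
  split=> //; rewrite (le_lt_trans (cabs_le_ReIm _))//= subr0 [ltRHS]splitr.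
  exact: ltrD.
have [px0|px0] := eqVneq p.[x0] 0.
  have dpx0 := simple x0ab px0; set D := p^`().[x0] in dpx0.
  have dPz : P^`().[z0] = D%:C by rewrite deriv_toC horner_map.
  have x0in : al < x0 < be.
    move: x0ab => /andP[h1 h2]; rewrite !lt_neqAle h1 h2 !andbT.
    apply/andP; split; first by apply: contraNneq pal => ->; rewrite px0.
    by apply: contraNneq pbe => <-; rewrite px0.
  have pp0 : 0 < (phi * D%:P).[x0].
    rewrite hornerM hornerC phiE px0 expr0n addr0 -/D mulrAC mulr_gt0 ?bump//.
    by rewrite -expr2 exprn_even_gt0.
  have [d1 /andP[d10 d11] near1] := horner_near (phi * D%:P) x0 pp0.
  have dPz0 : P^`().[z0] != 0.
    by rewrite dPz -[0]/(0%:C) (inj_eq (@complexI R)).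
  have [d2 /andP[d20 d21] near2] := neq0_near_cabs dPz0.
  have [d4 /andP[d40 d41] near4] := horner_neq0_near dpx0.
  have [M M0 PM] := second_order_cabs P z0.
  have D0 : 0 < `|D| by rewrite normr_gt0.
  have M1 : 0 < 2 * (M + 1) by rewrite mulr_gt0// ltr_wpDl.
  pose d3 := `|D| / (2 * (M + 1)).
  have d30 : 0 < d3 by rewrite divr_gt0.
  pose r := Num.min (Num.min d1 d2) d3.
  have r0 : 0 < r by rewrite !lt_min d10 d20.
  have [rd1 rd2 rd3] : [/\ r <= d1, r <= d2 & r <= d3].
    by rewrite /r !ge_min !lexx !orbT.
  have Mr : 2 * (M + 1) * r <= `|D| by rewrite mulrC -ler_pdivlMr.
  have r1 : r <= 1 by exact: le_trans d11.
  exists (r / 2), (r / 2 / (B + 1)).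
  split; rewrite ?divr_gt0// => x e xx e0 er.
  have [cl ph] := close r x e r0 r1 xx e0 er.
  set y := e * phi.[x] in cl ph *; set z : C := x +i* y in cl *.
  apply: regular_pointI; first by apply: near2; rewrite (le_trans (ltW cl)).
  have xr' : `|x - x0| < r by rewrite (lt_trans xx)// ltr_pdivrMr// ltr_pMr ?ltr1n.
  have xr : `|x - x0| <= d1 by rewrite (le_trans (ltW xr')).
  have pos : 0 < phi.[x] * D.
    have := near1 x xr; rewrite ltr_norml => /andP[+ _].
    by rewrite -subr_gt0 opprK subrK hornerM hornerC.
  have y0 : y != 0.
    by rewrite mulf_neq0 ?(gt_eqF e0)//; apply: contraTneq pos => ->; rewrite mul0r ltxx.
  have h : cabs (P.[z] - P.[x%:C] - P^`().[z0] * (z - x%:C)) <=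
      M * (cabs (z - z0) + cabs (x%:C - z0)) * cabs (z - x%:C).
    apply: PM; first by rewrite (le_trans (ltW cl)).
    by rewrite -rmorphB cabs_real (le_trans xr).
  have zx : z - x%:C = 0 +i* y.
    by apply/eqP; rewrite eq_complex /= subrr subr0 !eqxx.
  have := le_trans (cabs_Im _) h.
  rewrite zx cabs_imag dPz horner_toC -rmorphB cabs_real => {}h.
  move=> [_ imz]; move: h.
  have -> : complex.Im (P.[z] - (p.[x])%:C - D%:C * (0 +i* y)) =
      complex.Im P.[z] - D * y.
    by case: (P.[z]) => u v /=; rewrite !mul0r !(subr0, addr0).
  have Dy : D * y = `|D| * `|y|.
    rewrite -normrM ger0_norm// /y mulrCA mulr_ge0 ?(ltW e0)//.
    by rewrite mulrC ltW.
  rewrite Dy distrC => /(le_trans (ler_norm _)) h.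
  have yp : 0 < `|y| by rewrite normr_gt0.
  have : `|D| * `|y| <= M * (cabs (z - z0) + `|x - x0|) * `|y|.
    by apply: le_trans h; rewrite lerBrDr gerDl.
  rewrite ler_pM2r//; apply/negP; rewrite -ltNge.
  have h1 : cabs (z - z0) + `|x - x0| < 2 * r by rewrite mulr_natl mulr2n ltrD.
  rewrite (le_lt_trans (ler_wpM2l M0 (ltW h1)))// (lt_le_trans _ Mr)//.
  by rewrite mulrA ltr_pM2r// mulrC ltr_pM2l// ltrDl.
have [dpx0|dpx0] := eqVneq p^`().[x0] 0; last first.
  have [dz [e1 e10 off]] := regular_real px0 dpx0.
  have [d2 /andP[d20 d21] near2] := neq0_near_cabs dz.
  pose r := Num.min e1 d2.
  have r0 : 0 < r by rewrite lt_min e10 d20.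
  have [re rd] : r <= e1 /\ r <= d2 by rewrite /r !ge_min !lexx !orbT.
  exists (r / 2), (r / 2 / (B + 1)).
  split; rewrite ?divr_gt0// => x e xx e0 er.
  have [cl _] := close r x e r0 (le_trans rd d21) xx e0 er.
  apply: regular_pointI; first by apply: near2; rewrite (le_trans (ltW cl)).
  by apply: off; exact: lt_le_trans re.
have x0in : al < x0 < be.
  move: x0ab => /andP[h1 h2]; rewrite !lt_neqAle h1 h2 !andbT.
  apply/andP; split; first by apply: contraNneq dpal => ->; rewrite dpx0.
  by apply: contraNneq dpbe => <-; rewrite dpx0.
have phi0 : phi.[x0] != 0.
  by rewrite phiE dpx0 add0r mulf_neq0 ?expf_neq0// gt_eqF// bump.
have [d1 /andP[d10 d11] near1] := horner_neq0_near phi0.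
have P0 : 0 < `|p.[x0]| by rewrite normr_gt0.
have [d2 /andP[d20 d21] near2] := near_cabs P z0 P0.
have dp0 : P^`() != 0.
  rewrite deriv_toC map_poly_eq0; apply: contraNneq dpal => ->.
  by rewrite horner0.
have [d3 /andP[d30 d31] near3] := isolated_cabs z0 dp0.
pose r := Num.min (Num.min d1 d2) d3.
have r0 : 0 < r by rewrite !lt_min d10 d20.
have [rd1 rd2 rd3] : [/\ r <= d1, r <= d2 & r <= d3].
  by rewrite /r !ge_min !lexx !orbT.
exists (r / 2), (r / 2 / (B + 1)).
split; rewrite ?divr_gt0// => x e xx e0 er.
have [cl _] := close r x e r0 (le_trans rd1 d11) xx e0 er.
have phx : phi.[x] != 0.
  by apply: near1; rewrite (le_trans (ltW xx))// (le_trans _ rd1)// ler_pdivrMr// ler_peMr ?ler1n// ltW.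
apply: regular_pointI.
  apply: near3; last by rewrite (le_trans (ltW cl)).
  by rewrite eq_complex /= negb_and mulf_neq0 ?orbT// (gt_eqF e0).
have : complex.Re P.[x +i* (e * phi.[x])] != 0.
  apply: (@Re_neq0 _ p.[x0]); rewrite -horner_toC; apply: near2.
  by rewrite (le_trans (ltW cl)).
by move=> /eqP re [].
Qed.

(** The bound on [e] is uniform in [x] because it can be chosen locally. *)
Lemma base_curve : exists2 q : {poly C},
  q.[al%:C] = al%:C /\ q.[be%:C] = be%:C &
  forall x, al <= x <= be -> regular_point P q.[x%:C].
Proof.
have [e [e0 H]] : exists e, 0 < e /\ forall x, al <= x <= be ->
    regular_point P (x +i* (e * phi.[x])).
  suff [e [e0 H]] : exists e, 0 < e /\ forall x e', al <= x <= be -> 0 < e' ->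
      e' < e -> regular_point P (x +i* (e' * phi.[x])).
    exists (e / 2); split=> [|x xab]; first by rewrite divr_gt0.
    by apply: H; rewrite // ?divr_gt0// ltr_pdivrMr// ltr_pMr// ltr1n.
  pose S y := exists e, 0 < e /\ forall x e', al <= x <= y -> 0 < e' ->
    e' < e -> regular_point P (x +i* (e' * phi.[x])).
  apply: (local_propagation (Q := S) (ltW albe)) => [x0 x0ab|].
    have [d [e1 [d0 e10 H]]] := local_perturbation x0ab.
    exists d => // y z _ _ yx zx [e [e0 Sy]].
    exists (Num.min e e1); split=> [|x e' /andP[ax xz] e'0]; first by rewrite lt_min e0.
    rewrite lt_min => /andP[e'e e'e1]; have [xy|yx'] := lerP x y.
      by apply: Sy; rewrite ?ax.
    apply: H => //; move: yx zx; rewrite !ltr_norml => /andP[h1 h2] /andP[h3 h4].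
    by apply/andP; split; lra.
  have [|d [e1 [d0 e10 H]]] := @local_perturbation al; first by rewrite lexx ltW.
  exists e1; split=> // x e'; rewrite -eq_le => /eqP <-; apply: H.
  by rewrite subrr normr0.
pose q : {poly C} := 'X + (0 +i* e)%:P * map_poly (real_complex R) phi.
have qE x : q.[x%:C] = x +i* (e * phi.[x]).
  rewrite hornerD hornerX hornerM hornerC horner_map /=.
  by apply/eqP; rewrite eq_complex /= !(mul0r, mulr0, subr0, addr0, add0r) !eqxx.
have phi0 x : (x - al) * (be - x) = 0 -> q.[x%:C] = x%:C.
  by move=> h; rewrite qE phiE h mulr0 mulr0.
exists q; first by split; apply: phi0; rewrite subrr ?mul0r ?mulr0.
by move=> x xab; rewrite qE; exact: H.
Qed.

End Perturbation.

(** * The first and the last piece *)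

Lemma finish_piece (b D : R) : p != 0 -> p.[b] = 0 -> 0 < D ->
  exists c, [/\ b - D < c, c < b, p.[c] != 0, p^`().[c] != 0 &
    let fe := fun t => c%:C + t%:C * (b - c)%:C in
    [/\ regular_piece fe, fe 0 = c%:C, fe 1 = b%:C,
      forall t, complex.Im P.[fe t] = 0 &
      (forall s t, 0 <= s <= 1 -> 0 <= t <= 1 ->
        complex.Re P.[fe s] = complex.Re P.[fe t] -> s = t) /\
      forall t, 0 < t < 1 -> complex.Re (velocity (fun t => P.[fe t]) t) != 0]].
Proof.
move=> p0 pb D0; have [d /andP[d0 _] [dp mono]] := monotone_left p0 pb.
pose d' := Num.min d (D / 2).
have d'0 : 0 < d' by rewrite lt_min d0 divr_gt0.
have d'd : d' <= d by rewrite /d' ge_min lexx.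
have d'D : d' <= D / 2 by rewrite /d' ge_min lexx orbT.
pose c := b - d'; have cb : c < b by rewrite ltrBlDr ltrDl.
have inj u v : b - d <= u -> u < v -> v <= b -> p.[u] != p.[v].
  move=> du uv vb; have := mono u v du uv vb.
  by apply: contraTneq => ->; rewrite subrr mulr0 ltxx.
have dc : b - d <= c by rewrite lerD2l lerN2.
have pc : p.[c] != 0 by rewrite -pb; exact: inj.
exists c; split=> //; first by rewrite /c ltrD2l ltrN2; lra.
  by apply: dp; rewrite dc.
have bc : 0 < b - c by rewrite subr_gt0.
have feE t : c%:C + t%:C * (b - c)%:C = (c + t * (b - c))%:C :> C.
  by rewrite [RHS]rmorphD /= [X in _ = _ + X]rmorphM.
have vE t : P.[c%:C + t%:C * (b - c)%:C] = (p.[c + t * (b - c)])%:C.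
  by rewrite feE horner_toC.
have dfe t : cder (fun t => P.[c%:C + t%:C * (b - c)%:C]) t
    (P^`().[c%:C + t%:C * (b - c)%:C] * (b - c)%:C).
  exact/cder_horner/cder_segment.
split.
- split; first exact: smooth_segment.
  move=> t _; rewrite (cder_velocity (cder_segment _ _ t)).
  by rewrite -[0]/(0%:C) (inj_eq (@complexI R)) (gt_eqF bc).
- by rewrite mul0r addr0.
- by rewrite mul1r -rmorphD /= addrC subrK.
- by move=> t; rewrite vE.
split=> [s t s01 t01|t /andP[t0 t1]].
  have in_cb u : 0 <= u <= 1 -> c <= c + u * (b - c) <= b.
    move=> /andP[u0 u1]; rewrite lerDl mulr_ge0 ?(ltW bc)//=.
    by rewrite -lerBrDl ler_piMl// ltW.
  have mon u v : 0 <= u <= 1 -> 0 <= v <= 1 -> u < v ->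
      p.[c + u * (b - c)] != p.[c + v * (b - c)].
    move=> /in_cb/andP[u0 u1] /in_cb/andP[v0 v1] uv; apply: inj => //.
      exact: le_trans u0.
    by rewrite ltrD2l ltr_pM2r.
  rewrite !vE /= => E; apply/eqP; case: (ltgtP s t) => // st.
    by have := mon _ _ s01 t01 st; rewrite E eqxx.
  by have := mon _ _ t01 s01 st; rewrite E eqxx.
rewrite (cder_velocity (dfe t)) feE deriv_toC horner_map -rmorphM /=.
rewrite mulf_neq0 ?(gt_eqF bc)//; apply: dp.
rewrite (le_trans dc) ?lerDl ?mulr_ge0 ?ltW//=.
by rewrite -ltrBrDl gtr_pMl.
Qed.

(** To first order [(1 + i k) ^ m] is [1 + i m k], hence not real for small
    [k > 0].  With [m] the multiplicity of a zero, this is the direction in which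
    the image of a segment leaves the zero. *)
Lemma tilt (m : nat) : (0 < m)%N -> exists k : R, [/\ 0 < k, k <= 1,
  forall y, 0 <= y <= k -> cabs ((1 +i* y) ^+ m - 1) < 4^-1 &
  complex.Im ((1 +i* k) ^+ m) != 0].
Proof.
move=> m0; pose g : {poly C} := 1 + 'i%:P * 'X; pose f := g ^+ m.
have gE (z : C) : g.[z] = 1 + 'i * z by rewrite hornerD hornerM !hornerC hornerX.
have fE y : f.[y%:C] = (1 +i* y) ^+ m.
  rewrite horner_exp gE; congr (_ ^+ _).
  by apply/eqP; rewrite eq_complex /= !(mul0r, mul1r, mulr0, subr0, addr0, add0r) !eqxx.
have f0 : f.[0] = 1 by rewrite horner_exp gE mulr0 addr0 expr1n.
have df0 : f^`().[0] = 0 +i* m%:R.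
  have dg : g^`() = 'i%:P.
    by rewrite /g derivD derivM derivX !derivC mul0r !add0r mulr1.
  rewrite deriv_exp dg hornerMn hornerM horner_exp gE hornerC.
  rewrite mulr0 addr0 expr1n mulr1 -mulr_natr.
  have -> : m%:R = (m%:R)%:C :> C by rewrite rmorph_nat.
  apply/eqP; rewrite eq_complex /= !(mul0r, mul1r, mulr0, oppr0, subr0, addr0, add0r).
  by rewrite !eqxx.
have e4 : 0 < 4^-1 :> R by [].
have [d /andP[d0 d1] near] := near_cabs f 0 e4.
have [M M0 fM] := second_order_cabs f 0.
have M1 : 0 < M + 1 by rewrite ltr_wpDl.
pose k := Num.min d (M + 1)^-1.
have k0 : 0 < k by rewrite lt_min d0 invr_gt0.
have kd : k <= d by rewrite /k ge_min lexx.
have kM : k * (M + 1) <= 1.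
  by rewrite -ler_pdivlMr// div1r /k ge_min lexx orbT.
have k1 : k <= 1 by exact: le_trans d1.
exists k; split=> // [y /andP[y0 yk]|].
  rewrite -fE -f0; apply: near.
  by rewrite subr0 cabs_real ger0_norm// (le_trans yk).
have : cabs (k%:C - 0) <= 1 by rewrite subr0 cabs_real gtr0_norm.
move=> /fM/(_ (_ : cabs (0 - 0) <= 1)); rewrite subrr cabs0 ler01 => /(_ isT).
rewrite !subr0 addr0 cabs_real gtr0_norm// => /(le_trans (cabs_Im _)).
rewrite df0 f0 fE; set w := _ ^+ m.
have -> : complex.Im (w - 1 - (0 +i* m%:R) * k%:C) = complex.Im w - m%:R * k.
  by case: (w) => x y; rewrite /= !(mul0r, mulr0, subr0, addr0, add0r, oppr0).
move=> h; apply/eqP => w0; move: h; rewrite w0 sub0r normrN normrM normr_nat.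
rewrite gtr0_norm// ler_pM2r//; apply/negP; rewrite -ltNge.
have : 1 <= m%:R :> R by rewrite ler1n.
have : M * k < 1 by apply: lt_le_trans kM; rewrite mulrC ltr_pM2l// ltrDl.
exact: lt_le_trans.
Qed.

(** A segment from [a] along the real axis could have the same values as the last
    piece, so it is tilted.  With [F] the composition of [P] with a
    parametrization of the tilted line, [F(t) / t ^ m] tends to a value that is
    neither real nor imaginary, so both coordinates of [F] are nonzero
    polynomials, monotone near [0].  The vertical segment from the end of this
    piece down to the real axis consists of regular points, since [P] is
    approximately a nonzero real number there. *)
Lemma start_piece (a B D : R) : p != 0 -> p.[a] = 0 -> 0 < B -> 0 < D ->
  exists v : C, [/\ 0 < complex.Re v < D,
    let s0 := fun t => a%:C + t%:C * v in
    [/\ regular_piece s0,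
      (forall b s t, 0 <= s <= 1 -> 0 <= t <= 1 ->
        co b P.[s0 s] = co b P.[s0 t] -> s = t),
      (forall b t, 0 < t < 1 -> co b (velocity (fun t => P.[s0 t]) t) != 0) &
      forall t, 0 <= t <= 1 -> `|complex.Re P.[s0 t]| < B] &
    0 <= complex.Im v /\ forall y, 0 <= y <= complex.Im v ->
      regular_point P ((a + complex.Re v) +i* y)].
Proof.
move=> p0 pa B0 D0; have [m [u]] := multiplicity_XsubC p a.
rewrite p0 /= => ua pE.
have m0 : (0 < m)%N.
  by case: m pE => // pE; move: ua; rewrite rootE -pa pE expr0 mulr1 eqxx.
have [k [k0 k1 near1 imk]] := tilt m0.
set e : C := 1 +i* k in imk; set w0 := e ^+ m in imk.
pose A := u.[a]; have A0 : A != 0 by exact: ua.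
pose U := map_poly (real_complex R) u.
have UA : U.[a%:C] = A%:C by rewrite horner_map.
have PE z : P.[z] = U.[z] * (z - a%:C) ^+ m.
  rewrite pE rmorphM rmorphXn /= rmorphB /= map_polyX map_polyC /=.
  by rewrite hornerM horner_exp hornerXsubC.
have rew0 : complex.Re w0 != 0.
  apply: (@Re_neq0 _ 1); rewrite normr1.
  have := near1 k; rewrite lexx ltW// => /(_ isT) h.
  by apply: lt_trans h _; lra.
pose q : {poly C} := a%:C%:P + e%:P * 'X.
have qE (x : C) : q.[x] = a%:C + e * x by rewrite hornerD hornerM !hornerC hornerX.
pose F := P \Po q; pose G := w0%:P * (U \Po q).
have FG (x : C) : F.[x] = x ^+ m * G.[x].
  rewrite horner_comp qE PE hornerM hornerC horner_comp qE.
  by rewrite [a%:C + _ - _]addrC addKr exprMn -/w0; ring.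
have G0 : G.[0] = A%:C * w0.
  by rewrite hornerM hornerC horner_comp qE mulr0 addr0 UA mulrC.
have F0 : F.[0] = 0 by rewrite FG expr0n eqn0Ngt m0 mul0r.
have coF b : coP b F != 0 /\ (coP b F).[0] = 0.
  split; last by rewrite horner_coP F0; case: b.
  have coG0 : co b G.[0] != 0.
    by rewrite G0 co_real mulf_neq0//; case: b.
  have gt0 : 0 < `|co b G.[0]| by rewrite normr_gt0.
  have [d /andP[d0 d1] near] := near_cabs G 0 gt0.
  have coGd : co b G.[d%:C] != 0.
    have : cabs (d%:C - 0) <= d by rewrite subr0 cabs_real gtr0_norm.
    move=> /near; apply: contraTneq => E; rewrite -leNgt.
    have : `|co b (G.[d%:C] - G.[0])| <= cabs (G.[d%:C] - G.[0]).
      by case: b {coG0 gt0 near E}; [exact: cabs_Re|exact: cabs_Im].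
    by rewrite coB E sub0r normrN.
  apply: contraNneq coGd => cF0; have := horner_coP b F d.
  rewrite cF0 horner0 FG -rmorphXn co_real => /esym/eqP.
  by rewrite mulf_eq0 expf_eq0 (gt_eqF d0) andbF.
have [d1 /andP[d10 _] [dF1 mono1]] := monotone_right (coF true).1 (coF true).2.
have [d2 /andP[d20 _] [dF2 mono2]] := monotone_right (coF false).1 (coF false).2.
have [d3 /andP[d30 _] near3] := near_cabs F 0 B0.
have A4 : 0 < `|A| / 4 by rewrite divr_gt0// normr_gt0.
have [d4 /andP[d40 _] near4] := near_cabs U a%:C A4.
have dP0 : P^`() != 0.
  rewrite deriv_toC map_poly_eq0 -size_poly_eq0 polyorder.size_deriv -lt0n.
  by rewrite -subn1 subn_gt0; apply: (root_size_gt1 (a := a)) => //; apply/rootP.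
have [d5 /andP[d50 _] near5] := isolated_cabs a%:C dP0.
pose de := Num.min (Num.min (Num.min d1 d2) (Num.min d3 (d4 / 2)))
  (Num.min (d5 / 2) (D / 2)).
have de0 : 0 < de by rewrite !lt_min d10 d20 d30 !divr_gt0.
have : de <= de by [].
rewrite {2}/de !le_min -!andbA => /and5P[de1 de2 de3 de4 /andP[de5 deD]].
pose v : C := de%:C * e.
have vE : v = de +i* (de * k).
  by apply/eqP; rewrite eq_complex /= !(mul0r, mulr1, subr0, addr0) !eqxx.
have sE t : a%:C + t%:C * v = q.[(t * de)%:C].
  by rewrite qE rmorphM /= /v; ring.
have vF t : P.[a%:C + t%:C * v] = F.[(t * de)%:C] by rewrite sE horner_comp.
have coPF b t : co b P.[a%:C + t%:C * v] = (coP b F).[t * de].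
  by rewrite vF horner_coP.
exists v; split.
- by rewrite vE /= de0/= (le_lt_trans deD)// ltr_pdivrMr// ltr_pMr// ltr1n.
- have v0 : v != 0.
    by apply/eqP => /(congr1 (@complex.Re R)); rewrite vE /= => E; move: de0; rewrite E ltxx.
  split.
  + split; first exact: smooth_segment.
    by move=> t _; rewrite (cder_velocity (cder_segment _ _ t)).
  + move=> b s t s01 t01; rewrite !coPF => E.
    have inj x y : 0 <= x <= 1 -> 0 <= y <= 1 -> x < y ->
        (coP b F).[x * de] != (coP b F).[y * de].
      move=> /andP[x0 x1] /andP[y0 y1] xy.
      have xd : x * de < y * de by rewrite ltr_pM2r.
      have x0d : 0 <= x * de by rewrite mulr_ge0// ltW.
      have yd : y * de <= de by rewrite ler_piMl// ltW.
      have : exists c, 0 < c * ((coP b F).[y * de] - (coP b F).[x * de]).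
        case: b {coPF E}; eexists; [apply: mono1|apply: mono2] => //;
          rewrite add0r; exact: le_trans yd _.
      by move=> [c]; apply: contraTneq => ->; rewrite subrr mulr0 ltxx.
    apply/eqP; case: (ltgtP s t) => // st.
      by have := inj _ _ s01 t01 st; rewrite E eqxx.
    by have := inj _ _ t01 s01 st; rewrite E eqxx.
  + move=> b t /andP[t0 t1].
    have td0 : 0 < t * de by rewrite mulr_gt0.
    have td : t * de <= de by rewrite ler_piMl// ltW.
    rewrite (cder_velocity (cder_horner P (cder_segment a%:C v t))).
    have -> : P^`().[a%:C + t%:C * v] * v = de%:C * F^`().[(t * de)%:C].
      rewrite sE deriv_comp hornerM horner_comp /v.
      rewrite derivD derivC add0r derivM derivC mul0r add0r derivX mulr1 hornerC.
      by ring.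
    rewrite co_real mulf_neq0 ?(gt_eqF de0)// -horner_coP -deriv_coP.
    by case: b; [apply: dF1|apply: dF2]; rewrite add0r td0 (le_trans td).
  move=> t /andP[t0 t1]; rewrite vF.
  apply: le_lt_trans (cabs_Re _) _; rewrite -[F.[_]]subr0 -F0; apply: near3.
  rewrite subr0 cabs_real ger0_norm ?mulr_ge0 ?(ltW de0)//.
  by rewrite (le_trans _ de3)// ler_piMl// ltW.
rewrite vE /=; split=> [|y /andP[y0 yk]]; first by rewrite mulr_ge0// ltW.
pose l := y / de.
have yE : y = de * l by rewrite /l mulrC divfK// gt_eqF.
have l0 : 0 <= l by rewrite divr_ge0// ltW.
have lk : l <= k by rewrite ler_pdivrMr// mulrC.
have := near1 l; rewrite l0 lk => /(_ isT) nl.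
set z : C := _ +i* _.
have zE : z - a%:C = de%:C * (1 +i* l).
  apply/eqP; rewrite eq_complex /= !(mul0r, mulr1, subr0, addr0) -yE.
  by rewrite addrC addKr !eqxx.
have za : cabs (z - a%:C) <= 2 * de.
  rewrite zE cabsM cabs_real gtr0_norm// mulrC ler_pM2r//.
  rewrite (le_trans (cabs_le_ReIm _))//= normr1 ger0_norm//.
  by rewrite -[2]/(1 + 1) lerD2l (le_trans lk).
apply: regular_pointI.
  apply: near5; last by rewrite (le_trans za)// mulrC -ler_pdivlMr.
  apply/eqP => /(congr1 (@complex.Re R)) /= /eqP.
  by rewrite -subr_eq0 addrC addKr (gt_eqF de0).
suff : complex.Re P.[z] != 0 by move=> /eqP re [].
apply: (@Re_neq0 _ (de ^+ m * A)).
have -> : P.[z] - (de ^+ m * A)%:C = (de ^+ m)%:C *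
    ((1 +i* l) ^+ m * (U.[z] - A%:C) + A%:C * ((1 +i* l) ^+ m - 1)).
  by rewrite PE zE exprMn !rmorphM /= rmorphXn /=; ring.
have dm0 : 0 < de ^+ m by rewrite exprn_gt0.
rewrite cabsM cabs_real normrM (gtr0_norm dm0) ltr_pM2l//.
rewrite (le_lt_trans (cabsD _ _))// !cabsM cabs_real.
have Uz : cabs (U.[z] - A%:C) < `|A| / 4.
  by rewrite -UA; apply: near4; rewrite (le_trans za)// mulrC -ler_pdivlMr.
have f54 : cabs ((1 +i* l) ^+ m) <= 5 / 4.
  rewrite -[X in cabs X](subrK 1) (le_trans (cabsD _ _))//.
  have -> : cabs (1 : C) = 1 by rewrite /cabs normr1.
  by move: nl; clear; lra.
have Ap : 0 < `|A| by rewrite normr_gt0.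
have h1 : cabs ((1 +i* l) ^+ m) * cabs (U.[z] - A%:C) <= 5 / 4 * (`|A| / 4).
  by rewrite ler_pM ?cabs_ge0// ltW.
have h2 : `|A| * cabs ((1 +i* l) ^+ m - 1) <= `|A| * 4^-1.
  by rewrite ler_pM2l// ltW.
by rewrite (le_lt_trans (lerD h1 h2))//; move: Ap; clear; lra.
Qed.

End Real.
End BaseCurve.

(** * Property (E) for real polynomials *)

Section Conclusion.
Context {R : realType}.
Local Notation C := R[i].

(** The path is continued from the end of the first piece down to the real axis,
    then along the base curve, by propagating [reach]. *)
Lemma property_E_real (a b : R) (p : {poly R}) : a < b -> p != 0 ->
  p.[a] = 0 -> p.[b] = 0 ->
  (forall x, a < x < b -> p.[x] = 0 -> p^`().[x] != 0) ->
  property_E (map_poly (real_complex R) p) a%:C b%:C.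
Proof.
move=> ab p0 pa pb simple; set P := map_poly _ p.
have D0 : 0 < (b - a) / 2 by rewrite divr_gt0// subr_gt0.
have [c [Dc cb pc dpc [ge fe0' fe1' fe_re [fe_inj fe_vel]]]] := finish_piece p0 pb D0.
pose fe (t : R) : C := c%:C + t%:C * (b - c)%:C.
have fe0 : fe 0 = c%:C by [].
have fe1 : fe 1 = b%:C by [].
have B0 : 0 < `|p.[c]| by rewrite normr_gt0.
have [v [/andP[v0 vD] [gs inj0 vel0 small] [imv vert]]] := start_piece p0 pa B0 D0.
pose s0 (t : R) : C := a%:C + t%:C * v.
set al := a + complex.Re v in vert.
have alc : al < c by rewrite /al; lra.
have aal : a < al by rewrite ltrDl.
have s00 : s0 0 = a%:C by rewrite /s0 mul0r addr0.
have start : P.[s0 0] = 0 by rewrite s00 horner_toC pa.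
have fe_start : P.[fe 0] = (p.[c])%:C by rewrite fe0 horner_toC.
have fe_finish : P.[fe 1] = 0 by rewrite fe1 horner_toC pb.
have re0 t : 0 <= t <= 1 -> complex.Re P.[s0 t] != p.[c].
  by move=> /small; apply: contraTneq => ->; rewrite ltxx.
have loc := reach_local (s0 := s0) (fe := fe) p.[c] inj0 vel0 (fun t _ => fe_re t) fe_inj
  (fun t => fe_vel t).
rewrite -s00 -fe1.
apply: (reach_finish (s0 := s0) (fe := fe) gs start inj0 vel0 re0 ge fe_start fe_finish
  (fun t _ => fe_re t) fe_inj fe_vel).
  by rewrite fe0; exact: regular_real.
have reg_al : regular_point P al%:C by apply: vert; rewrite lexx.
have [dal [e e0 off]] := reg_al.
have pal : p.[al] != 0.
  apply/eqP => pal; apply: (off al%:C); first by rewrite subrr cabs0.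
  by rewrite horner_toC pal; split=> /=.
have dpal : p^`().[al] != 0.
  by apply: contraNneq dal; rewrite deriv_toC horner_map => ->.
have [|q [qal qc] qreg] := base_curve alc pal pc dpal dpc.
  move=> x /andP[x1 x2]; apply: simple.
  by rewrite (lt_le_trans aal)// (le_lt_trans x2).
rewrite fe0 -qc; apply: (along_curve loc (ltW alc) qreg); rewrite qal.
pose q1 : {poly C} := (a%:C + v)%:P - 'i%:P * 'X.
have q1E y : q1.[y%:C] = al +i* (complex.Im v - y).
  rewrite hornerD hornerN hornerM !hornerC hornerX /al; case: (v) => v1 v2.
  apply/eqP; rewrite eq_complex /=.
  by rewrite !(mul0r, mul1r, mulr0, subr0, sub0r, addr0, add0r, opprK, oppr0) !eqxx.
have -> : al%:C = q1.[(complex.Im v)%:C] by rewrite q1E subrr.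
apply: (along_curve loc imv) => [y /andP[y0 y1]|].
  by rewrite q1E; apply: vert; rewrite subr_ge0 y1 gerBl.
have -> : q1.[0%:C] = s0 1 by rewrite hornerD hornerN hornerM !hornerC hornerX mulr0 subr0 /s0 mul1r.
apply: (reach_start (s0 := s0) (fe := fe)) => // t _; exact: fe_re.
Qed.

End Conclusion.

Theorem corollary5p5 (R : realType) (a b : R) (P : {poly R})
    (ltab : a < b) (Pa : P.[a] = 0) (Pb : P.[b] = 0)
    (simple_zeros : forall x : R, a < x < b -> root P x -> mup x P = 1%N) :
  property_E (map_poly (real_complex R) P) a%:C b%:C /\
  definite (map_poly (real_complex R) P) a%:C b%:C.
Proof.
(* every point is a zero of the zero polynomial, with [mup] equal to [0] *)
have P0 : P != 0.
  apply/eqP => P0; have mid : a < (a + b) / 2 < b by rewrite !midf_lt.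
  have := simple_zeros _ mid; rewrite P0 root0 => /(_ isT).
  rewrite /mup; case: arg_maxnP => [|i _ _ i1]; first by rewrite expr0 dvd1p.
  by have := ltn_ord i; rewrite i1 size_poly0.
have simple x : a < x < b -> P.[x] = 0 -> P^`().[x] != 0.
  move=> xab /rootP Px; have := simple_zeros x xab Px.
  apply: contra_eqN => dPx; have /factor_theorem[q PE] := Px.
  rewrite eq_sym ltn_eqF// mup_geq// PE expr2 dvdp_mul// dvdp_XsubCl.
  move: dPx; rewrite PE derivM derivB derivX derivC subr0 mulr1 hornerD hornerM.
  by rewrite hornerXsubC subrr mulr0 add0r.
by split; [exact: property_E_real|exact: definite_real].
Qed.
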